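(* Let $p$ be a prime, $G=\mathrm{U}(1,1)(\mathbb{Q}_{p^2}/\mathbb{Q}_p)$ with diagonal torus $T$ and upper-triangular Borel subgroup $B$. Let $E/\mathbb{Q}_p$ be a finite extension with ring of integers $\mathcal{O}$ and residue field $k$, large enough that $k$ contains $\mathbb{F}_{p^2}$ and $\lambda$ below. Let $\overline\chi=\mu_\lambda\omega^r:T\to k^\times$ be a smooth character, with $\lambda\in k^\times$ and $r\in\mathbb{Z}$. Assume that $\lambda\neq\pm1$ or that $r-1$ is not divisible by $p-1$. Then the morphism of functors $$\mathrm{Ind}_B^G:\mathrm{Def}_{\overline\chi}\to\mathrm{Def}_{\mathrm{Ind}_B^G\overline\chi}$$ on $\mathrm{Art}(\mathcal{O})$, sending (the class of) a lift $\chi$ of $\overline\chi$ to (the class of) $\mathrm{Ind}_B^G\chi$, is an isomorphism.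
   Context: $G=\{g\in\mathrm{GL}_2(\mathbb{Q}_{p^2}) : c(g)^tJg=J\}$ where $c$ is the nontrivial automorphism of the unramified quadratic extension $\mathbb{Q}_{p^2}/\mathbb{Q}_p$ and $J=\begin{pmatrix}0&1\\1&0\end{pmatrix}$; $T=\{t(x)=\mathrm{diag}(x,c(x)^{-1})\}$, $B=TU$ the upper-triangular matrices in $G$. $\mu_\lambda$ is the character of $\mathbb{Q}_{p^2}^\times$ trivial on $\mathbb{Z}_{p^2}^\times$ with $p\mapsto\lambda$, $\omega$ the character with $\omega(p)=1$ and $\omega(u)=\overline u$ (reduction mod $p$) for $u\in\mathbb{Z}_{p^2}^\times$, viewed as characters of $T$ via $t(x)\mapsto x$. $\mathrm{Art}(\mathcal{O})$ is the category of local Artinian $\mathcal{O}$-algebras $A$ with local structure map inducing an isomorphism of $k$ with the residue field of $A$, with local $\mathcal{O}$-algebra morphisms. For a smooth representation $\overline\pi$ of a group $H$ (here $T$ or $G$) over $k$, a lift of $\overline\pi$ to $A\in\mathrm{Art}(\mathcal{O})$ is a pair $(\pi,\phi)$ with $\pi$ a smooth $A[H]$-module free over $A$ and $\phi:\pi\to\overline\pi$ an $A[H]$-linear surjection inducing an isomorphism $\pi\otimes_Ak\cong\overline\pi$; morphisms of lifts are $A[H]$-linear maps compatible with the $\phi$'s; $\mathrm{Def}_{\overline\pi}(A)$ is the set of isomorphism classes of lifts to $A$. For a lift $\chi:T\to A^\times$ (inflated to $B$ trivially on $U$), smooth induction $\mathrm{Ind}_B^G\chi=\{f:G\to A : f(bgk)=\chi(b)f(g)$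 for $b\in B,g\in G,k\in K_f$ some compact open$\}$ with right translation action is free over $A$ and satisfies $(\mathrm{Ind}_B^G\chi)\otimes_Ak\cong\mathrm{Ind}_B^G\overline\chi$, so it is a lift of $\mathrm{Ind}_B^G\overline\chi$; this gives the morphism of functors. *)

(* Defs.v *)
From HB Require Import structures.
From mathcomp Require Import all_boot all_order all_algebra all_field.
From mathcomp Require Import all_classical.
From mathcomp Require Import topology.
From mathcomp Require Import ring.

Set Implicit Arguments.
Unset Strict Implicit.
Unset Printing Implicit Defensive.

Import Order.TTheory GRing.Theory Num.Theory.
Local Open Scope classical_set_scope.
Local Open Scope ring_scope.

(* Z_p as the inverse limit of the Z/p^n: zp_res x n is the representative in
   [0, p^n[ of x modulo p^n. *)
Record Zp (p : nat) (p_pr : prime p) : Type := MkZp {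
  zp_res :> nat -> int;
  zp_coh : `[< forall n, zp_res n = (zp_res n.+1 %% (p ^ n)%N%:Z)%Z >] }.

HB.instance Definition _ p (p_pr : prime p) := [isSub for @zp_res p p_pr].
HB.instance Definition _ p (p_pr : prime p) := [Choice of Zp p_pr by <:].

Section PadicIntegers.
Variables (p : nat) (p_pr : prime p).
Local Notation q n := ((p ^ n)%N%:Z).
Local Notation Zp := (Zp p_pr).
Implicit Types x y z : Zp.

Let q_dvd m n : (m <= n)%N -> (q m %| q n)%Z.
Proof. by move=> le_mn; rewrite dvdzE /= dvdn_exp2l. Qed.

Let modz_q m n (a : int) : (m <= n)%N -> ((a %% q n)%Z %% q m)%Z = (a %% q m)%Z.
Proof.
move=> le_mn; apply/eqP; rewrite eqz_mod_dvd.
by apply: (dvdz_trans (q_dvd le_mn)); rewrite -eqz_mod_dvd modz_mod.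
Qed.

Lemma zp_resE x m n : (m <= n)%N -> x m = (x n %% q m)%Z.
Proof.
have cx i : x i = (x i.+1 %% q i)%Z by have /asboolP := zp_coh x.
move=> /subnKC <-; elim: (n - m)%N => [|d IHd].
  by rewrite addn0 cx modz_mod.
by rewrite IHd cx modz_q ?leq_addr // addnS.
Qed.

Lemma zp_resmod x n : (x n %% q n)%Z = x n.
Proof. by rewrite -zp_resE. Qed.

Let mk_coh (f : nat -> int) :
  (forall n, f n.+1 = f n %[mod q n])%Z ->
  `[< forall n, (f n %% q n)%Z = ((f n.+1 %% q n.+1)%Z %% q n)%Z >].
Proof. by move=> cf; apply/asboolP => n; rewrite modz_q // cf. Qed.

Definition mk_zp f cf : Zp := MkZp p_pr (@mk_coh f cf).

Let zpP x y : (forall n, x n = y n %[mod q n])%Z -> x = y.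
Proof. by move=> xy; apply/val_inj/funext => n; rewrite /= -[LHS]zp_resmod xy zp_resmod. Qed.

Let cst_coh (a : int) n : ((fun=> a) n.+1 = (fun=> a) n %[mod q n])%Z.
Proof. by []. Qed.

Let add_coh x y n : (x n.+1 + y n.+1 = x n + y n %[mod q n])%Z.
Proof. by rewrite (zp_resE x (leqnSn n)) (zp_resE y (leqnSn n)) modzDml modzDmr. Qed.

Let opp_coh x n : (- x n.+1 = - x n %[mod q n])%Z.
Proof. by rewrite (zp_resE x (leqnSn n)) modzNm. Qed.

Let mul_coh x y n : (x n.+1 * y n.+1 = x n * y n %[mod q n])%Z.
Proof. by rewrite (zp_resE x (leqnSn n)) (zp_resE y (leqnSn n)) modzMml modzMmr. Qed.

Definition zp0 := mk_zp (cst_coh 0).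
Definition zp1 := mk_zp (cst_coh 1).
Definition zp_add x y := mk_zp (add_coh x y).
Definition zp_opp x := mk_zp (opp_coh x).
Definition zp_mul x y := mk_zp (mul_coh x y).

Let addA : associative zp_add.
Proof. by move=> x y z; apply: zpP => n /=; rewrite !modz_mod modzDml modzDmr addrA. Qed.
Let addC : commutative zp_add.
Proof. by move=> x y; apply: zpP => n /=; rewrite addrC. Qed.
Let add0 : left_id zp0 zp_add.
Proof. by move=> x; apply: zpP => n /=; rewrite modz_mod modzDml add0r. Qed.
Let addN : left_inverse zp0 zp_opp zp_add.
Proof. by move=> x; apply: zpP => n /=; rewrite !modz_mod modzDml addNr. Qed.
HB.instance Definition _ := GRing.isZmodule.Build Zp addA addC add0 addN.

Let mulA : associative zp_mul.
Proof. by move=> x y z; apply: zpP => n /=; rewrite !modz_mod modzMml modzMmr mulrA. Qed.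
Let mulC : commutative zp_mul.
Proof. by move=> x y; apply: zpP => n /=; rewrite mulrC. Qed.
Let mul1 : left_id zp1 zp_mul.
Proof. by move=> x; apply: zpP => n /=; rewrite modz_mod modzMml mul1r. Qed.
Let mulD : left_distributive zp_mul zp_add.
Proof.
move=> x y z; apply: zpP => n /=.
by rewrite !modz_mod modzMml modzDml modzDmr mulrDl.
Qed.
Let one_neq0 : zp1 != zp0.
Proof.
apply/eqP => /(congr1 (fun x : Zp => x 1%N)) /=.
rewrite expn1 mod0z modz_small //=.
by rewrite ltz_nat prime_gt1.
Qed.
HB.instance Definition _ :=
  GRing.Zmodule_isComNzRing.Build Zp mulA mulC mul1 mulD one_neq0.

Let zp_unit : pred Zp := fun x => `[< exists y, y * x = 1 >].
Let zp_inv x : Zp :=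
  if pselect (exists y, y * x = 1) is left ex then projT1 (cid ex) else x.

Let mulV : {in zp_unit, left_inverse 1 zp_inv *%R}.
Proof.
move=> x /asboolP ux; rewrite /zp_inv; case: pselect => // ex.
by case: (cid ex).
Qed.
Let unitPl x y : y * x = 1 -> zp_unit x.
Proof. by move=> yx1; apply/asboolP; exists y. Qed.
Let inv_out : {in [predC zp_unit], zp_inv =1 id}.
Proof.
move=> x /negP nux; rewrite /zp_inv; case: pselect => // ux.
by case: nux; apply/asboolP.
Qed.
HB.instance Definition _ :=
  GRing.ComNzRing_hasMulInverse.Build Zp mulV unitPl inv_out.

Let ndvd x : x != 0 -> exists a, forall n, (a <= n)%N -> ~~ (q a %| x n)%Z.
Proof.
move=> x0; have [a xa] : exists a, x a != 0.
  apply: contrapT => /forallNP ex; case/eqP: x0; apply: zpP => n.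
  by rewrite /= modz_mod; case: (eqVneq (x n) 0) => [-> //|/ex].
exists a => n le_an; apply/dvdz_mod0P; rewrite -zp_resE //; exact/eqP.
Qed.

Let dvd_cancel a n (m t : int) :
  ~~ (q a %| m)%Z -> (q (a + n) %| m * t)%Z -> (q n %| t)%Z.
Proof.
have [->|t0] := eqVneq t 0; first by rewrite dvdz0.
have [->|m0] := eqVneq m 0; first by rewrite dvdz0.
rewrite !dvdzE /= abszM !pfactor_dvdn ?muln_gt0 ?absz_gt0 ?t0 ?m0 //.
rewrite lognM ?absz_gt0 // -ltnNge => lt_ma le.
by rewrite -(leq_add2l a); apply: (leq_trans le); rewrite leq_add2r ltnW.
Qed.

Let mulf_eq0 x y : x * y = 0 -> (x == 0) || (y == 0).
Proof.
move=> xy0; apply/norP => -[/ndvd[a xa] /ndvd[b yb]].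
have := yb (a + b)%N (leq_addl _ _); apply/negP/negPn.
apply: dvd_cancel (xa (a + b)%N (leq_addr _ _)) _.
by apply/dvdz_mod0P; have /(congr1 (fun z : Zp => z (a + b)%N)) := xy0; rewrite /= mod0z.
Qed.
HB.instance Definition _ := GRing.ComUnitRing_isIntegral.Build Zp mulf_eq0.

Lemma zp_natE n i : (n%:R : Zp) i = (n%:Z %% q i)%Z.
Proof.
elim: n => [|n IHn] //; rewrite -natr1.
change ((((n%:R : Zp) i + (1 : Zp) i) %% q i)%Z = (n.+1%:Z %% q i)%Z).
by rewrite IHn /= modzDml modzDmr intS addrC.
Qed.

Lemma zp_dvd_pexp x : x != 0 -> exists a y, x * y = (p ^ a)%:R.
Proof.
move=> /ndvd[a xa]; exists a.
have exu n : exists u, (q (a + n) %| x (a + n)%N * u - q a)%Z.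
  pose m := x (a + n)%N; have [u [v uv]] := Bezoutz m (q (a + n)).
  have /dvdzP[w qaE] : (gcdz m (q (a + n)) %| q a)%Z.
    have := xa _ (leq_addr n a); rewrite -/m !dvdzE /=.
    have /(dvdn_pfactor _ _ p_pr)[c _ gE] := dvdn_gcdr `|m| (p ^ (a + n)).
    rewrite gE; apply: contraR => /negP nd.
    apply: (@dvdn_trans (p ^ c)); last by rewrite -gE dvdn_gcdl.
    by apply: dvdn_exp2l; rewrite leqNgt; apply/negP => /ltnW /(dvdn_exp2l p).
  exists (w * u); rewrite qaE -uv; apply/dvdzP; exists (- (w * v)).
  by rewrite -/m; ring.
pose u n := projT1 (cid (exu n)).
have uP n : (q (a + n) %| x (a + n)%N * u n - q a)%Z by rewrite /u; case: cid.
have cu n : (u n.+1 = u n %[mod q n])%Z.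
  apply/eqP; rewrite eqz_mod_dvd; apply: dvd_cancel (xa _ (leq_addr n a)) _.
  have dx : (q (a + n) %| x (a + n).+1 - x (a + n)%N)%Z.
    by rewrite -eqz_mod_dvd (zp_resE x (leqnSn (a + n))) modz_mod.
  have duS : (q (a + n) %| x (a + n).+1 * u n.+1 - q a)%Z.
    rewrite -addnS; apply: (dvdz_trans _ (uP n.+1)).
    by apply: q_dvd; rewrite leq_add2l.
  have -> : x (a + n)%N * (u n.+1 - u n) = (x (a + n).+1 * u n.+1 - q a)
      - (x (a + n)%N * u n - q a) - (x (a + n).+1 - x (a + n)%N) * u n.+1.
    by ring.
  by apply: rpredB; [apply: rpredB|apply: dvdz_mulr].
exists (mk_zp cu); apply: zpP => n.
rewrite zp_natE /= !modz_mod modzMmr; apply/eqP.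
rewrite (zp_resE x (leq_addl a n)) modzMml eqz_mod_dvd.
by apply: dvdz_trans (uP n); apply: q_dvd; rewrite leq_addl.
Qed.

End PadicIntegers.

Definition Qp (p : nat) (p_pr : prime p) : fieldType := {fraction Zp p_pr}.

Section FractionRep.
Import FracField.
Local Open Scope quotient_scope.
Lemma fracP (R : idomainType) (x : {fraction R}) :
  exists n d, d != 0 /\ tofrac d * x = tofrac n.
Proof.
exists (repr x).1, (repr x).2; split; first exact: denom_ratioP.
rewrite -{2}[x]reprK; unlock tofrac; rewrite -[LHS]pi_mul.
apply/eqmodP; rewrite /= equivfE /mulf /=.
by rewrite !numden_Ratio ?oner_eq0 ?mul1r ?mulr1 ?denom_ratioP ?reprK.
Qed.
End FractionRep.

Section IntegerRing.
Variables (p : nat) (p_pr : prime p) (L : fieldExtType (Qp p_pr)).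

Definition Zp_to_ext : Zp p_pr -> L :=
  GRing.in_alg L \o (@FracField.tofrac (Zp p_pr)).
HB.instance Definition _ := GRing.RMorphism.on Zp_to_ext.

Definition integral : {pred L} := fun x => `[< integralOver Zp_to_ext x >].

Lemma integral_subring : subring_closed integral.
Proof.
split; first by apply/asboolP/integral1.
- by move=> x y /asboolP ix /asboolP iy; apply/asboolP/integral_sub.
- by move=> x y /asboolP ix /asboolP iy; apply/asboolP/integral_mul.
Qed.
HB.instance Definition _ :=
  GRing.isSubringClosed.Build L integral integral_subring.

Record intring := MkIntring {
  intring_val :> L;
  intring_valP : intring_val \in integral }.

HB.instance Definition _ := [isSub for intring_val].
HB.instance Definition _ := [Choice of intring by <:].
HB.instance Definition _ :=
  GRing.SubChoice_isSubComNzRing.Build L integral intring integral_subring.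

Lemma Qp_clear_denom (x : Qp p_pr) :
  exists m, (p ^ m)%:R * (x%:A : L) \in integral.
Proof.
have [n [d [d0 dx]]] := fracP x.
have [m [e de]] := zp_dvd_pexp d0; exists m.
have -> : (p ^ m)%:R * (x%:A : L) = Zp_to_ext (n * e).
  rewrite /Zp_to_ext /= tofracM -dx -mulrAC -tofracM de rmorph_nat.
  by rewrite -scalerA scaler_nat mulr_natl.
by apply/asboolP/integral_id.
Qed.

Lemma clear_denom (x : L) : exists m, (p ^ m)%:R * x \in integral.
Proof.
have [P [monP Px0 intP]] : exists P : {poly L}, [/\ P \is monic, root P x &
    forall i, exists m, (p ^ m)%:R * P`_i \in integral].
  have /polyOver1P[P0 P0E] := minPolyOver 1 x.
  exists (minPoly 1 x); split; [exact: monic_minPoly|exact: root_minPoly|].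
  move=> i; rewrite P0E coef_map /=.
  exact: Qp_clear_denom.
pose m i := projT1 (cid (intP i)).
have mP i : (p ^ m i)%:R * P`_i \in integral by rewrite /m; case: cid.
pose M := (\sum_(i < size P) m i)%N; exists M.
have MP i : (p ^ M)%:R * P`_i \in integral.
  have [ltiP|leP] := ltnP i (size P); last by rewrite nth_default // mulr0 rpred0.
  rewrite /M (bigD1 (Ordinal ltiP)) //= addnC expnD natrM -mulrA.
  by rewrite rpredM // rpred_nat.
pose a : L := (p ^ M)%:R; pose n := (size P).-1.
have sP : size P = n.+1 by rewrite prednK // size_poly_gt0 monic_neq0.
pose Q := \poly_(i < n.+1) (P`_i * a ^+ (n - i)).
have Qn : Q`_n = 1.
  rewrite coef_poly ltnSn subnn expr0 mulr1.
  by move: monP; rewrite monicE /lead_coef sP => /eqP.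
have sQ : size Q = n.+1.
  apply/eqP; rewrite eqn_leq size_poly /=.
  by rewrite ltnNge; apply/negP => /leq_sizeP/(_ n (leqnn _)); rewrite Qn; apply/eqP/oner_neq0.
apply/asboolP; apply: (@integral_root_monic _ _ _ _ Q).
- by rewrite monicE /lead_coef sQ Qn.
- apply/rootP; rewrite horner_poly.
  transitivity (a ^+ n * P.[x]); last by rewrite (rootP Px0) mulr0.
  rewrite horner_coef sP big_distrr /=; apply: eq_bigr => i _.
  have le_in : (i <= n)%N by rewrite -ltnS.
  by rewrite -/a exprMn -[X in a ^+ X * _](subnK le_in) exprD; ring.
- move=> z /(nthP 0)[i]; rewrite sQ => lti <-; apply/asboolP; rewrite -[`[< _ >]]/(_ \in integral).
  rewrite coef_poly lti; have [->|ne] := eqVneq i n.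
    rewrite subnn expr0 mulr1; move: monP.
    by rewrite monicE /lead_coef sP => /eqP ->; apply: rpred1.
  have -> : (n - i = (n - i).-1.+1)%N by rewrite prednK // subn_gt0 ltn_neqAle ne -ltnS.
  by rewrite exprS mulrA [_ * a]mulrC rpredM // rpredX // rpred_nat.
Qed.

End IntegerRing.

Section AdicTopology.
Variables (p : nat) (p_pr : prime p) (L : fieldExtType (Qp p_pr)).

(* L with its p-adic topology; the balls x + p^n O_L are a basis of neighbourhoods. *)
Definition adic : Type := L.
HB.instance Definition _ := Choice.on adic.

Definition adic_ball (x : L) (n : nat) : set L :=
  [set y | exists2 z, z \in @integral _ _ L & y - x = (p ^ n)%:R * z].

Lemma adic_ball_center x n : adic_ball x n x.
Proof. by exists 0; rewrite ?rpred0 ?mulr0 ?subrr. Qed.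

Lemma adic_ball_trans x y z n :
  adic_ball x n y -> adic_ball y n z -> adic_ball x n z.
Proof.
move=> [u iu yx] [v iv zy]; exists (u + v); first exact: rpredD.
by rewrite mulrDr -yx -zy; ring.
Qed.

Lemma le_adic_ball x m n : (m <= n)%N -> adic_ball x n `<=` adic_ball x m.
Proof.
move=> /subnKC <- y [z iz yx]; exists ((p ^ (n - m))%:R * z).
  by rewrite rpredM // rpred_nat.
by rewrite yx expnD natrM mulrA.
Qed.

HB.instance Definition _ :=
  hasNbhs.Build adic (fun x => filter_from setT (adic_ball x)).

Let adic_filter (x : adic) : ProperFilter (nbhs x).
Proof.
apply: filter_from_proper; last by move=> n _; exists x; exact: adic_ball_center.
apply: filter_from_filter; first by exists 0%N.
move=> m n _ _; exists (maxn m n) => // y By.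
by split; apply: le_adic_ball By; rewrite ?leq_maxl ?leq_maxr.
Qed.

Let adic_singleton (x : adic) (A : set adic) : nbhs x A -> A x.
Proof. by move=> [n _]; apply; apply: adic_ball_center. Qed.

Let adic_nbhs (x : adic) (A : set adic) : nbhs x A -> nbhs x (nbhs^~ A).
Proof.
move=> [n _ BA]; exists n => // y xy; exists n => // z yz.
by apply: BA; apply: adic_ball_trans xy yz.
Qed.

HB.instance Definition _ :=
  Nbhs_isNbhsTopological.Build adic adic_filter adic_singleton adic_nbhs.

End AdicTopology.

Lemma mulmx_continuous_aux (R : comNzRingType) (a b m n z : R) :
  a * (m * n * z) * b = n * (m * (a * b) * z).
Proof. by ring. Qed.

(* No compatibility between the two structures is imposed; only U11 and torus,
   with their p-adic topologies, are used. *)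
#[short(type="groupTopType")]
HB.structure Definition GroupTop := {G of Group G & Topological G}.

Section UnitaryGroup.
Variables (p : nat) (p_pr : prime p) (L : fieldExtType (Qp p_pr)).
Variable c : {lrmorphism L -> L}.

Definition Jmx : 'M[L]_2 := \matrix_(i, j) (i != j)%:R.

Record U11 := MkU11 {
  u11_mx :> 'M[L]_2;
  u11P : (u11_mx \in unitmx) && ((map_mx c u11_mx)^T *m Jmx *m u11_mx == Jmx) }.

HB.instance Definition _ := [isSub for u11_mx].
HB.instance Definition _ := [Choice of U11 by <:].

Let u11_oneP : ((1%:M : 'M[L]_2) \in unitmx) &&
  ((map_mx c 1%:M)^T *m Jmx *m 1%:M == Jmx).
Proof. by rewrite unitmx1 map_mx1 trmx1 mul1mx mulmx1 eqxx. Qed.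

Let u11_mulP (g h : U11) : (g *m h \in unitmx) &&
  ((map_mx c (g *m h))^T *m Jmx *m (g *m h) == Jmx).
Proof.
case: g h => [g /andP[ug /eqP gJ]] [h /andP[uh /eqP hJ]] /=.
rewrite unitmx_mul ug uh map_mxM trmx_mul; apply/eqP.
set g' := (map_mx c g)^T; set h' := (map_mx c h)^T.
have -> : h' *m g' *m Jmx *m (g *m h) = h' *m (g' *m Jmx *m g) *m h.
  by rewrite !mulmxA.
by rewrite gJ hJ.
Qed.

Let u11_invP (g : U11) : (invmx g \in unitmx) &&
  ((map_mx c (invmx g))^T *m Jmx *m invmx g == Jmx).
Proof.
case: g => [g /andP[ug /eqP gJ]] /=; rewrite unitmx_inv ug; apply/eqP.
rewrite -[X in _ *m X *m _]gJ; set g' := (map_mx c g)^T.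
set h' := (map_mx c (invmx g))^T.
have -> : h' *m (g' *m Jmx *m g) *m invmx g = (h' *m g') *m Jmx *m (g *m invmx g).
  by rewrite !mulmxA.
rewrite mulmxV // mulmx1 -trmx_mul -map_mxM mulmxV // map_mx1 trmx1.
by rewrite mul1mx.
Qed.

Definition u11_one := MkU11 u11_oneP.
Definition u11_mul g h := MkU11 (u11_mulP g h).
Definition u11_inv g := MkU11 (u11_invP g).

Let u11_unit (g : U11) : (g : 'M_2) \in unitmx.
Proof. by case/andP: (u11P g). Qed.
Let mulA : associative u11_mul.
Proof. by move=> g h k; apply: val_inj; apply: mulmxA. Qed.
Let mul1 : left_id u11_one u11_mul.
Proof. by move=> g; apply: val_inj; apply: mul1mx. Qed.
Let mul_1 : right_id u11_one u11_mul.
Proof. by move=> g; apply: val_inj; apply: mulmx1. Qed.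
Let mulV : left_inverse u11_one u11_inv u11_mul.
Proof. by move=> g; apply: val_inj; apply: mulVmx. Qed.
Let mul_V : right_inverse u11_one u11_inv u11_mul.
Proof. by move=> g; apply: val_inj; apply: mulmxV. Qed.
HB.instance Definition _ := isGroup.Build U11 mulA mul1 mul_1 mulV mul_V.

HB.instance Definition _ := Topological.copy U11
  (initial_topology (fun g : U11 => (u11_mx g : 'M[adic L]_2))).

Definition torus_mx (x : L) : 'M[L]_2 :=
  \matrix_(i, j) (if i != j then 0 else if i == 0 then x else (c x)^-1).

Definition in_torus : {pred U11} :=
  fun g => `[< exists2 x, x != 0 & u11_mx g = torus_mx x >].

Lemma in_torus_closed : group_closed in_torus.
Proof.
split=> [|g h /asboolP[x x0 gx] /asboolP[y y0 hy]]; apply/asboolP.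
  exists 1; rewrite ?oner_neq0 //=; apply/matrixP => i j; rewrite !mxE.
  by rewrite rmorph1 invr1 if_same; case: eqVneq.
exists (x / y); first by rewrite mulf_neq0 ?invr_neq0.
have cy0 : c y != 0 by rewrite fmorph_eq0.
suff : (u11_mx (g / h)%g *m torus_mx y = torus_mx (x / y) *m torus_mx y).
  by rewrite -hy => /(can_inj (mulmxK (u11_unit h))).
rewrite -{1}hy /= mulmxKV // gx; apply/matrixP => i j; rewrite !mxE.
rewrite !big_ord_recl big_ord0 /= !mxE.
move: i j => [[|[|i]] // ?] [[|[|j]] // ?] /=;
  rewrite ?mulr0 ?mul0r ?addr0 ?add0r //; first by rewrite divfK.
by rewrite rmorphM fmorphV invfM invrK mulfK.
Qed.

Record torus := MkTorus { torus_val :> U11; torusP : torus_val \in in_torus }.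
HB.instance Definition _ := [isSub for torus_val].
HB.instance Definition _ := [Choice of torus by <:].
HB.instance Definition _ :=
  SubChoice_isSubGroup.Build U11 in_torus torus in_torus_closed.
HB.instance Definition _ := Topological.copy torus (initial_topology torus_val).

(* t(x) |-> x *)
Definition torus_coord (t : torus) : L := u11_mx t 0 0.

Definition in_borel (g : U11) : Prop := u11_mx g 1 0 = 0.
Definition in_unipotent (g : U11) : Prop :=
  [/\ in_borel g, u11_mx g 0 0 = 1 & u11_mx g 1 1 = 1].

Lemma mulmx_continuous (A B : 'M[L]_2) :
  continuous (fun X : 'M[adic L]_2 => (A *m X *m B : 'M[adic L]_2)).
Proof.
pose e i j k l := projT1 (cid (@clear_denom _ _ L (A i k * B l j))).
have eP i j k l : (p ^ e i j k l)%:R * (A i k * B l j) \in @integral _ _ L.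
  by rewrite /e; case: cid.
pose M := (\sum_i \sum_j \sum_k \sum_l e i j k l)%N.
have MP i j k l : (p ^ M)%:R * (A i k * B l j) \in @integral _ _ L.
  have : (e i j k l <= M)%N.
    rewrite /M (bigD1 i) //= (bigD1 j) //= (bigD1 k) //= (bigD1 l) //=.
    by rewrite -!addnA leq_addr.
  move=> /subnK <-; rewrite expnD natrM -mulrA.
  by rewrite rpredM // rpred_nat.
move=> X W [P PX sub].
have exn i j : exists n, adic_ball ((A *m X *m B) i j) n `<=` P i j.
  by have [n _ h] := PX i j; exists n.
pose n i j := projT1 (cid (exn i j)).
have nP i j : adic_ball ((A *m X *m B) i j) (n i j) `<=` P i j.
  by rewrite /n; case: cid.
exists (fun k l => adic_ball (X k l) (M + \sum_i \sum_j n i j)).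
  by move=> k l; exists (M + \sum_i \sum_j n i j)%N.
move=> Y XY; apply: sub => i j /=; apply: nP.
apply: (@le_adic_ball _ _ _ _ _ (\sum_i \sum_j n i j)%N).
  by rewrite (bigD1 i) //= (bigD1 j) //= -!addnA leq_addr.
set N := (\sum_i \sum_j n i j)%N.
have exz k l : exists z, z \in @integral _ _ L /\ Y k l - X k l = (p ^ (M + N))%:R * z.
  by have [z iz zE] := XY k l; exists z.
pose z k l := projT1 (cid (exz k l)).
have zP k l : z k l \in @integral _ _ L by rewrite /z; case: cid => ? [].
have zE k l : Y k l - X k l = (p ^ (M + N))%:R * z k l.
  by rewrite /z; case: cid => ? [].
exists (\sum_l \sum_k (p ^ M)%:R * (A i k * B l j) * z k l).
  by apply: rpred_sum => l _; apply: rpred_sum => k _; apply: rpredM.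
have -> : (A *m Y *m B) i j - (A *m X *m B) i j = (A *m (Y - X) *m B) i j.
  by rewrite mulmxBr mulmxBl !mxE.
rewrite mxE mulr_sumr; apply: eq_bigr => l _.
rewrite mxE mulr_suml mulr_sumr; apply: eq_bigr => k _.
by rewrite !mxE zE expnD natrM mulmx_continuous_aux.
Qed.

Lemma u11_open_translate (g h : U11) (K : set U11) :
  open K -> open [set x : U11 | K (g * x * h)%g].
Proof.
move=> [V oV <-].
exists [set X : 'M[adic L]_2 | V (u11_mx g *m X *m u11_mx h)] => //.
by apply: open_comp oV => X _; apply: mulmx_continuous.
Qed.

End UnitaryGroup.

Section CommutativeAlgebra.
Variable R : comNzRingType.

Definition is_unit (x : R) : Prop := exists y, x * y = 1.

Definition ideal (I : set R) : Prop :=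
  [/\ I 0, forall x y, I x -> I y -> I (x + y) & forall a x, I x -> I (a * x)].

Definition maximal_ideal (M : set R) : Prop :=
  [/\ ideal M, ~ M 1 & forall I, ideal I -> M `<=` I -> ~ I 1 -> I = M].

Definition local_ring : Prop := exists! M : set R, maximal_ideal M.

Definition artinian : Prop := forall I : nat -> set R,
  (forall n, ideal (I n)) -> (forall n, I n.+1 `<=` I n) ->
  exists n, forall m, (n <= m)%N -> I m = I n.

Definition free_module (V : lmodType R) : Prop := exists B : set V,
  (forall (s : seq V) (a : V -> R), uniq s -> (forall v, v \in s -> B v) ->
     \sum_(v <- s) a v *: v = 0 -> forall v, v \in s -> a v = 0) /\
  (forall w, exists (s : seq V) (a : V -> R),
     (forall v, v \in s -> B v) /\ w = \sum_(v <- s) a v *: v).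
End CommutativeAlgebra.

(* W together with j is S (x)_R V, by its universal property. *)
Definition is_base_change (R S : comNzRingType) (f : {rmorphism R -> S})
    (V : lmodType R) (W : lmodType S) (j : {linear V -> W | f \; *:%R}) : Prop :=
  forall (X : lmodType S) (u : {linear V -> X | f \; *:%R}),
  exists2 w : {linear W -> X}, (forall v, w (j v) = u v)
    & forall w' : {linear W -> X}, (forall v, w' (j v) = u v) -> w' =1 w.

(* The objects of Art(O), for k the residue field of O with reduction map red.
   aug is the composite A -> A/m_A ~ k; it is determined by the algebra A: its
   kernel is maximal, hence equal to m_A, and aug_red fixes the identification
   of A/m_A with k to be the inverse of the one induced by O -> A. *)
Record art (O : comNzRingType) (k : fieldType) (red : {rmorphism O -> k}) := Art {
  art_alg :> comAlgType O;
  art_local : local_ring art_alg;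
  art_artinian : artinian art_alg;
  aug : {rmorphism art_alg -> k};
  aug_red : forall x : O, aug x%:A = red x }.

Definition local_hom (R S : comNzRingType) (f : R -> S) : Prop :=
  forall x, is_unit (f x) -> is_unit x.

Record rep (R : comNzRingType) (H : groupType) := Rep {
  rep_mod :> lmodType R;
  act : H -> {linear rep_mod -> rep_mod};
  act1 : forall v, act 1%g v = v;
  actM : forall g h v, act (g * h)%g v = act g (act h v) }.

Definition smooth (R : comNzRingType) (H : groupTopType) (V : rep R H) : Prop :=
  forall v : V, open [set h : H | act V h v = v].

Section Deformations.
Variables (O : comNzRingType) (k : fieldType) (red : {rmorphism O -> k}).
Variables (H : groupTopType) (pibar : rep k H).

(* A pair (pi, phi) with phi A[H]-linear, before the conditions of is_lift. *)
Record prelift (A : art red) := Prelift {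
  lift_rep :> rep A H;
  lift_map : {linear lift_rep -> pibar | aug A \; *:%R};
  lift_mapE : forall h v, lift_map (act lift_rep h v) = act pibar h (lift_map v) }.

(* is_base_change (lift_map V) says that phi induces V (x)_A k ~ pibar. *)
Definition is_lift (A : art red) (V : prelift A) : Prop :=
  [/\ smooth V, free_module V, (forall w, exists v, lift_map V v = w)
    & is_base_change (lift_map V)].

Definition lift_iso (A : art red) (V W : prelift A) : Prop :=
  exists h : {linear V -> W}, [/\ bijective h,
    forall g v, h (act V g v) = act W g (h v) &
    forall v, lift_map W (h v) = lift_map V v].

(* The set of isomorphism classes of lifts, a class being the collection of its
   members. *)
Definition Def (A : art red) : Type := {X : prelift A -> Prop |
  exists2 V, is_lift V & X = (fun W => is_lift W /\ lift_iso V W)}.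

(* The graph of Def(f) : Def(A) -> Def(B), V |-> V (x)_A B. *)
Definition Def_map (A B : art red) (f : {lrmorphism A -> B})
    (X : Def A) (Y : Def B) : Prop :=
  exists V W, [/\ sval X V, sval Y W &
    exists j : {linear V -> W | f \; *:%R}, [/\
      forall h v, j (act V h v) = act W h (j v),
      forall v, lift_map W (j v) = lift_map V v & is_base_change j]].
End Deformations.

(* p generates the maximal ideal of O_L. *)
Definition unramified (p : nat) (p_pr : prime p) (L : fieldExtType (Qp p_pr)) :=
  maximal_ideal (range (fun y : intring L => p%:R * y)).

Section Induction.
Variables (p : nat) (p_pr : prime p) (L : fieldExtType (Qp p_pr)).
Variable c : {lrmorphism L -> L}.
Local Notation G := (U11 c).
Local Notation T := (torus c).

Definition open_subgroup (K : set G) : Prop :=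
  [/\ open K, K 1%g & forall x y, K x -> K y -> K (x * y^-1)%g].

Section Module.
Variables (R : comNzRingType) (sigma : rep R T).

(* sigma is inflated to B = TU trivially on U: b acts as any t with b in tU.
   For sigma = A with T acting through chi this is Ind_B^G chi.  An open subgroup
   K may be shrunk to a compact open one, G being locally profinite. *)
Definition in_ind : {pred (G -> sigma)} := fun f => `[<
  (forall (b g : G) (t : T), in_borel b -> in_unipotent ((t : G)^-1 * b)%g ->
     f (b * g)%g = act sigma t (f g)) /\
  (exists2 K, open_subgroup K & forall g x, K x -> f (g * x)%g = f g) >].

Lemma in_ind_closed : subsemimod_closed in_ind.
Proof.
have ind0 : (0 : G -> sigma) \in in_ind.
  apply/asboolP; split=> [b g t _ _|]; first by rewrite [RHS]linear0.
  by exists setT => //; split=> //; exact: openT.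
split; first split=> // f f' /asboolP[fB [K [oK K1 KV] fK]]
    /asboolP[fB' [K' [oK' K'1 KV'] fK']].
- apply/asboolP; split=> [b g t bB btU|].
    by rewrite [LHS](congr2 _ (fB _ _ _ bB btU) (fB' _ _ _ bB btU)) -linearD.
  exists (K `&` K'); first split.
  - exact: openI.
  - by [].
  - by move=> x y [? ?] [? ?]; split; [apply: KV|apply: KV'].
  by move=> g x [Kx K'x]; rewrite [LHS](congr2 _ (fK _ _ Kx) (fK' _ _ K'x)).
move=> a f /asboolP[fB [K oK fK]]; apply/asboolP; split=> [b g t bB btU|].
  by rewrite [LHS](congr1 _ (fB _ _ _ bB btU)) -linearZ.
by exists K => // g x Kx; rewrite [LHS](congr1 _ (fK _ _ Kx)).
Qed.

Record ind := MkInd { ind_fun :> G -> sigma; indP : ind_fun \in in_ind }.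
HB.instance Definition _ := [isSub for ind_fun].
HB.instance Definition _ := [Choice of ind by <:].
HB.instance Definition _ :=
  GRing.SubChoice_isSubLmodule.Build R (G -> sigma) in_ind ind in_ind_closed.

Lemma ind_transP (g : G) (f : ind) : (fun x : G => f (x * g)%g) \in in_ind.
Proof.
have /asboolP[fB [K [oK K1 KV] fK]] := indP f; apply/asboolP; split.
  by move=> b h t bB btU; rewrite -mulgA (fB _ _ _ bB btU).
exists [set x | K (g^-1 * x * g)%g]; first split=> /=.
- exact: u11_open_translate.
- by rewrite mulg1 mulVg.
- move=> x y Kx Ky; have := KV _ _ Kx Ky.
  by rewrite !invgM invgK !mulgA mulgK.
by move=> h x Kx; rewrite -(fK (h * g)%g _ Kx) !mulgA mulgK.
Qed.

Definition ind_act (g : G) (f : ind) : ind := MkInd (ind_transP g f).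

Lemma ind_act_linear g : linear (ind_act g).
Proof. by move=> a f f'; apply: val_inj. Qed.
HB.instance Definition _ g :=
  GRing.isLinear.Build R ind ind *:%R (ind_act g) (ind_act_linear g).

Lemma ind_act1 f : ind_act 1%g f = f.
Proof. by apply/val_inj/funext => x /=; rewrite mulg1. Qed.
Lemma ind_actM g h f : ind_act (g * h)%g f = ind_act g (ind_act h f).
Proof. by apply/val_inj/funext => x /=; rewrite mulgA. Qed.

Definition Ind : rep R G := @Rep R G ind ind_act ind_act1 ind_actM.
End Module.

Section Lifts.
Variables (O : comNzRingType) (k : fieldType) (red : {rmorphism O -> k}).
Variables (chibar : rep k T) (A : art red) (V : prelift chibar A).

Lemma ind_compP (f : ind V) : (fun g : G => lift_map V (f g)) \in @in_ind k chibar.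
Proof.
have /asboolP[fB [K oK fK]] := indP f; apply/asboolP; split.
  by move=> b h t bB btU; rewrite (fB _ _ _ bB btU) lift_mapE.
by exists K => // g x Kx; rewrite fK.
Qed.

Definition ind_comp (f : Ind V) : Ind chibar := MkInd (ind_compP f).

Lemma ind_comp_linear : linear_for (aug A \; *:%R) ind_comp.
Proof.
by move=> a f f'; apply/val_inj/funext => g /=; rewrite linearP.
Qed.
HB.instance Definition _ := GRing.isLinear.Build A (Ind V) (Ind chibar)
  (aug A \; *:%R) ind_comp ind_comp_linear.

Lemma ind_compE g (f : Ind V) :
  ind_comp (act (Ind V) g f) = act (Ind chibar) g (ind_comp f).
Proof. by apply: val_inj. Qed.

(* (sigma, phi) |-> (Ind sigma, f |-> phi o f). *)
Definition Ind_lift : prelift (Ind chibar) A :=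
  @Prelift _ _ red G (Ind chibar) A (Ind V) ind_comp ind_compE.
End Lifts.
End Induction.

Section Characters.
Variables (p : nat) (p_pr : prime p) (L : fieldExtType (Qp p_pr)) (k : fieldType).

(* Characters of L^*; the value at 0 is irrelevant. *)
Record mchar := MChar {
  mchar_fun :> L -> k;
  mchar1 : mchar_fun 1 = 1;
  mcharM : forall x y, x != 0 -> y != 0 ->
    mchar_fun (x * y) = mchar_fun x * mchar_fun y }.

Lemma mchar_neq0 (chi : mchar) x : x != 0 -> chi x != 0.
Proof.
move=> x0; have : chi x * chi x^-1 != 0.
  by rewrite -mcharM ?invr_eq0 // mulfV // mchar1 oner_neq0.
by rewrite mulf_eq0 negb_or => /andP[].
Qed.

(* mu * omega^r *)
Definition twist_fun (mu omega : mchar) (r : int) (x : L) := mu x * omega x ^ r.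
Lemma twist1 mu omega r : twist_fun mu omega r 1 = 1.
Proof. by rewrite /twist_fun !mchar1 exp1rz mul1r. Qed.
Lemma twistM mu omega r x y : x != 0 -> y != 0 ->
  twist_fun mu omega r (x * y) = twist_fun mu omega r x * twist_fun mu omega r y.
Proof.
move=> x0 y0; rewrite /twist_fun !mcharM // expfzMl; ring.
Qed.
Definition twist mu omega r := MChar (twist1 mu omega r) (@twistM mu omega r).

Definition is_mu (lambda : k) (mu : mchar) : Prop :=
  mu p%:R = lambda /\ forall u : intring L, is_unit u -> mu (u : L) = 1.

Definition is_omega (res : intring L -> k) (omega : mchar) : Prop :=
  omega p%:R = 1 /\ forall u : intring L, is_unit u -> omega (u : L) = res u.

Variable (c : {lrmorphism L -> L}) (chi : mchar).

Lemma torus_coord_neq0 (t : torus c) : torus_coord t != 0.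
Proof.
have /asboolP[x x0 tx] := torusP t.
by rewrite /torus_coord tx mxE.
Qed.

Lemma torus_coordM (s t : torus c) :
  torus_coord (s * t)%g = torus_coord s * torus_coord t.
Proof.
have /asboolP[x x0 tx] := torusP t.
rewrite /torus_coord /= mxE !big_ord_recl big_ord0 /= addr0.
by rewrite [X in _ + _ * X](_ : _ = 0) ?mulr0 ?addr0 // tx mxE.
Qed.

Definition char_act (t : torus c) (v : k^o) : k^o := chi (torus_coord t) *: v.
Lemma char_act_linear t : linear (char_act t).
Proof. by move=> a v w; rewrite /char_act scalerDr !scalerA mulrC. Qed.
HB.instance Definition _ t :=
  GRing.isLinear.Build k k^o k^o *:%R (char_act t) (char_act_linear t).
Lemma char_act1 v : char_act 1%g v = v.
Proof. by rewrite /char_act /torus_coord /= mxE mchar1 scale1r. Qed.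
Lemma char_actM s t v : char_act (s * t)%g v = char_act s (char_act t v).
Proof.
by rewrite /char_act torus_coordM mcharM ?torus_coord_neq0 // scalerA.
Qed.

Definition char_rep : rep k (torus c) :=
  @Rep k (torus c) k^o char_act char_act1 char_actM.
End Characters.

(* Main.v *)
Require Import Defs.
From HB Require Import structures.
From mathcomp Require Import all_boot all_order all_algebra all_field.
From mathcomp Require Import all_classical.
From mathcomp Require Import topology.
From mathcomp Require Import ring.

Set Implicit Arguments.
Unset Strict Implicit.
Unset Printing Implicit Defensive.

Import Order.TTheory GRing.Theory Num.Theory.
Local Open Scope classical_set_scope.
Local Open Scope ring_scope.

(** Let m be the maximal ideal of A and U the unipotent radical of B.  The
    inverse of induction is the functor of U-coinvariants, which sends a lift pi
    of Ind chibar to its quotient by the submodule D of the vectors u w - w.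

    Since k has characteristic p there is no Haar measure on U with values in k:
    the functions on the big cell B w U are killed by taking coinvariants, so
    (Ind chibar)_U is the line chibar (evaluation at 1).  As m is nilpotent,
    pi = A v0 + D for any v0 lifting a generator.

    It remains to see that the cyclic module pi / D is free, i.e. that
    a v0 in D forces a = 0.  As U is a union of procyclic groups, H_1(U, -) is a
    colimit of invariants under traces; for Ind chibar it is a line, generated by
    the class of the indicator function of a ball of the big cell, on which t(x)
    acts by a character of T which genericity makes different from chibar.  Choose
    s = t(x) and a scalar kappa lifting its eigenvalue on H_1.  Devissage along the
    powers of m shows that (s - kappa)^j maps D /\ m^j pi into m^j D, whereas
    s - kappa is invertible on the coinvariants of Ind chibar; hence a lies in
    every power of m.

    The resulting functional pi -> A is equivariant for a character chi of B
    lifting chibar, and Frobenius reciprocity gives a map pi -> Ind chi.  It is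
    bijective because a family lifting a k-basis of Ind chibar spans pi and is a
    basis of Ind chi. *)


(** * Local Artinian rings *)

(** Coinvariants are only right exact: D /\ m^j pi may exceed m^j D. The excess comes from H_1(U,
    Ind chibar), and only there does genericity enter. On H_1, t(x) moves a ball of the big cell to
    the ball scaled by the norm n = x c(x), with a scalar chi(c x)^-1 picked up on passing w. The
    trace back to the original translations then contributes 1 if x = p, because p^2 translates of
    the shrunken ball tile the old one, and n mod p if x is a unit, because n equal terms are
    summed. For x = p the eigenvalue is lambda^-1, against lambda on the coinvariants, and they
    differ when lambda^2 <> 1. For a unit x, equality with chi(x) would mean chi(n) = n, that is
    n^(r - 1) = 1 modulo p. If p - 1 does not divide r - 1 some residue violates this, and every
    residue is a norm modulo p. Since U is a union of procyclic groups, each element of D is a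
    single u w - w, so D /\ m^j pi can be studied through the kernel of one operator u - 1 at a
    time. *)

Section LocalArtinian.
Variables (R : comNzRingType) (k : fieldType) (aug : {rmorphism R -> k}).
Hypotheses (locR : local_ring R) (artR : artinian R).
Hypothesis aug_surj : forall y, exists x, aug x = y.

Lemma aug_ker_maximal : maximal_ideal [set x | aug x = 0].
Proof.
split.
- split=> /= [|x y x0 y0|a x x0]; rewrite ?rmorph0 ?rmorphD ?rmorphM ?x0 ?y0 ?addr0 ?mulr0 //.
- by rewrite /= rmorph1; apply/eqP/oner_neq0.
- move=> I [I0 ID IM] mI nI1; apply/seteqP; split=> // x Ix /=.
  apply: contrapT => /eqP ax0; have [y axy] := aug_surj (aug x)^-1.
  apply: nI1; have -> : 1 = (1 - y * x) + y * x by rewrite subrK.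
  apply: ID; last exact: IM.
  by apply: mI => /=; rewrite rmorphB rmorph1 rmorphM axy mulVf // subrr.
Qed.

Lemma ex_maximal_ideal (I : set R) :
  ideal I -> ~ I 1 -> exists2 M, maximal_ideal M & I `<=` M.
Proof.
move=> iI nI1.
(* The alternative [S = set0] accounts for the empty chain, whose union must satisfy [P] too. *)
pose P (S : set R) := S = set0 \/ [/\ ideal S, I `<=` S & ~ S 1].
have [|M [PM maxM]] := @Zorn_bigcup _ P.
  move=> F FP totF.
  have [[S0 FS0 S0n]|noS] := pselect (exists2 S, F S & S !=set0); last first.
    left; apply/seteqP; split=> // x [S FS Sx]; case: noS; exists S => //.
    by exists x.
  have FI S : F S -> S !=set0 -> [/\ ideal S, I `<=` S & ~ S 1].
    by move=> FS [x Sx]; case: (FP S FS) => // S0E; rewrite S0E in Sx.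
  right; split.
  - split.
    + have [[S00 _ _] _ _] := FI _ FS0 S0n; by exists S0.
    + move=> x y [S FS Sx] [S' FS' S'y].
      have [[_ SD _] _ _] : [/\ ideal S, I `<=` S & ~ S 1] by apply: FI => //; exists x.
      have [[_ SD' _] _ _] : [/\ ideal S', I `<=` S' & ~ S' 1] by apply: FI => //; exists y.
      have [SS'|S'S] := totF _ _ FS FS'.
        by exists S' => //; apply: SD' => //; exact: SS'.
      by exists S => //; apply: SD => //; exact: S'S.
    + move=> a x [S FS Sx].
      have [[_ _ SM] _ _] : [/\ ideal S, I `<=` S & ~ S 1] by apply: FI => //; exists x.
      by exists S => //; exact: SM.
  - move=> x Ix; exists S0 => //.
    by have [_ + _] := FI _ FS0 S0n; apply.
  - move=> [S FS S1].
    by have [_ _ +] : [/\ ideal S, I `<=` S & ~ S 1] by apply: FI => //; exists 1.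
have M0 : M <> set0.
  move=> M0; apply: (maxM I); last by right; split.
  rewrite M0; split=> // /(_ 0); case: iI => I0 _ _; exact.
case: PM => [//|[iM IM nM1]].
exists M => //; split=> // I' iI' MI' nI'1.
apply: contrapT => nE; apply: (maxM I'); last first.
  by right; split=> //; apply: subset_trans IM MI'.
by split=> // I'M; apply: nE; apply/seteqP.
Qed.

(** A non-unit generates a proper ideal; the maximal ideal containing it is the kernel of [aug]
    because the ring is local. *)
Lemma aug_unit (x : R) : aug x != 0 -> exists y, x * y = 1.
Proof.
move=> ax0; apply: contrapT => nu.
pose I : set R := [set y | exists z, y = x * z].
have [||M maxM IM] := @ex_maximal_ideal I.
- split=> /= [|y y' [z ->] [z' ->]|a y [z ->]]; first by exists 0; rewrite mulr0.
    by exists (z + z'); rewrite mulrDr.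
  by exists (a * z); rewrite mulrCA.
- by move=> [z /esym xz]; apply: nu; exists z.
have [M0 [_ uniqM]] := locR.
have ME : M = [set x | aug x = 0] by rewrite -(uniqM _ maxM) (uniqM _ aug_ker_maximal).
by case/eqP: ax0; rewrite ME in IM; apply: IM; exists 1; rewrite mulr1.
Qed.

Fixpoint mpow (j : nat) : set R :=
  if j is j'.+1 then [set x | exists s : seq (R * R),
    (forall ab, ab \in s -> aug ab.1 = 0 /\ mpow j' ab.2) /\
    x = \sum_(ab <- s) ab.1 * ab.2]
  else setT.

Lemma mpow_ideal j : ideal (mpow j).
Proof.
case: j => [|j]; first by split.
split=> /=.
- by exists [::]; rewrite big_nil.
- move=> x y [s [sP ->]] [t [tP ->]]; exists (s ++ t); rewrite big_cat; split=> //.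
  by move=> ab; rewrite mem_cat => /orP[/sP|/tP].
- move=> a x [s [sP ->]]; exists [seq (a * ab.1, ab.2) | ab <- s]; split.
    by move=> _ /mapP[ab /sP[a0 b0] ->] /=; rewrite rmorphM a0 mulr0.
  by rewrite big_map mulr_sumr; apply: eq_bigr => ab _; rewrite mulrA.
Qed.

Lemma mpow0 j : mpow j 0.
Proof. by case: (mpow_ideal j). Qed.
Lemma mpowD j x y : mpow j x -> mpow j y -> mpow j (x + y).
Proof. by case: (mpow_ideal j) => _ + _; apply. Qed.
Lemma mpowMl j a x : mpow j x -> mpow j (a * x).
Proof. by case: (mpow_ideal j) => _ _; apply. Qed.
Lemma mpowMr j a x : mpow j x -> mpow j (x * a).
Proof. by rewrite mulrC; apply: mpowMl. Qed.
Lemma mpowN j x : mpow j x -> mpow j (- x).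
Proof. by rewrite -mulN1r; apply: mpowMl. Qed.
Lemma mpow_sum j (I : eqType) (s : seq I) (F : I -> R) :
  (forall i, i \in s -> mpow j (F i)) -> mpow j (\sum_(i <- s) F i).
Proof.
move=> sF; rewrite big_seq; apply: big_ind => //; [exact: mpow0|exact: mpowD].
Qed.

Lemma mpowS j a x : aug a = 0 -> mpow j x -> mpow j.+1 (a * x).
Proof.
by move=> a0 jx; exists [:: (a, x)]; rewrite big_seq1; split=> // ab; rewrite inE => /eqP->.
Qed.

Lemma mpow1E x : mpow 1 x <-> aug x = 0.
Proof.
split=> [[s [sP ->]]|x0]; last by rewrite -[x]mulr1; apply: mpowS.
by rewrite rmorph_sum big_seq big1 // => ab /sP[a0 _]; rewrite rmorphM a0 mul0r.
Qed.

Lemma mpowSW j x : mpow j.+1 x -> mpow j x.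
Proof. by move=> [s [sP ->]]; apply: mpow_sum => ab /sP[_]; apply: mpowMl. Qed.

(** The powers of m stabilise at some J = m J. If J <> 0, start from x = 1 and use J = m J to find y
    in m with x y J <> 0, again and again. The decreasing principal ideals so obtained stabilise,
    hence x = x y z with y in m at some stage; as 1 - y z is a unit, x = 0, a contradiction. *)
Lemma mpow_nilp : exists n, forall x, mpow n x -> x = 0.
Proof.
have [n stab] := artR mpow_ideal (fun n => @mpowSW n).
exists n => x0 Jx0; apply: contrapT => /eqP nx0.
pose J := mpow n; have mJ : J = mpow n.+1 by rewrite (stab n.+1).
pose good (x : R) := exists2 b, J b & x * b != 0.
have step x : good x -> exists y, aug y = 0 /\ good (x * y).
  move=> [b]; rewrite {1}mJ => -[s [sP ->]] nz.
  have [ab abs nzab] : exists2 ab, ab \in s & x * (ab.1 * ab.2) != 0.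
    apply: contrapT => no; case/eqP: nz; rewrite mulr_sumr big_seq big1 // => ab abs.
    by apply: contrapT => /eqP nzab; apply: no; exists ab.
  by have [a0 Jb] := sP _ abs; exists ab.1; split=> //; exists ab.2; rewrite // -mulrA.
pose T := {x : R | good x}.
have g1 : good 1 by exists x0; rewrite ?mul1r.
pose next (x : T) : T := exist good _ (projT2 (cid (step _ (projT2 (sigT_of_sig x))))).2.
pose xs (i : nat) : T := iter i next (exist good 1 g1).
pose I i : set R := [set y | exists z, y = sval (xs i) * z].
have xsS i : exists y, aug y = 0 /\ sval (xs i.+1) = sval (xs i) * y.
  by rewrite /xs /=; rewrite /next /=; case: cid => y [y0 gy] /=; exists y; case: (iter _ _ _) y0 gy.
have [||m Im] := artR (I := I).
- move=> i; split=> /= [|y y' [z ->] [z' ->]|a y [z ->]]; first by exists 0; rewrite mulr0.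
    by exists (z + z'); rewrite mulrDr.
  by exists (a * z); rewrite mulrCA.
- by move=> i _ [z ->]; have [y [_ ->]] := xsS i; exists (y * z); rewrite mulrA.
have [y [y0 xE]] := xsS m.
have : I m (sval (xs m)) by exists 1; rewrite mulr1.
rewrite -(Im m.+1) // => -[z]; rewrite xE => xx.
have [v v1] : exists v, (1 - y * z) * v = 1.
  by apply: aug_unit; rewrite rmorphB rmorph1 rmorphM y0 mul0r subr0 oner_neq0.
have x00 : sval (xs m) = 0.
  by rewrite -[LHS]mulr1 -v1 mulrA mulrBr mulr1 mulrA -xx subrr mul0r.
by case: (svalP (xs m)) => b _; rewrite x00 mul0r eqxx.
Qed.

Section Nakayama.
Variable M : lmodType R.

Definition powM (j : nat) : set M := [set v | exists s : seq (R * M),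
  (forall aw, aw \in s -> mpow j aw.1) /\ v = \sum_(aw <- s) aw.1 *: aw.2].

Lemma powM0 j : powM j 0.
Proof. by exists [::]; rewrite big_nil. Qed.

Lemma powMD j v w : powM j v -> powM j w -> powM j (v + w).
Proof.
move=> [s [sP ->]] [t [tP ->]]; exists (s ++ t); rewrite big_cat; split=> //.
by move=> ab; rewrite mem_cat => /orP[/sP|/tP].
Qed.

Lemma powMZ j a v : powM j v -> powM j (a *: v).
Proof.
move=> [s [sP ->]]; exists [seq (a * aw.1, aw.2) | aw <- s]; split.
  by move=> _ /mapP[ab /sP ja ->] /=; apply: mpowMl.
by rewrite big_map scaler_sumr; apply: eq_bigr => ab _; rewrite scalerA.
Qed.

Lemma powMN j v : powM j v -> powM j (- v).
Proof. by rewrite -scaleN1r; apply: powMZ. Qed.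

Lemma powMB j v w : powM j v -> powM j w -> powM j (v - w).
Proof. by move=> jv jw; apply: powMD jv (powMN jw). Qed.

Lemma powM_sum j (I : eqType) (s : seq I) (F : I -> M) :
  (forall i, i \in s -> powM j (F i)) -> powM j (\sum_(i <- s) F i).
Proof.
move=> sF; rewrite big_seq; apply: big_ind => //; [exact: powM0|exact: powMD].
Qed.

Lemma powM_scale j a v : mpow j a -> powM j (a *: v).
Proof.
by move=> ja; exists [:: (a, v)]; rewrite big_seq1; split=> // aw; rewrite inE => /eqP->.
Qed.

Lemma powM_scaleS j a v : mpow j a -> powM 1 v -> powM j.+1 (a *: v).
Proof.
move=> ja [s [sP ->]]; rewrite scaler_sumr; apply: powM_sum => aw /sP /mpow1E a0.
by rewrite scalerA mulrC; apply: powM_scale; apply: mpowS.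
Qed.

Lemma powMSW j v : powM j.+1 v -> powM j v.
Proof. by move=> [s [sP ->]]; apply: powM_sum => aw /sP/mpowSW; apply: powM_scale. Qed.

Lemma powM_linear j (h : {linear M -> M}) v : powM j v -> powM j (h v).
Proof.
by move=> [s [sP ->]]; rewrite linear_sum; apply: powM_sum => aw /sP ja; rewrite linearZ; apply: powM_scale.
Qed.

(** M may be infinitely generated: in an expression of v - s in m^j M, approximating each vector by
    S modulo m M improves the error to m^(j+1) M, and m is nilpotent. *)
Lemma nakayama (S : set M) : S 0 -> (forall v w, S v -> S w -> S (v + w)) ->
  (forall a v, S v -> S (a *: v)) ->
  (forall v, exists2 s, S s & powM 1 (v - s)) -> forall v, S v.
Proof.
move=> S0 SD SZ Sm v; have [n nil] := mpow_nilp.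
suff [s Ss [t [tP vsE]]] : exists2 s, S s & powM n (v - s).
  suff -> : v = s by [].
  apply/eqP; rewrite -subr_eq0 vsE big_seq big1 // => aw /tP/nil->.
  by rewrite scale0r.
elim: n {nil} => [|n [s Ss [t [tP vsE]]]].
  by exists 0 => //; rewrite subr0 -[v]scale1r; apply: powM_scale.
pose c (w : M) := s2val (cid2 (Sm w)).
have cS w : S (c w) by rewrite /c; case: cid2.
have cm w : powM 1 (w - c w) by rewrite /c; case: cid2.
exists (s + \sum_(aw <- t) aw.1 *: c aw.2).
  apply: (SD) => //; elim: t {tP vsE} => [|aw t IHt]; first by rewrite big_nil.
  by rewrite big_cons; apply: (SD) IHt; apply: SZ.
rewrite opprD addrA vsE -sumrB; apply: powM_sum => aw /tP ja.
by rewrite -scalerBr; apply: powM_scaleS.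
Qed.
End Nakayama.
End LocalArtinian.

(** * Bases and base change *)

Section Bases.
Variables (R : comNzRingType) (M : lmodType R) (I : choiceType).

(** Indexed families rather than subsets, so that a k-basis of a reduction can index the family of
    its lifts. *)
Definition indep_fam (B : set I) (e : I -> M) : Prop :=
  forall (s : seq I) (a : I -> R), uniq s -> (forall i, i \in s -> B i) ->
    \sum_(i <- s) a i *: e i = 0 -> forall i, i \in s -> a i = 0.

Definition span_fam (B : set I) (e : I -> M) : set M :=
  [set w | exists (s : seq I) (a : I -> R),
    (forall i, i \in s -> B i) /\ w = \sum_(i <- s) a i *: e i].

Definition basis_fam (B : set I) (e : I -> M) : Prop :=
  indep_fam B e /\ forall w, span_fam B e w.

Lemma span_fam0 B e : span_fam B e 0.
Proof. by exists [::], (fun=> 0); rewrite big_nil. Qed.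

Lemma span_fam_uniq B e w : span_fam B e w -> exists (s : seq I) (a : I -> R),
  [/\ uniq s, forall i, i \in s -> B i, forall i, i \notin s -> a i = 0
    & w = \sum_(i <- s) a i *: e i].
Proof.
move=> [s [a [sB ->]]].
exists (undup s), (fun i => if i \in s then a i *+ count_mem i s else 0); split.
- exact: undup_uniq.
- by move=> i; rewrite mem_undup; apply: sB.
- by move=> i; rewrite mem_undup => /negPf ->.
rewrite -big_undup_iterop_count; apply: eq_big_seq => i; rewrite mem_undup => ->.
by rewrite -scalerMnl.
Qed.

Lemma sum_widen (s t : seq I) (a : I -> R) (e : I -> M) : uniq s -> uniq t ->
  {subset s <= t} -> (forall i, i \notin s -> a i = 0) ->
  \sum_(i <- t) a i *: e i = \sum_(i <- s) a i *: e i.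
Proof.
move=> us ut st a0; rewrite (bigID (fun i => i \in s)) /= [X in _ + X]big1; last first.
  by move=> i /a0 ->; rewrite scale0r.
rewrite addr0 -big_filter; apply: perm_big; apply: uniq_perm => //.
  exact: filter_uniq.
by move=> i; rewrite mem_filter; case: (boolP (i \in s)) => // /st.
Qed.

Lemma span_famP B e : (span_fam B e 0) /\
  (forall v w, span_fam B e v -> span_fam B e w -> span_fam B e (v + w)) /\
  (forall a v, span_fam B e v -> span_fam B e (a *: v)).
Proof.
split; first exact: span_fam0.
split=> [v w /span_fam_uniq[s [a [us sB a0 ->]]] /span_fam_uniq[t [b [ut tB b0 ->]]]|c v].
  exists (undup (s ++ t)), (fun i => a i + b i); split.
    by move=> i; rewrite mem_undup mem_cat => /orP[/sB|/tB].
  rewrite -(sum_widen (t := undup (s ++ t)) _ us) ?undup_uniq //; last first.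
    by move=> i; rewrite mem_undup mem_cat => ->.
  rewrite -(sum_widen (t := undup (s ++ t)) _ ut) ?undup_uniq //; last first.
    by move=> i; rewrite mem_undup mem_cat orbC => ->.
  by rewrite -big_split; apply: eq_bigr => i _; rewrite scalerDl.
move=> [s [a [sB ->]]]; exists s, (fun i => c * a i); split=> //.
by rewrite scaler_sumr; apply: eq_bigr => i _; rewrite scalerA.
Qed.

Section Coordinates.
Variables (B : set I) (e : I -> M).
Hypothesis Be : basis_fam B e.

Lemma basis_coord : exists co : I -> M -> R,
  [/\ forall i, linear_for *%R (co i),
      forall v, exists2 s, uniq s & (forall i, i \in s -> B i) /\
         v = \sum_(i <- s) co i v *: e i
    & forall s a, uniq s -> (forall i, i \in s -> B i) -> (forall i, i \notin s -> a i = 0) ->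
        forall i, co i (\sum_(i <- s) a i *: e i) = a i].
Proof.
have [ind span] := Be.
have ex v := span_fam_uniq (span v).
pose su v := projT1 (cid (ex v)).
pose co i v := projT1 (cid (projT2 (cid (ex v)))) i.
have coP v : [/\ uniq (su v), forall i, i \in su v -> B i,
    forall i, i \notin su v -> co i v = 0 & v = \sum_(i <- su v) co i v *: e i].
  by rewrite /su /co; case: (cid (ex v)) => s Ps /=; case: cid.
have expand v t : uniq t -> {subset su v <= t} -> \sum_(i <- t) co i v *: e i = v.
  move=> ut st; have [uv vB v0 vE] := coP v.
  transitivity (\sum_(i <- su v) co i v *: e i); last by rewrite -vE.
  exact: sum_widen.
have uni s a v : uniq s -> (forall i, i \in s -> B i) -> (forall i, i \notin s -> a i = 0) ->
    v = \sum_(i <- s) a i *: e i -> forall i, co i v = a i.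
  move=> us sB a0 vE; have [uv vB v0 vE'] := coP v.
  pose t := undup (s ++ su v); have ut : uniq t by apply: undup_uniq.
  have tB i : i \in t -> B i by rewrite mem_undup mem_cat => /orP[/sB|/vB].
  have st : {subset s <= t} by move=> i; rewrite mem_undup mem_cat => ->.
  have vt : {subset su v <= t} by move=> i; rewrite mem_undup mem_cat orbC => ->.
  move=> i; have [it|] := boolP (i \in t); last first.
    by rewrite mem_undup mem_cat negb_or => /andP[/a0 -> /v0 ->].
  apply/eqP; rewrite -subr_eq0; apply/eqP.
  apply: (ind t (fun i => co i v - a i)) => //.
  under eq_bigr do rewrite scalerBl.
  rewrite sumrB expand //; apply/eqP; rewrite subr_eq0 {1}vE; apply/eqP/esym.
  exact: sum_widen.
exists co; split; last by move=> s a us sB a0 i; apply: (uni s).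
- move=> i a v w; have [uv vB v0 vE] := coP v; have [uw wB w0 wE] := coP w.
  pose t := undup (su v ++ su w); have ut : uniq t by apply: undup_uniq.
  have vt : {subset su v <= t} by move=> j; rewrite mem_undup mem_cat => ->.
  have wt : {subset su w <= t} by move=> j; rewrite mem_undup mem_cat orbC => ->.
  apply: (uni t (fun i => a * co i v + co i w)) => //.
  + by move=> j; rewrite mem_undup mem_cat => /orP[/vB|/wB].
  + by move=> j; rewrite mem_undup mem_cat negb_or => /andP[/v0 -> /w0 ->]; rewrite mulr0 addr0.
  under eq_bigr do rewrite scalerDl -scalerA.
  by rewrite big_split /= -scaler_sumr !expand.
- by move=> v; have [uv vB v0 vE] := coP v; exists (su v).
Qed.
End Coordinates.
End Bases.

Lemma basis_extend (R : comNzRingType) (M N : lmodType R) (I : choiceType) (B : set I)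
    (e : I -> M) (u : I -> N) : basis_fam B e ->
  exists h : {linear M -> N}, forall i, B i -> h (e i) = u i.
Proof.
move=> Be; have [co [colin coe coU]] := basis_coord Be.
pose sw w := s2val (cid2 (coe w)).
have swP w : [/\ uniq (sw w), forall i, i \in sw w -> B i & w = \sum_(i <- sw w) co i w *: e i].
  by rewrite /sw; case: cid2 => s us [].
have co0 w i : i \notin sw w -> co i w = 0.
  move=> iw; have [us sB wE] := swP w.
  rewrite {1}wE; rewrite (eq_big_seq (fun i => (if i \in sw w then co i w else 0) *: e i)).
    by rewrite coU // ?(negPf iw) // => i' /negPf ->.
  by move=> i' ->.
pose wf w := \sum_(i <- sw w) co i w *: u i.
have wfE w t : uniq t -> {subset sw w <= t} -> wf w = \sum_(i <- t) co i w *: u i.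
  by move=> ut st; have [us _ _] := swP w; apply/esym/sum_widen => // i; apply: co0.
have wf_lin : linear wf.
  move=> a w w'; pose t := undup (sw w ++ sw w' ++ sw (a *: w + w')).
  rewrite !(wfE _ t) ?undup_uniq //; try by move=> i it; rewrite mem_undup !mem_cat it ?orbT.
  rewrite scaler_sumr -big_split; apply: eq_bigr => i _ /=.
  by rewrite colin scalerDl scalerA.
pose wl : {linear M -> N} := HB.pack wf (GRing.isLinear.Build R M N *:%R wf wf_lin).
exists wl => i Bi; pose d (i' : I) : R := (i' == i)%:R.
have coe_d i' : co i' (e i) = d i'.
  rewrite -[e i]scale1r -[1 : R]/((true : nat)%:R) -(eqxx i) -/(d i)
    -[d i *: e i](big_seq1 +%R i (fun i => d i *: e i)).
  rewrite coU //; first by move=> i''; rewrite inE => /eqP ->.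
  by move=> i''; rewrite inE /d => /negPf ->.
rewrite /= (wfE _ (undup (i :: sw (e i)))) ?undup_uniq //; last first.
  by move=> i' i's; rewrite mem_undup inE i's orbT.
rewrite (bigD1_seq i) ?undup_uniq ?mem_undup ?mem_head //= coe_d /d eqxx scale1r big1 ?addr0 //.
by move=> i' /negPf ne; rewrite coe_d /d ne scale0r.
Qed.

Lemma free_module_basis (R : comNzRingType) (M : lmodType R) :
  free_module M <-> exists B, basis_fam (I := M) B id.
Proof. by split=> -[B [ind sp]]; exists B. Qed.

Lemma basis_fam_free (R : comNzRingType) (M : lmodType R) (I : choiceType)
    (B : set I) (e : I -> M) : injective e -> basis_fam B e -> free_module M.
Proof.
move=> inj [ind sp].
have lift_seq (s : seq M) : (forall v, v \in s -> (e @` B) v) ->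
    exists2 t, (forall i, i \in t -> B i) & s = [seq e i | i <- t].
  elim: s => [|v s IHs] sB; first by exists [::].
  have [i Bi eiv] := sB v (mem_head _ _).
  have [|t tB tE] := IHs; first by move=> w ws; apply: sB; rewrite inE ws orbT.
  exists (i :: t); last by rewrite /= eiv -tE.
  by move=> i'; rewrite inE => /orP[/eqP ->|/tB].
exists (e @` B); split.
- move=> s a us /lift_seq[t tB sE] sum0 v vs; move: us sum0 vs.
  rewrite {s}sE map_inj_uniq // big_map => ut sum0 /mapP[i it ->].
  exact: (ind t (a \o e)).
- move=> w; have [s [a [us sB a0 ->]]] := span_fam_uniq (sp w).
  have [[i _]|] := pselect (exists i, i \in s); last first.
    move=> ns; exists [::], (fun=> 0); rewrite big_nil; split=> //.
    by rewrite big_seq big1 // => i si; case: ns; exists i.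
  (* [g] inverts [e] on s; the index i found above only serves as the default value. *)
  pose g v := odflt i (ohead [seq i <- s | e i == v]).
  have ge i' : i' \in s -> g (e i') = i'.
    move=> si'; rewrite /g; have : i' \in [seq i <- s | e i == e i'] by rewrite mem_filter eqxx.
    case E : [seq i <- s | e i == e i'] => [|x l] //= _.
    have : x \in [seq i <- s | e i == e i'] by rewrite E mem_head.
    by rewrite mem_filter => /andP[/eqP/inj].
  exists [seq e i | i <- s], (fun v => a (g v)); split.
    by move=> v /mapP[i' /sB Bi' ->]; exists i'.
  by rewrite big_map; apply: eq_big_seq => i' /ge ->.
Qed.

Section BaseChange.
Variables (R S : comNzRingType) (f : {rmorphism R -> S}).
Variables (V : lmodType R) (W : lmodType S) (j : {linear V -> W | f \; *:%R}).

(** A linear map out of W is prescribed freely on the basis [j (e i)], and a semilinear map out of V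
    is determined on the spanning family [e]. *)
Lemma base_change_of_basis (I : choiceType) (B : set I) (e : I -> V) :
  (forall v, span_fam B e v) -> basis_fam B (fun i => j (e i)) -> is_base_change j.
Proof.
move=> sp Bje X u; have [w wE] := basis_extend (fun i => u (e i)) Bje; exists w.
- move=> v; have [s [a [sB ->]]] := sp v.
  rewrite !linear_sum; apply: eq_big_seq => i /sB Bi.
  by rewrite !linearZ /= wE.
- move=> w' w'j v; have [_ /(_ v)[s [a [sB ->]]]] := Bje.
  rewrite !linear_sum; apply: eq_big_seq => i /sB Bi.
  by rewrite !linearZ /= w'j wE.
Qed.
End BaseChange.

Lemma ex_basis (k : fieldType) (M : lmodType k) : exists B : set M, basis_fam B id.
Proof.
pose P (B : set M) := indep_fam (I := M) B id.
have [|B [PB maxB]] := @Zorn_bigcup _ P.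
  move=> F FP totF s a us sB s0.
  suff [[X FX sX]|s_nil] : (exists2 X, F X & forall i, i \in s -> X i) \/ s = [::].
    exact: (FP X FX s a us sX s0).
    by rewrite s_nil.
  elim: s sB {us s0 a} => [|v s IHs] sB; first by right.
  left; have [X FX Xv] := sB v (mem_head _ _).
  have [|[Y FY sY]|s_nil] := IHs.
  - by move=> i si; apply: sB; rewrite inE si orbT.
  - have [XY|YX] := totF _ _ FX FY.
      by exists Y => // i; rewrite inE => /orP[/eqP ->|/sY //]; apply: XY.
    by exists X => // i; rewrite inE => /orP[/eqP -> //|/sY]; apply: YX.
  - by exists X => // i; rewrite s_nil inE => /eqP ->.
exists B; split=> // w; apply: contrapT => nw.
have [sp0 [spD spZ]] := span_famP B (id : M -> M).
have nBw : ~ B w.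
  by move=> Bw; apply: nw; exists [:: w], (fun=> 1); rewrite big_seq1 scale1r;
    split=> // i; rewrite inE => /eqP ->.
apply: (maxB (B `|` [set w])).
  by split; [move=> x Bx; left|move=> /(_ w) h; apply: nBw; apply: h; right].
move=> s a us sB s0.
have sumB (t : seq M) : (forall i, i \in t -> i \in s /\ i != w) ->
    forall i, i \in t -> B i.
  by move=> tP i /tP[/sB [//|->]]; rewrite eqxx.
have aw : w \in s -> a w = 0.
  move=> ws; apply: contrapT => /eqP aw0; apply: nw.
  move: s0; rewrite (bigD1_seq w) //= => /eqP; rewrite addr_eq0 => /eqP E.
  have -> : w = (- (a w)^-1) *: (\sum_(i <- s | i != w) a i *: i).
    by rewrite scaleNr -scalerN -E scalerA mulVf ?scale1r.
  apply: spZ; exists [seq i <- s | i != w], a; split; last by rewrite big_filter.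
  by apply: sumB => i; rewrite mem_filter => /andP[].
have s0' : \sum_(i <- [seq i <- s | i != w]) a i *: i = 0.
  rewrite big_filter -[RHS]s0 [RHS](bigID (fun i => i != w)) /= [X in _ = _ + X]big_seq_cond.
  rewrite [X in _ = _ + X]big1 ?addr0 // => i /andP[si /negPn/eqP iw].
  by rewrite iw aw ?scale0r // -iw.
move=> i si; have [iw|iw] := eqVneq i w; first by rewrite iw; apply: aw; rewrite -iw.
apply: (PB [seq i <- s | i != w] a _ _ s0'); first exact: filter_uniq.
  by apply: sumB => i'; rewrite mem_filter => /andP[].
by rewrite mem_filter iw.
Qed.

(** * Lifting bases from the residue field *)

Section Reduction.
Variables (R : comNzRingType) (k : fieldType) (aug : {rmorphism R -> k}).
Hypotheses (locR : local_ring R) (artR : artinian R).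
Hypothesis aug_surj : forall y : k, exists a : R, aug a = y.
Local Notation mpow := (@mpow R k aug).

Section OneModule.
Variables (M : lmodType R) (Mbar : lmodType k) (phi : {linear M -> Mbar | aug \; *:%R}).
Local Notation powM := (@powM R k aug M).
Implicit Types v w : M.

Lemma powM1_ker v : powM 1 v -> phi v = 0.
Proof.
move=> [s [sP ->]]; rewrite linear_sum big_seq big1 // => aw /sP/mpow1E a0.
by rewrite linearZ /= a0 scale0r.
Qed.

(** The coordinates reduced modulo m form a semilinear map from M to the functions M -> k. By the
    universal property it factors through [phi], so it vanishes on the kernel of [phi]. *)
Lemma lift_coord : free_module M -> is_base_change phi ->
  exists co : M -> M -> R, [/\ forall i, linear_for *%R (co i),
  forall v, exists s, v = \sum_(i <- s) co i v *: i &
  forall v, phi v = 0 <-> forall i, aug (co i v) = 0].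
Proof.
move=> /free_module_basis[B Bb] bcM; have [co [colin coe _]] := basis_coord Bb.
have coe' v : exists s, v = \sum_(i <- s) co i v *: i.
  by have [s _ [_ vE]] := coe v; exists s.
exists co; split=> // v; split=> [v0|v0]; last first.
  have [s ->] := coe' v; rewrite linear_sum big1 // => i _.
  by rewrite linearZ /= v0 scale0r.
pose uf v : M -> k^o := fun i => aug (co i v).
have uf_lin : linear_for (aug \; *:%R) uf.
  by move=> a w w'; apply/funext => i; rewrite /uf colin rmorphD rmorphM.
pose ul : {linear M -> (M -> k^o) | aug \; *:%R} :=
  HB.pack uf (GRing.isLinear.Build R M (M -> k^o) (aug \; *:%R) uf uf_lin).
have [w wE _] := bcM _ ul.
by move=> i; have := congr1 (fun f : M -> k^o => f i) (wE v); rewrite v0 linear0 => /esym.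
Qed.

Lemma ker_powM1 : free_module M -> is_base_change phi -> forall v, phi v = 0 -> powM 1 v.
Proof.
move=> fM bcM v; have [co [_ coe coP]] := lift_coord fM bcM.
move=> /coP v0; have [s ->] := coe v.
by apply: powM_sum => i _; apply: powM_scale; apply/mpow1E.
Qed.

Hypothesis ker1 : forall v, phi v = 0 -> powM 1 v.

Lemma span_lift (B : set Mbar) (s : Mbar -> M) : (forall m, B m -> phi (s m) = m) ->
  (forall m, span_fam (I := Mbar) B id m) -> forall v, span_fam B s v.
Proof.
move=> sK sp; have [sp0 [spD spZ]] := span_famP B s.
apply: (nakayama locR artR aug_surj) => // v; have [t [a [tB vE]]] := sp (phi v).
pose al m := projT1 (cid (aug_surj (a m))).
have alE m : aug (al m) = a m by rewrite /al; case: cid.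
exists (\sum_(m <- t) al m *: s m); first by exists t, al.
apply: ker1; rewrite linearB vE linear_sum; apply/eqP; rewrite subr_eq0; apply/eqP.
by apply: eq_big_seq => m /tB Bm; rewrite linearZ /= sK // alE.
Qed.

(** Gaussian elimination for a module not yet known to be free: some functional takes a unit value
    on the first vector, and subtracting multiples of that vector makes the functional vanish on all
    others. *)
Lemma indep_lift (X : Type) (la : X -> M -> R) (B : set Mbar) (s : Mbar -> M) :
  (forall x, linear_for *%R (la x)) ->
  (forall v, phi v <> 0 -> exists x, aug (la x v) != 0) ->
  (forall m, B m -> phi (s m) = m) ->
  indep_fam (I := Mbar) B id -> indep_fam B s.
Proof.
move=> lin det sK ind t a ut tB; move: t ut tB a.
(* Elimination changes the family, so the induction runs over arbitrary families with independent
   reductions. *)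
suff main (e : Mbar -> M) (t : seq Mbar) : uniq t ->
    (forall b : Mbar -> k, \sum_(i <- t) b i *: phi (e i) = 0 -> forall i, i \in t -> b i = 0) ->
    forall a, \sum_(i <- t) a i *: e i = 0 -> forall i, i \in t -> a i = 0.
  move=> t ut tB; apply: main => // b E; apply: ind => //.
  by rewrite -[RHS]E; apply: eq_big_seq => i /tB Bi; rewrite sK.
elim: t e => [|i0 t IHt] e //= /andP[i0t ut] bind a; rewrite big_cons => aE.
have tn i : i \in t -> i == i0 = false by move=> it; apply/negP => /eqP E; rewrite -E it in i0t.
have [|x nx] := det (e i0).
  move=> e0; have /eqP := oner_neq0 k; apply.
  have := bind (fun i => (i == i0)%:R) _ i0 (mem_head _ _); rewrite eqxx; apply.
  rewrite big_cons e0 scaler0 add0r big_seq big1 // => i /tn ->.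
  by rewrite scale0r.
have [d d1] := aug_unit locR aug_surj nx.
pose lal : {linear M -> R^o} := HB.pack (la x)
  (GRing.isLinear.Build R M R^o *:%R (la x) (lin x)).
have laE : a i0 * la x (e i0) + \sum_(i <- t) a i * la x (e i) = 0.
  have : lal (a i0 *: e i0 + \sum_(i <- t) a i *: e i) = 0 by rewrite aE linear0.
  rewrite linearD linear_sum linearZ => E0; rewrite -[RHS]E0; congr (_ + _).
  by apply: eq_bigr => i _; rewrite linearZ.
pose e' i := e i - (d * la x (e i)) *: e i0.
have a0t : forall i, i \in t -> a i = 0.
  apply: (IHt e') => // [b bE i it|].
    pose b' i := if i == i0 then - \sum_(i <- t) b i * aug (d * la x (e i)) else b i.
    have := bind b' _ i; rewrite inE it orbT /b' (tn i it) => -> //.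
    rewrite big_cons eqxx -[RHS]bE addrC.
    rewrite (eq_big_seq (fun i => b i *: phi (e i))); last by move=> j /tn ->.
    rewrite scaleNr scaler_suml -sumrB; apply: eq_bigr => j _.
    by rewrite /e' linearB [phi (_ *: _)]linearZ /= scalerBr scalerA.
  have -> : \sum_(i <- t) a i *: e' i = \sum_(i <- t) a i *: e i
      - (d * \sum_(i <- t) a i * la x (e i)) *: e i0.
    rewrite mulr_sumr scaler_suml -sumrB; apply: eq_bigr => j _.
    by rewrite /e' scalerBr scalerA mulrCA.
  move/eqP: laE; rewrite addrC addr_eq0 => /eqP ->.
  rewrite mulrN scaleNr opprK mulrCA [d * _]mulrC d1 mulr1 addrC.
  exact: aE.
move=> i; rewrite inE => /orP[/eqP ->|/a0t //].
have : a i0 * la x (e i0) = 0.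
  by rewrite -[RHS]laE [X in _ + X]big_seq big1 ?addr0 // => j /a0t ->; rewrite mul0r.
by move=> E; rewrite -[a i0]mulr1 -d1 mulrA E mul0r.
Qed.
End OneModule.

Lemma lift_bij (M N : lmodType R) (Mbar : lmodType k)
    (phiM : {linear M -> Mbar | aug \; *:%R}) (phiN : {linear N -> Mbar | aug \; *:%R})
    (B : set Mbar) (h : {linear M -> N}) :
  (forall v, phiM v = 0 -> @powM R k aug M 1 v) -> (forall m, exists v, phiM v = m) ->
  basis_fam (I := Mbar) B id ->
  (forall s : Mbar -> N, (forall m, phiN (s m) = m) -> basis_fam B s) ->
  (forall v, phiN (h v) = phiM v) -> bijective h.
Proof.
move=> kerM surjM [_ sp] basN hphi.
pose s m := projT1 (cid (surjM m)).
have sK m : phiM (s m) = m by rewrite /s; case: cid.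
have [indN spN] : basis_fam B (h \o s) by apply: basN => m; rewrite /= hphi.
have spM := span_lift kerM (fun m _ => sK m) sp.
have inj : injective h.
  move=> v w E; apply/eqP; rewrite -subr_eq0; apply/eqP.
  have : h (v - w) = 0 by rewrite linearB E subrr.
  have [t [a [ut tB a0 ->]]] := span_fam_uniq (spM (v - w)).
  move=> hE; rewrite big_seq big1 // => m mt.
  rewrite (indN t a ut tB _ m mt) ?scale0r // -[RHS]hE linear_sum.
  by apply: eq_bigr => i _; rewrite linearZ.
have surj w : exists v, h v = w.
  have [t [a [tB ->]]] := spN w; exists (\sum_(i <- t) a i *: s i).
  by rewrite linear_sum; apply: eq_bigr => i _; rewrite linearZ.
exists (fun w => projT1 (cid (surj w))) => v; last by case: cid.
by apply: inj; case: cid.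
Qed.
End Reduction.

(** * The unramified quadratic extension *)

Section PadicValuation.
Variables (p : nat) (p_pr : prime p).
Local Notation Zp := (Defs.Zp p_pr).
Local Notation q n := ((p ^ n)%N%:Z).

Lemma zp_eq (x y : Zp) : (forall n, x n = y n) -> x = y.
Proof. by move=> xy; apply/val_inj/funext. Qed.

Lemma zp_div_p (x : Zp) : zp_res x 1 = 0 -> exists y : Zp, x = p%:R * y.
Proof.
move=> x1; have p0 : p%:Z != 0 by rewrite -lt0n prime_gt0.
have dvdx n : (p%:Z %| x n.+1)%Z.
  apply/dvdz_mod0P; have := zp_resE x (ltn0Sn n).
  by rewrite expn1 x1.
(* Division by p costs one digit: the quotient modulo p^n is read off x modulo p^(n+1). *)
pose f n := (x n.+1 %/ p%:Z)%Z.
have fE n : f n * p%:Z = x n.+1 by rewrite /f divzK.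
have cf n : (f n.+1 = f n %[mod q n])%Z.
  apply/eqP; rewrite eqz_mod_dvd -(dvdz_mul2r p0).
  rewrite mulrBl !fE -PoszM -expnSr -eqz_mod_dvd.
  by rewrite [X in _ == X](_ : _ = x n.+1) ?zp_resmod // -zp_resE.
exists (mk_zp p_pr cf); apply: zp_eq => n.
change (x n = (((p%:R : Zp) n * (f n %% q n)%Z) %% q n)%Z).
by rewrite zp_natE modzMml modzMmr mulrC fE -zp_resE.
Qed.

Lemma zp_resM (x y : Zp) : zp_res (x * y) 1 = ((x 1%N * y 1%N) %% q 1)%Z.
Proof. by []. Qed.

Lemma zp_p_dvdM (x y z : Zp) : x * y = p%:R * z ->
  (exists x', x = p%:R * x') \/ (exists y', y = p%:R * y').
Proof.
move=> /(congr1 (fun t : Zp => t 1%N)); rewrite !zp_resM zp_natE expn1 modzz mul0r mod0z.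
move=> /dvdz_mod0P; rewrite dvdzE abszM /= Euclid_dvdM // => /orP[] d; [left|right];
  by apply: zp_div_p; rewrite -zp_resmod expn1; apply/dvdz_mod0P; rewrite dvdzE.
Qed.

Lemma zp_p_neq0 : (p%:R : Zp) != 0.
Proof.
apply/eqP => /(congr1 (fun t : Zp => t 2%N)) E.
have : (p%:Z %% q 2)%Z = 0 by rewrite -(zp_natE p_pr) E; exact: mod0z.
move=> /dvdz_mod0P; rewrite dvdzE !absz_nat => /(dvdn_leq (prime_gt0 p_pr)).
by apply/negP; rewrite -ltnNge -{1}(expn1 p) ltn_exp2l ?prime_gt1.
Qed.

(** A nonzero x divides some p^a. Since p is prime, each factor p can be removed either from x or
    from its cofactor, until their product is 1. *)
Lemma zp_factor (x : Zp) : x != 0 -> exists i u u', u * u' = 1 /\ x = p%:R ^+ i * u.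
Proof.
move=> x0; have [a [y]] := zp_dvd_pexp x0.
have p0 := zp_p_neq0.
elim: a x y {x0} => [|a IHa] x y.
  by rewrite expn0 => xy; exists 0%N, x, y; rewrite expr0 mul1r.
rewrite expnS natrM => xy; have [[x' xE]|[y' yE]] := zp_p_dvdM xy.
  have [|i [u [u' [uu' x'E]]]] := IHa x' y.
    by apply: (mulfI p0); rewrite -xy xE mulrA.
  by exists i.+1, u, u'; rewrite xE x'E exprS mulrA.
by apply: (IHa x y'); apply: (mulfI p0); rewrite -xy yE mulrCA.
Qed.

Lemma zp_mod_p (x : Zp) : exists (i : nat) (y : Zp), (i < p)%N /\ x = i%:R + p%:R * y.
Proof.
have p0 : p%:Z != 0 by rewrite -lt0n prime_gt0.
have x1 := zp_resmod x 1; rewrite expn1 in x1.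
have : 0 <= zp_res x 1 by rewrite -x1 modz_ge0.
case E : (zp_res x 1) => [i|//] _; exists i.
have [|y yE] := @zp_div_p (x - i%:R).
  change (((x 1%N + ((- ((i%:R : Zp) 1%N)) %% q 1)%Z) %% q 1)%Z = 0).
  by rewrite zp_natE modzNm modzDmr E subrr mod0z.
exists y; split; last by rewrite -yE addrC subrK.
by rewrite -ltz_nat -E -x1 ltz_pmod // ltz_nat prime_gt0.
Qed.
End PadicValuation.

Section Quadratic.
Variables (p : nat) (p_pr : prime p) (L : fieldExtType (Qp p_pr)).
Hypotheses (L_quadratic : \dim {: L} = 2%N) (L_unramified : unramified L).
Variable c : {lrmorphism L -> L}.
Hypothesis c_nontrivial : exists x : L, c x <> x.
Local Notation OL := (@integral _ _ L).
Local Notation Zpe := (@Zp_to_ext _ p_pr L).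

Lemma c_alg a : c a%:A = a%:A.
Proof. by rewrite linearZ /= rmorph1. Qed.

Lemma L_gen : exists2 x : L, c x <> x & forall y, exists a b : Qp p_pr, y = a%:A + b *: x.
Proof.
have [x cx] := c_nontrivial; exists x => // y.
have x1 : x \notin 1%VS by apply/negP => /vlineP[a xa]; apply: cx; rewrite xa c_alg.
have : y \in (1 + <[x]>)%VS.
  suff -> : (1 + <[x]> = fullv)%VS by apply: memvf.
  apply/eqP; rewrite eqEdim subvf L_quadratic.
  have <- : \dim (1%VS : {vspace L}) = 1%N by rewrite dim_vline oner_neq0.
  rewrite ltn_neqAle dimvS ?addvSl // andbT; apply/negP => /eqP dE.
  have /eqP E : (1 == 1 + <[x]>)%VS by rewrite eqEdim addvSl /= -dE.
  by move/negP: x1; apply; rewrite E memvE addvSr.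
move=> /memv_addP[u /vlineP[a ->] [v /vlineP[b ->] ->]]; by exists a, b.
Qed.

(** c fixes Q_p, so y and c y are roots of one quadratic polynomial over Q_p; hence c y = b - y with
    b in Q_p. *)
Lemma cK x : c (c x) = x.
Proof.
have [y cy gen] := L_gen.
have [a [b yy]] := gen (y * y).
have cyE : c y = b%:A - y.
  have cyy : c y * c y = a%:A + b *: c y by rewrite -rmorphM yy rmorphD /= c_alg linearZ.
  have : (c y - y) * (c y + y - b%:A) = 0.
    have -> : (c y - y) * (c y + y - b%:A) = c y * c y - y * y - b%:A * (c y - y) by ring.
    by rewrite cyy yy mulrBr !mulr_algl; ring.
  move/eqP; rewrite mulf_eq0 subr_eq0 => /orP[/eqP //|]; rewrite subr_eq0 => /eqP <-.
  by rewrite addrK.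
have [a' [b' ->]] := gen x.
have ccy : c (c y) = y by rewrite {1}cyE rmorphB /= c_alg cyE subKr.
by rewrite !rmorphD /= !c_alg !linearZ /= ccy.
Qed.

Lemma c_fixed x : c x = x -> exists a : Qp p_pr, x = a%:A.
Proof.
have [y cy gen] := L_gen; have [a [b ->]] := gen x.
rewrite rmorphD /= c_alg linearZ /= => /addrI/eqP.
rewrite -subr_eq0 -scalerBr scaler_eq0 subr_eq0 => /orP[/eqP ->|/eqP //].
by exists a; rewrite scale0r addr0.
Qed.

Lemma c_integral x : x \in OL -> c x \in OL.
Proof.
move=> /asboolP[P monP rP]; apply/asboolP; exists P => //.
suff -> : map_poly Zpe P = map_poly c (map_poly Zpe P).
  by rewrite /root horner_map (rootP rP) rmorph0.
by rewrite -map_poly_comp; apply: eq_map_poly => a /=; rewrite /Zp_to_ext /= c_alg.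
Qed.

Lemma Zpe_integral a : Zpe a \in OL.
Proof. by apply/asboolP; apply: integral_id. Qed.

Lemma one_notin_pO y : y \in OL -> p%:R * y != 1.
Proof.
case: L_unramified => _ n1 _ iy; apply/eqP => py; apply: n1.
exists (MkIntring iy) => //; apply: val_inj.
by rewrite rmorphM rmorph_nat rmorph1.
Qed.

Lemma pO_absurd y : y \in OL -> p%:R * y = 1 -> False.
Proof. by move=> /one_notin_pO /eqP. Qed.

Lemma p_neq0 : (p%:R : L) != 0.
Proof.
have -> : (p%:R : L) = Zpe p%:R by rewrite rmorph_nat.
by rewrite /Zp_to_ext /= scaler_eq0 oner_eq0 orbF tofrac_eq0 zp_p_neq0.
Qed.

Lemma pX_neq0 N : (p%:R ^+ N : L) != 0.
Proof. by rewrite expf_neq0 ?p_neq0. Qed.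

Lemma p_integral N : p%:R ^+ N \in OL.
Proof. by rewrite rpredX ?rpred_nat. Qed.

(** The two natural numbers encode the valuation j - i, which may be negative. *)
Lemma Qp_unit_decomp x : c x = x -> x != 0 ->
  exists i j u u', u * u' = 1 /\ x * p%:R ^+ i = p%:R ^+ j * Zpe u.
Proof.
move=> /c_fixed[a ->]; have [n [d [d0 dx]]] := fracP a => ax0.
have n0 : n != 0.
  apply: contraNneq ax0 => n0; rewrite n0 tofrac0 in dx.
  by move/eqP: dx; rewrite mulf_eq0 tofrac_eq0 (negPf d0) => /eqP ->; rewrite scale0r.
have [i [u [u' [uu' dE]]]] := zp_factor d0.
have [j [v [v' [vv' nE]]]] := zp_factor n0.
exists i, j, (v * u'), (v' * u); split; first by rewrite mulrACA vv' mul1r mulrC.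
have : Zpe d * a%:A = Zpe n by rewrite /Zp_to_ext /= -dx mulr_algl scalerA.
rewrite dE nE !rmorphM !rmorphXn !rmorph_nat /= => E.
have Zuu : Zpe u * Zpe u' = 1 by rewrite -rmorphM uu' rmorph1.
by rewrite mulrA -E -[LHS]mulr1 -Zuu; ring.
Qed.

(** Were the valuation j - i negative, p would have an integral inverse, although p O_L is a proper
    ideal. *)
Lemma fixed_integral_Zp x : c x = x -> x \in OL -> exists a, x = Zpe a.
Proof.
move=> cx ix; have [->|x0] := eqVneq x 0; first by exists 0; rewrite rmorph0.
have [i [j [u [u' [uu' xE]]]]] := Qp_unit_decomp cx x0.
have Zuu : Zpe u * Zpe u' = 1 by rewrite -rmorphM uu' rmorph1.
have [le_ij|lt_ji] := leqP i j.
  exists (p%:R ^+ (j - i) * u); apply: (mulIf (pX_neq0 i)).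
  by rewrite xE rmorphM rmorphXn rmorph_nat mulrAC -exprD subnK.
exfalso; have : p%:R * (p%:R ^+ (i - j).-1 * x * Zpe u') != 1.
  by apply: one_notin_pO; rewrite !rpredM ?Zpe_integral ?p_integral.
case/eqP; apply: (mulIf (pX_neq0 j)); rewrite mul1r !mulrA -exprS prednK ?subn_gt0 //.
transitivity (x * p%:R ^+ i * Zpe u'); last by rewrite xE -mulrA Zuu mulr1.
by rewrite -{2}(subnK (ltnW lt_ji)) exprD; ring.
Qed.

(** The valuation alternative in Q_p. Ratios of trace-zero elements are fixed by c, so it decides
    whether a point of the big cell lies in a given ball or is far away. *)
Lemma fixed_dichotomy x : c x = x -> x \in OL \/ exists2 y, y \in OL & x * (p%:R * y) = 1.
Proof.
move=> cx; have [->|x0] := eqVneq x 0; first by left; rewrite rpred0.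
have [i [j [u [u' [uu' xE]]]]] := Qp_unit_decomp cx x0.
have Zuu : Zpe u * Zpe u' = 1 by rewrite -rmorphM uu' rmorph1.
have [le_ij|lt_ji] := leqP i j; [left|right].
  suff -> : x = p%:R ^+ (j - i) * Zpe u by rewrite rpredM ?Zpe_integral ?p_integral.
  by apply: (mulIf (pX_neq0 i)); rewrite xE mulrAC -exprD subnK.
exists (p%:R ^+ (i - j).-1 * Zpe u'); first by rewrite rpredM ?Zpe_integral ?p_integral.
apply: (mulIf (pX_neq0 j)); rewrite mul1r !mulrA -[x * _ * _]mulrA -exprS prednK ?subn_gt0 //.
transitivity (x * p%:R ^+ i * Zpe u'); last by rewrite xE -mulrA Zuu mulr1.
by rewrite -{2}(subnK (ltnW lt_ji)) exprD; ring.
Qed.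

Lemma fixed_approx N x : c x = x -> x \in OL ->
  exists (i : nat) (y : L), [/\ (i < p ^ N)%N, c y = y, y \in OL & x = i%:R + p%:R ^+ N * y].
Proof.
move=> cx /(fixed_integral_Zp cx)[a ->].
suff [i [b [lti ->]]] : exists i (b : Defs.Zp p_pr), (i < p ^ N)%N /\ a = i%:R + p%:R ^+ N * b.
  exists i, (Zpe b); rewrite Zpe_integral; split=> //; first exact: c_alg.
  by rewrite rmorphD rmorphM rmorphXn !rmorph_nat.
elim: N a {x cx} => [|N IHN] a; first by exists 0%N, a; rewrite expn0 expr0 add0r mul1r.
have [i [b [lti ->]]] := zp_mod_p a; have [j [b' [ltj ->]]] := IHN b.
exists (i + p * j)%N, b'; split.
  apply: (@leq_trans (p + p * j)%N); first by rewrite ltn_add2r.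
  by rewrite -mulnS expnS leq_mul2l ltj orbT.
by rewrite mulrDr addrA natrD natrM exprS mulrA.
Qed.

Lemma nat_pdvd N (i : nat) y : y \in OL -> i%:R = p%:R ^+ N * y -> (p ^ N %| i)%N.
Proof.
elim: N i y => [|N IHN] i y iy iE; first by rewrite expn0 dvd1n.
have /dvdnP[i' i'E] : (p %| i)%N.
  apply: contrapT => /negP; rewrite -prime_coprime // => cop.
  have i0 : (0 < i)%N.
    by rewrite lt0n; apply: contraL cop => /eqP ->; rewrite /coprime gcdn0 neq_ltn prime_gt1 ?orbT.
  have [u v uv _] := egcdnP p i0.
  have gcd1 : gcdn i p = 1%N by move: cop; rewrite coprime_sym => /eqP.
  rewrite gcd1 in uv.
  have : p%:R * (u%:R * p%:R ^+ N * y - v%:R) != 1.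
    by apply: one_notin_pO; rewrite rpredB ?rpredM ?rpred_nat ?p_integral.
  have := congr1 (fun n => n%:R : L) uv; rewrite natrM natrD natrM iE exprS => E.
  case/eqP; transitivity (u%:R * (p%:R * p%:R ^+ N * y) - v%:R * p%:R : L); first by ring.
  by rewrite E addrC addKr.
rewrite i'E expnSr dvdn_mul //; apply: (IHN _ y iy).
by apply: (mulfI p_neq0); rewrite mulrA -exprS -iE i'E mulnC natrM.
Qed.

(** The norm z c(z) is fixed by c, so [fixed_dichotomy] applies to its inverse; the norm is 1 modulo
    p, which excludes the second alternative. *)
Lemma one_plus_p_inv y : y \in OL -> (1 + p%:R * y)^-1 \in OL.
Proof.
move=> iy; set z := 1 + p%:R * y.
have cz : c (z * c z) = z * c z by rewrite rmorphM /= cK mulrC.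
have zczE : z * c z = 1 + p%:R * (y + c y + p%:R * (y * c y)).
  by rewrite /z rmorphD rmorph1 rmorphM rmorph_nat; ring.
have iz : z * c z \in OL.
  by rewrite zczE rpredD ?rpred1 // rpredM ?rpred_nat // !(rpredD, rpredM) ?rpred_nat ?c_integral.
have zcz0 : z * c z != 0.
  apply/eqP => z0; move: zczE; rewrite z0 => /eqP; rewrite eq_sym addrC addr_eq0 => /eqP E.
  apply: (@pO_absurd (- (y + c y + p%:R * (y * c y)))).
    by rewrite rpredN !(rpredD, rpredM) ?rpred_nat ?c_integral.
  by rewrite mulrN E opprK.
suff iV : (z * c z)^-1 \in OL.
  have z0 : z != 0 by apply: contraNneq zcz0 => ->; rewrite mul0r.
  have -> : z^-1 = c z * (z * c z)^-1.
    by rewrite invfM mulrCA divff ?mulr1 // fmorph_eq0.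
  by rewrite rpredM // c_integral // rpredD ?rpred1 // rpredM ?rpred_nat.
have cV : c (z * c z)^-1 = (z * c z)^-1 by rewrite fmorphV /= cz.
have [//|[w iw wE]] := fixed_dichotomy cV.
exfalso; have zw : z * c z = p%:R * w by apply: (mulfI (invr_neq0 zcz0)); rewrite wE mulVf.
apply: (@pO_absurd (w - (y + c y + p%:R * (y * c y)))).
  by rewrite rpredB // !(rpredD, rpredM) ?rpred_nat ?c_integral.
by rewrite mulrBr -zw zczE addrK.
Qed.

Lemma one_plus_p_neq0 y : y \in OL -> 1 + p%:R * y != 0.
Proof.
move=> iy; apply/eqP => /eqP; rewrite addrC addr_eq0 => /eqP E.
by apply: (@pO_absurd (- y)); rewrite ?rpredN // mulrN E opprK.
Qed.

(* Dividing a trace-zero element by a power of p makes its square a unit: were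
   the valuation of the square odd, p O_L would not be prime. *)
Lemma ex_trace0_unit : exists2 e : L, c e = - e & [/\ e \in OL, e != 0 & (e * e)^-1 \in OL].
Proof.
have [x cx _] := L_gen; pose e0 := x - c x.
have ce0 : c e0 = - e0 by rewrite rmorphB /= cK opprB.
have e00 : e0 != 0 by rewrite subr_eq0; apply/eqP => /esym.
have cee : c (e0 * e0) = e0 * e0 by rewrite rmorphM /= ce0 mulrNN.
have [i [j [u [u' [uu' eE]]]]] := Qp_unit_decomp cee (mulf_neq0 e00 e00).
have Zuu : Zpe u * Zpe u' = 1 by rewrite -rmorphM uu' rmorph1.
(* Here (e0 p^i)^2 = p^(i+j) u; dividing e0 p^i by p^h leaves e^2 = p^b u with b the parity of i +
   j. *)
pose n := (i + j)%N; pose h := n./2; pose b := odd n.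
pose e := e0 * p%:R ^+ i / p%:R ^+ h.
have ee : e * e = p%:R ^+ b * Zpe u.
  have E2 : e0 * p%:R ^+ i * (e0 * p%:R ^+ i) = p%:R ^+ n * Zpe u.
    transitivity (p%:R ^+ i * (e0 * e0 * p%:R ^+ i)); first by ring.
    by rewrite eE /n exprD mulrA.
  have -> : e * e = e0 * p%:R ^+ i * (e0 * p%:R ^+ i) / (p%:R ^+ h * p%:R ^+ h).
    by rewrite /e invfM; ring.
  rewrite E2 -(odd_double_half n) -/h -/b exprD -addnn exprD.
  by rewrite mulrAC mulfK // mulf_neq0 ?pX_neq0.
have ce : c e = - e by rewrite /e !rmorphM /= fmorphV !rmorphXn !rmorph_nat /= ce0 !mulNr.
have e_neq0 : e != 0 by rewrite /e !mulf_neq0 ?invr_neq0 ?pX_neq0.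
have ie : e \in OL.
  apply/asboolP; pose P : {poly L} := 'X^2 - (e * e)%:P.
  apply: (@integral_root_monic _ _ _ _ P).
  - by rewrite /P monicXnsubC.
  - by apply/rootP; rewrite /P hornerD hornerN hornerXn hornerC expr2 subrr.
  - move=> y /(nthP 0)[l lt <-]; apply/asboolP; rewrite -[`[< _ >]]/(_ \in OL).
    rewrite /P coefB coefXn coefC rpredB ?rpred_nat //.
    by case: ifP => _; rewrite ?rpred0 // ee rpredM ?p_integral ?Zpe_integral.
have b0 : b = false.
  apply/negP => b1; rewrite b1 expr1 in ee.
  have [[_ ID IM] n1 maxp] := L_unramified.
  pose E : intring L := MkIntring ie.
  (* The ideal (p, e). Whether it is O_L or, by maximality, p O_L, one gets e = p v with v integral;
     then p u = p^2 v^2 makes p invertible. *)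
  pose I : set (intring L) := [set y | exists w w' : intring L, y = p%:R * w + w' * E].
  have iI : ideal I.
    split=> /= [|y y' [w [w' ->]] [v [v' ->]]|a y [w [w' ->]]].
    - by exists 0, 0; rewrite mulr0 mul0r addr0.
    - by exists (w + v), (w' + v'); ring.
    - by exists (a * w), (a * w'); ring.
  have [I1|nI1] := pselect (I 1).
    move: I1 => [w [w' E1]].
    have E1L : 1 = p%:R * val w + val w' * e.
      by have := congr1 val E1; rewrite rmorphD !rmorphM rmorph1 rmorph_nat.
    have eE' : e = p%:R * (val w * e + val w' * Zpe u).
      transitivity ((p%:R * val w + val w' * e) * e); first by rewrite -E1L mul1r.
      transitivity (p%:R * val w * e + val w' * (e * e)); first by ring.
      by rewrite ee; ring.
    pose v := val w * e + val w' * Zpe u.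
    have iv : v \in OL by rewrite rpredD // rpredM ?Zpe_integral //; apply: intring_valP.
    apply: (@pO_absurd (v * v * Zpe u')); first by rewrite !rpredM ?Zpe_integral.
    apply: (mulfI p_neq0); rewrite mulr1.
    transitivity (e * e * Zpe u'); first by rewrite {1 2}eE' -/v; ring.
    by rewrite ee -mulrA Zuu mulr1.
  have IE : I = range (fun y : intring L => p%:R * y).
    by apply: maxp => // _ [w _ <-]; exists w, 0; rewrite mul0r addr0.
  have : I E by exists 0, 1; rewrite mulr0 add0r mul1r.
  rewrite IE => -[w _ wE].
  have wL : e = p%:R * val w by have := congr1 val wE; rewrite rmorphM rmorph_nat => ->.
  apply: (@pO_absurd (val w * val w * Zpe u')).
    by rewrite !rpredM ?Zpe_integral //; apply: intring_valP.
  apply: (mulfI p_neq0); rewrite mulr1.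
  transitivity (e * e * Zpe u'); first by rewrite {1 2}wL; ring.
  by rewrite ee -mulrA Zuu mulr1.
exists e => //; split=> //.
rewrite ee b0 expr0 mul1r.
suff -> : (Zpe u)^-1 = Zpe u' by apply: Zpe_integral.
have u0 : Zpe u != 0 by apply: contraTneq isT => u0; move/eqP: Zuu; rewrite u0 mul0r eq_sym oner_eq0.
by apply: (mulfI u0); rewrite divff.
Qed.
End Quadratic.

(** * Elements of the unitary group *)

Section UnitaryElements.
Variables (p : nat) (p_pr : prime p) (L : fieldExtType (Qp p_pr)).
Hypotheses (L_quadratic : \dim {: L} = 2%N) (L_unramified : unramified L).
Variable c : {lrmorphism L -> L}.
Hypothesis c_nontrivial : exists x : L, c x <> x.
Local Notation OL := (@integral _ _ L).
Local Notation G := (U11 c).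
Local Notation T := (torus c).
Local Notation cK := (cK L_quadratic c_nontrivial).
Implicit Types (x y z : L) (g h : G).
Local Notation low g := (u11_mx g 1%R 0%R).
Local Notation slope g := (u11_mx g 1%R 1%R / u11_mx g 1%R 0%R)%R.

Definition mx2 (a b d e : L) : 'M[L]_2 := \matrix_(i, j)
  (if i == 0 then if j == 0 then a else b else if j == 0 then d else e).

Lemma mx2_eta (g : 'M[L]_2) : g = mx2 (g 0 0) (g 0 1) (g 1 0) (g 1 1).
Proof.
apply/matrixP => i j; rewrite mxE.
by case: i j => [[|[|i]] // hi] [[|[|j]] // hj] /=; congr (g _ _); apply: val_inj.
Qed.

Lemma mx2M a b d e a' b' d' e' : mx2 a b d e *m mx2 a' b' d' e' =
  mx2 (a * a' + b * d') (a * b' + b * e') (d * a' + e * d') (d * b' + e * e').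
Proof.
apply/matrixP => i j; rewrite !mxE !big_ord_recl big_ord0 /= !mxE /= addr0.
by case: i j => [[|[|i]] // hi] [[|[|j]] // hj].
Qed.

Lemma mx2_1 : 1%:M = mx2 1 0 0 1.
Proof. by apply/matrixP => i j; rewrite !mxE; case: i j => [[|[|i]] // hi] [[|[|j]] // hj]. Qed.

Lemma Jmx2 : Jmx L = mx2 0 1 1 0.
Proof. by apply/matrixP => i j; rewrite !mxE; case: i j => [[|[|i]] // hi] [[|[|j]] // hj]. Qed.

Lemma mx2_trc a b d e : (map_mx c (mx2 a b d e))^T = mx2 (c a) (c d) (c b) (c e).
Proof. by apply/matrixP => i j; rewrite !mxE; case: i j => [[|[|i]] // hi] [[|[|j]] // hj]. Qed.

Lemma mx2_inj a b d e a' b' d' e' : mx2 a b d e = mx2 a' b' d' e' ->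
  [/\ a = a', b = b', d = d' & e = e'].
Proof.
by move=> /matrixP E; split; [have := E 0 0|have := E 0 1|have := E 1 0|have := E 1 1]; rewrite !mxE.
Qed.

Lemma mx2_u11 a b d e : c a * d + c d * a = 0 -> c a * e + c d * b = 1 ->
  c b * d + c e * a = 1 -> c b * e + c e * b = 0 ->
  (mx2 a b d e \in unitmx) && ((map_mx c (mx2 a b d e))^T *m Jmx L *m mx2 a b d e == Jmx L).
Proof.
move=> h1 h2 h3 h4.
have E : (map_mx c (mx2 a b d e))^T *m Jmx L *m mx2 a b d e = Jmx L.
  rewrite mx2_trc Jmx2 !mx2M !mulr0 !mulr1 !addr0 !add0r.
  by rewrite (addrC (c d * a)) h1 (addrC (c d * b)) h2 (addrC (c e * a)) h3 (addrC (c e * b)) h4.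
rewrite E eqxx andbT.
have : (Jmx L *m ((map_mx c (mx2 a b d e))^T *m Jmx L)) *m mx2 a b d e = 1%:M.
  by rewrite -mulmxA E Jmx2 mx2M mx2_1 !mulr0 !mul0r !mulr1 !addr0 !add0r.
by move=> /mulmx1_unit[].
Qed.

Lemma u11_rel g (a := g 0 0) (b := g 0 1) (d := g 1 0) (e := g 1 1) :
  [/\ c a * d + c d * a = 0, c a * e + c d * b = 1,
      c b * d + c e * a = 1 & c b * e + c e * b = 0].
Proof.
have /andP[_ /eqP] := u11P g; rewrite [u11_mx g]mx2_eta -/a -/b -/d -/e.
rewrite mx2_trc Jmx2 !mx2M !mulr0 !mulr1 !addr0 !add0r => /mx2_inj[h1 h2 h3 h4].
by split; rewrite addrC.
Qed.

(* insubd returns 1 when the matrix is not unitary: uu and nn are meant for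
   c z = - z, tt for x != 0. *)
Definition uu z : G := insubd (1%g : G) (mx2 1 z 0 1).
Definition tt x : G := insubd (1%g : G) (mx2 x 0 0 (c x)^-1).
Definition nn z : G := insubd (1%g : G) (mx2 1 0 z 1).
Definition ww : G := insubd (1%g : G) (mx2 0 1 1 0).

Lemma uuE z : c z = - z -> u11_mx (uu z) = mx2 1 z 0 1.
Proof.
move=> cz; apply: insubdK; apply: mx2_u11; rewrite ?rmorph0 ?rmorph1 /= ?cz; ring.
Qed.
Lemma nnE z : c z = - z -> u11_mx (nn z) = mx2 1 0 z 1.
Proof.
move=> cz; apply: insubdK; apply: mx2_u11; rewrite ?rmorph0 ?rmorph1 /= ?cz; ring.
Qed.
Lemma wwE : u11_mx ww = mx2 0 1 1 0.
Proof. by apply: insubdK; apply: mx2_u11; rewrite ?rmorph0 ?rmorph1 /=; ring. Qed.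
Lemma ttE x : x != 0 -> u11_mx (tt x) = mx2 x 0 0 (c x)^-1.
Proof.
move=> x0; have cx0 : c x != 0 by rewrite fmorph_eq0.
apply: insubdK; apply: mx2_u11; rewrite ?rmorph0 /= ?fmorphV /= ?cK ?mulr0 ?mul0r ?addr0 ?add0r //.
  by rewrite divff.
by rewrite mulVf.
Qed.

Lemma tt_torus x : tt x \in @in_torus _ _ _ c.
Proof.
have [->|x0] := eqVneq x 0.
  (* For x = 0 the matrix is 0, hence not unitary, and [tt 0] is the default value 1. *)
  rewrite /tt /insubd insubN /=; last first.
    have -> : mx2 0 0 0 (c 0)^-1 = 0.
      by rewrite rmorph0 invr0; apply/matrixP => i j; rewrite !mxE; case: ifP; case: ifP.
    by rewrite unitmxE det0 unitr0.
  by have [] := in_torus_closed c.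
apply/asboolP; exists x => //; rewrite ttE //.
by apply/matrixP => i j; rewrite !mxE; case: i j => [[|[|i]] // hi] [[|[|j]] // hj].
Qed.

Definition ttT x : T := MkTorus (tt_torus x).

Lemma u11_eqP g h : g = h <-> u11_mx g = u11_mx h.
Proof. by split=> [->//|E]; apply: val_inj. Qed.

Lemma u11M g h : u11_mx (g * h)%g = u11_mx g *m u11_mx h.
Proof. by []. Qed.

Lemma uuD z z' : c z = - z -> c z' = - z' -> uu (z + z') = (uu z * uu z')%g.
Proof.
move=> cz cz'; apply/u11_eqP; rewrite u11M !uuE ?rmorphD /= ?cz ?cz' ?opprD //.
by rewrite mx2M; congr mx2; ring.
Qed.
Lemma uu0 : uu 0 = 1%g.
Proof. by apply/u11_eqP; rewrite uuE ?rmorph0 ?oppr0 //= mx2_1. Qed.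
Lemma ttM x y : x != 0 -> y != 0 -> tt (x * y) = (tt x * tt y)%g.
Proof.
move=> x0 y0; apply/u11_eqP; rewrite u11M !ttE ?mulf_neq0 //.
by rewrite mx2M rmorphM invfM; congr mx2; ring.
Qed.
Lemma ttTM x y : x != 0 -> y != 0 -> ttT (x * y) = (ttT x * ttT y)%g.
Proof. by move=> x0 y0; apply: val_inj; apply: ttM. Qed.
Lemma ttT1 : ttT 1 = 1%g.
Proof.
apply: val_inj; change (tt 1 = 1%g); apply/u11_eqP.
by rewrite ttE ?oner_neq0 // rmorph1 invr1 -mx2_1.
Qed.

Lemma norm_trace0 x z : c z = - z -> c (x * c x * z) = - (x * c x * z).
Proof. by move=> cz; rewrite !rmorphM /= cK cz; ring. Qed.

Lemma tt_uu x z : x != 0 -> c z = - z -> (tt x * uu z)%g = (uu (x * c x * z) * tt x)%g.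
Proof.
move=> x0 cz; have cx0 : c x != 0 by rewrite fmorph_eq0.
apply/u11_eqP; rewrite !u11M !ttE // !uuE ?norm_trace0 // !mx2M.
by congr mx2; rewrite ?mulr0 ?mul0r ?mulr1 ?mul1r ?addr0 ?add0r //; rewrite mulrAC mulfK // mulrC.
Qed.

Lemma ww_tt x : x != 0 -> (ww * tt x)%g = (tt (c x)^-1 * ww)%g.
Proof.
move=> x0; have cx0 : c x != 0 by rewrite fmorph_eq0.
apply/u11_eqP; rewrite !u11M !ttE ?invr_neq0 // !wwE !mx2M fmorphV /= cK invrK.
by congr mx2; rewrite ?mulr0 ?mul0r ?mulr1 ?mul1r ?addr0 ?add0r.
Qed.

Lemma cell_trace0 g : g 1 0 != 0 -> c (g 1 1 / g 1 0) = - (g 1 1 / g 1 0).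
Proof.
move=> d0; have [h1 h2 h3 h4] := u11_rel g; move: d0 h1 h2 h3 h4.
set a := g 0 0; set b := g 0 1; set d := g 1 0; set e := g 1 1 => d0 h1 h2 h3 h4.
have cd0 : c d != 0 by rewrite fmorph_eq0.
rewrite rmorphM fmorphV /=; apply: (mulIf d0); apply: (mulIf cd0).
rewrite mulNr divfK // mulrAC divfK //.
have caE : c a * d = - (c d * a) by apply/eqP; rewrite -addr_eq0 h1.
have : (c b * e + c e * b) * d * c d = 0 by rewrite h4 !mul0r.
have -> : (c b * e + c e * b) * d * c d = c b * d * (e * c d) + c e * d * (c d * b) by ring.
have -> : c d * b = 1 - c a * e by rewrite -h2 addrC addKr.
have -> : c b * d = 1 - c e * a by rewrite -h3 addrK.
have -> : (1 - c e * a) * (e * c d) + c e * d * (1 - c a * e)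
  = e * c d + c e * d - c e * e * (c d * a + c a * d) by ring.
rewrite caE subrr mulr0 subr0 => /eqP; rewrite addrC addr_eq0 => /eqP ->.
by rewrite mulNr.
Qed.

Lemma bruhat_cell g : g 1 0 != 0 -> exists2 s, c s = - s &
  g = (uu s * tt (c (low g))^-1 * ww * uu (slope g))%g.
Proof.
move=> d0; have ct := cell_trace0 d0.
have [h1 h2 h3 h4] := u11_rel g; move: d0 h1 h2 h3 h4 ct (mx2_eta g).
set a := g 0 0; set b := g 0 1; set d := g 1 0; set e := g 1 1 => d0 h1 h2 h3 h4 ct gE.
have cd0 : c d != 0 by rewrite fmorph_eq0.
have caE : c a * d = - (c d * a) by apply/eqP; rewrite -addr_eq0 h1.
have cs : c (a / d) = - (a / d).
  rewrite rmorphM fmorphV /=; apply: (mulIf d0); apply: (mulIf cd0).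
  by rewrite mulNr divfK // mulrAC divfK // caE mulNr mulrC.
(* The first column of the product is (s d, d), which forces s = a / d. *)
exists (a / d) => //; apply/u11_eqP; rewrite !u11M !uuE // ttE ?invr_neq0 // wwE !mx2M.
rewrite fmorphV /= cK invrK gE; congr mx2; rewrite ?mulr0 ?mul0r ?mulr1 ?mul1r ?addr0 ?add0r //.
- by rewrite divfK.
- apply: (mulfI cd0); transitivity (1 - c a * e); first by rewrite -h2 addrC addKr.
  have -> : c a = - (c d * a) / d by apply: (mulIf d0); rewrite divfK.
  by field; rewrite d0 cd0.
- by rewrite mulrC divfK.
Qed.

Lemma bruhat_borel g : g 1 0 = 0 -> g 0 0 != 0 /\ exists2 s, c s = - s & g = (tt (g 0 0)%R * uu s)%g.
Proof.
move=> d0; have [h1 h2 h3 h4] := u11_rel g; move: d0 h1 h2 h3 h4 (mx2_eta g).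
set a := g 0 0; set b := g 0 1; set d := g 1 0; set e := g 1 1 => d0 h1 h2 h3 h4 gE.
rewrite d0 rmorph0 mul0r addr0 in h2.
have a0 : a != 0 by apply: contra_eq_neq h2 => ->; rewrite rmorph0 mul0r eq_sym oner_neq0.
have ca0 : c a != 0 by rewrite fmorph_eq0.
have eE : e = (c a)^-1 by apply: (mulfI ca0); rewrite h2 mulfV.
have cs : c (b / a) = - (b / a).
  rewrite rmorphM fmorphV /=; apply/eqP; rewrite -addr_eq0; apply/eqP.
  by rewrite -[RHS]h4 eE fmorphV /= cK; congr (_ + _); rewrite mulrC.
split=> //; exists (b / a) => //; apply/u11_eqP; rewrite !u11M !uuE // ttE // !mx2M gE d0 eE.
by congr mx2; rewrite ?mulr0 ?mul0r ?mulr1 ?mul1r ?addr0 ?add0r // mulrC divfK.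
Qed.

Section IndFunctions.
Variables (R : comNzRingType) (sigma : rep R T).
Implicit Types f : ind sigma.

Lemma ind_uu f z g : c z = - z -> f (uu z * g)%g = f g.
Proof.
move=> cz; have /asboolP[fB _] := indP f.
rewrite (fB _ _ 1%g) ?act1 //; first by rewrite /in_borel uuE // mxE.
by rewrite invg1 mul1g; split; rewrite /in_borel uuE // mxE.
Qed.

Lemma ind_tt f x g : x != 0 -> f (tt x * g)%g = act sigma (ttT x) (f g).
Proof.
move=> x0; have /asboolP[fB _] := indP f.
apply: fB; first by rewrite /in_borel ttE // mxE.
by rewrite mulVg; split; rewrite /in_borel -[u11_mx 1%g]/(1%:M) mxE.
Qed.

Lemma ind_cell f g : g 1 0 != 0 ->
  f g = act sigma (ttT (c (low g))^-1) (f (ww * uu (slope g))%g).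
Proof.
move=> d0; have [s cs {1}->] := bruhat_cell d0.
by rewrite -!mulgA ind_uu // ind_tt // invr_neq0 // fmorph_eq0.
Qed.

Lemma ind_borel f g : g 1 0 = 0 -> f g = act sigma (ttT (g 0 0)) (f 1%g).
Proof.
move=> d0; have [a0 [s cs {1}->]] := bruhat_borel d0.
by rewrite ind_tt // -[uu s]mulg1 ind_uu.
Qed.

Lemma ind_ext f f' : f 1%g = f' 1%g ->
  (forall y, c y = - y -> f (ww * uu y)%g = f' (ww * uu y)%g) -> f = f'.
Proof.
move=> f1 fw; apply/val_inj/funext => g /=.
have [d0|d0] := eqVneq (g 1 0) 0; first by rewrite (ind_borel f d0) (ind_borel f' d0) f1.
by rewrite (ind_cell f d0) (ind_cell f' d0) fw // cell_trace0.
Qed.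

(** Relates the point 1 to the far end of the big cell: [nn y^-1] tends to 1 as y goes to infinity,
    so smoothness of f at 1 controls f(w u(y)) for large y. *)
Lemma ind_nn f y : y != 0 -> c y = - y ->
  f (nn y^-1) = act sigma (ttT (- y)) (f (ww * uu y)%g).
Proof.
move=> y0 cy; have cyV : c y^-1 = - y^-1 by rewrite fmorphV /= cy invrN.
rewrite ind_cell nnE // !mxE /=; last by rewrite invr_neq0.
by rewrite cyV invrN !invrK mul1r.
Qed.
End IndFunctions.
End UnitaryElements.

(** * Congruence subgroups and functions supported on a ball of the big cell *)

Section Congruence.
Variables (p : nat) (p_pr : prime p) (L : fieldExtType (Qp p_pr)).
Hypotheses (L_quadratic : \dim {: L} = 2%N) (L_unramified : unramified L).
Variable c : {lrmorphism L -> L}.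
Hypothesis c_nontrivial : exists x : L, c x <> x.
Local Notation OL := (@integral _ _ L).
Local Notation G := (U11 c).
Local Notation T := (torus c).
Local Notation cK := (cK L_quadratic c_nontrivial).
Local Notation ttT := (ttT L_quadratic c_nontrivial).
Local Notation tt := (@tt _ _ _ c).
Local Notation uu := (@uu _ _ _ c).
Local Notation nn := (@nn _ _ _ c).
Local Notation ww := (@ww _ _ _ c).
Implicit Types (x y z : L) (g h : G).
Local Notation low g := (u11_mx g 1%R 0%R).
Local Notation slope g := (u11_mx g 1%R 1%R / u11_mx g 1%R 0%R)%R.

Definition cong N g : Prop := exists2 X : 'M[L]_2, (forall i j, X i j \in OL) &
  u11_mx g = 1%:M + p%:R ^+ N *: X.

Lemma cong1 N : cong N 1%g.
Proof. by exists 0; [move=> i j; rewrite mxE rpred0|rewrite scaler0 addr0]. Qed.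

Lemma congM N g h : cong N g -> cong N h -> cong N (g * h)%g.
Proof.
move=> [X iX gX] [Y iY hY]; exists (X + Y + p%:R ^+ N *: (X *m Y)).
  move=> i j; rewrite !mxE !(rpredD, rpredM) ?rpredX ?rpred_nat //.
  by apply: rpred_sum => l _; rewrite rpredM.
rewrite u11M gX hY mulmxDl mul1mx mulmxDr mulmx1 -scalemxAl -scalemxAr.
by rewrite !scalerDr -!addrA; congr (_ + _); rewrite addrCA.
Qed.

(** Unitarity expresses the inverse of g as J g' J, where g' is the conjugate transpose, so the
    congruence is visible entry by entry. *)
Lemma congV N g : cong N g -> cong N g^-1%g.
Proof.
move=> [X iX gX]; exists (Jmx L *m (map_mx c X)^T *m Jmx L).
  move=> i j; rewrite mxE; apply: rpred_sum => l _; rewrite rpredM //; last by rewrite mxE rpred_nat.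
  rewrite mxE; apply: rpred_sum => l' _; rewrite rpredM //; first by rewrite mxE rpred_nat.
  by rewrite !mxE; apply: c_integral.
have JJ : Jmx L *m Jmx L = 1%:M.
  by rewrite Jmx2 mx2M mx2_1 !mulr0 !mul0r !mulr1 !addr0 !add0r.
have /andP[ug /eqP gJ] := u11P g.
transitivity (Jmx L *m (map_mx c g)^T *m Jmx L).
  have : Jmx L *m (map_mx c g)^T *m Jmx L *m g = 1%:M.
    by rewrite -!mulmxA [X in _ *m X]mulmxA gJ JJ.
  by move=> /(congr1 (mulmx^~ (invmx g))); rewrite mulmxK // mul1mx => ->.
rewrite gX map_mxD map_mx1 map_mxZ /= rmorphXn rmorph_nat linearD /= trmx1 linearZ /=.
by rewrite mulmxDr mulmxDl mulmx1 JJ -scalemxAr -scalemxAl.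
Qed.

Lemma congW M N g : (M <= N)%N -> cong N g -> cong M g.
Proof.
move=> /subnKC <- [X iX gX]; exists (p%:R ^+ (N - M) *: X).
  by move=> i j; rewrite mxE rpredM // rpredX ?rpred_nat.
by rewrite scalerA -exprD.
Qed.

Lemma cong_ball N g :
  (forall i j, adic_ball ((1%:M : 'M[L]_2) i j) N (u11_mx g i j)) <-> cong N g.
Proof.
split=> [gB|[X iX gX] i j]; last first.
  by exists (X i j) => //; rewrite gX !mxE natrX addrAC subrr add0r.
have ex i j : exists z, z \in OL /\ u11_mx g i j = (1%:M : 'M[L]_2) i j + p%:R ^+ N * z.
  by have [z iz zE] := gB i j; exists z; rewrite -natrX -zE addrC subrK.
exists (\matrix_(i, j) projT1 (cid (ex i j))).
  by move=> i j; rewrite mxE; case: cid => z [].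
by apply/matrixP => i j; rewrite !mxE; case: cid => z [_ /= E]; rewrite E mxE.
Qed.

Lemma open_cong (K : set G) : open K -> K 1%g -> exists N, forall g, cong N g -> K g.
Proof.
move=> [V oV <-] /= V1; have : nbhs (1%:M : 'M[adic L]_2) V.
  by rewrite openE in oV; apply: oV.
move=> [P PX sub].
have exn i j : exists n, adic_ball ((1%:M : 'M[L]_2) i j) n `<=` P i j.
  by have [n _ h] := PX i j; exists n.
pose n i j := projT1 (cid (exn i j)).
have nP i j : adic_ball ((1%:M : 'M[L]_2) i j) (n i j) `<=` P i j.
  by rewrite /n; case: cid.
exists (\sum_i \sum_j n i j)%N => g /cong_ball gB; apply: sub => i j /=; apply: nP.
apply: le_adic_ball (gB i j).
by rewrite (bigD1 i) //= (bigD1 j) //= -!addnA leq_addr.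
Qed.

Lemma cong_open N : open [set g | cong N g].
Proof.
exists [set X : 'M[adic L]_2 | forall i j, adic_ball ((1%:M : 'M[L]_2) i j) N (X i j)].
  rewrite openE => X XB; exists (fun i j => adic_ball (X i j) N).
    by move=> i j; exists N.
  by move=> Y XY i j; apply: adic_ball_trans (XB i j) (XY i j).
by apply/seteqP; split=> g /= /cong_ball.
Qed.

Lemma cong_open_subgroup N : open_subgroup [set g | cong N g].
Proof.
split; [exact: cong_open|exact: cong1|].
by move=> g h gN hN; apply: congM => //; apply: congV.
Qed.

Lemma cong_uu N a : a \in OL -> c (p%:R ^+ N * a) = - (p%:R ^+ N * a) -> cong N (uu (p%:R ^+ N * a)).
Proof.
move=> ia ca; exists (mx2 0 a 0 0).
  by move=> i j; rewrite mxE; do 2 case: ifP => _; rewrite ?rpred0.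
rewrite uuE // mx2_1; apply/matrixP => i j; rewrite !mxE.
by do 2 case: ifP => _; rewrite ?mulr0 ?addr0 ?add0r.
Qed.

Lemma cong_nn N a : a \in OL -> c (p%:R ^+ N * a) = - (p%:R ^+ N * a) -> cong N (nn (p%:R ^+ N * a)).
Proof.
move=> ia ca; exists (mx2 0 0 a 0).
  by move=> i j; rewrite mxE; do 2 case: ifP => _; rewrite ?rpred0.
rewrite nnE // mx2_1; apply/matrixP => i j; rewrite !mxE.
by do 2 case: ifP => _; rewrite ?mulr0 ?addr0 ?add0r.
Qed.

Lemma pXS_integral N a : a \in OL -> p%:R ^+ N * a \in OL.
Proof. by move=> ia; rewrite rpredM // rpredX ?rpred_nat. Qed.

Lemma one_plus_pX_neq0 N a : a \in OL -> 1 + p%:R ^+ N.+1 * a != 0.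
Proof.
move=> ia; rewrite exprS -mulrA.
by apply: (one_plus_p_neq0 L_unramified); apply: pXS_integral.
Qed.

Lemma one_plus_pX_inv N a : a \in OL -> exists2 b, b \in OL &
  (1 + p%:R ^+ N.+1 * a)^-1 = 1 + p%:R ^+ N.+1 * b.
Proof.
move=> ia; have n0 := one_plus_pX_neq0 N ia.
exists (- (a * (1 + p%:R ^+ N.+1 * a)^-1)).
  rewrite rpredN rpredM // exprS -mulrA.
  by apply: (one_plus_p_inv L_quadratic L_unramified c_nontrivial); apply: pXS_integral.
by field.
Qed.

Lemma c_one_plus_pX N a : c (1 + p%:R ^+ N * a) = 1 + p%:R ^+ N * c a.
Proof. by rewrite rmorphD rmorph1 rmorphM rmorphXn rmorph_nat. Qed.

(** The exponent N + 1 guarantees that 1 + p^(N+1) a is a unit for every integral a. *)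
Lemma cong_tt N a : a \in OL -> cong N.+1 (tt (1 + p%:R ^+ N.+1 * a)).
Proof.
move=> ia; have n0 := one_plus_pX_neq0 N ia.
have [b ib bE] := one_plus_pX_inv N (c_integral c ia).
exists (mx2 a 0 0 b).
  by move=> i j; rewrite mxE; do 2 case: ifP => _; rewrite ?rpred0.
rewrite (ttE L_quadratic c_nontrivial) // c_one_plus_pX bE mx2_1.
by apply/matrixP => i j; rewrite !mxE; do 2 case: ifP => _; rewrite ?mulr0 ?addr0.
Qed.

Lemma torus_small (S : set T) : open S -> S 1%g ->
  exists N, forall a, a \in OL -> S (ttT (1 + p%:R ^+ N.+1 * a)).
Proof.
move=> [V oV <-] /= V1; have [N NV] := open_cong oV V1.
by exists N => a ia; apply: NV => /=; apply: (congW (leqnSn N)); apply: cong_tt.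
Qed.

Lemma torus_elem (t : T) : exists2 x, x != 0 & t = ttT x.
Proof.
have /asboolP[x x0 tx] := torusP t; exists x => //.
apply/val_inj/u11_eqP; rewrite tx /= (ttE L_quadratic c_nontrivial) //.
by apply/matrixP => i j; rewrite !mxE; case: i j => [[|[|i]] // hi] [[|[|j]] // hj].
Qed.

Lemma smooth_small (R : comNzRingType) (V : rep R G) : smooth V ->
  forall v, exists N, forall g, cong N g -> act V g v = v.
Proof. by move=> smV v; apply: (open_cong (smV v)); apply: act1. Qed.

Section Bump.
Variables (R : comNzRingType) (sigma : rep R T).
Implicit Types f : ind sigma.

Lemma ind_small f : exists N, forall g h, cong N h -> f (g * h)%g = f g.
Proof.
have /asboolP[_ [K [oK K1 _] fK]] := indP f.
by have [N NK] := open_cong oK K1; exists N => g h /NK; apply: fK.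
Qed.

Lemma ind_periodic f : exists N, forall y a, a \in OL -> c y = - y ->
  c (p%:R ^+ N * a) = - (p%:R ^+ N * a) -> f (ww * uu (y + p%:R ^+ N * a))%g = f (ww * uu y)%g.
Proof.
have [N fN] := ind_small f; exists N => y a ia cy ca.
by rewrite (uuD cy ca) mulgA; apply: fN; apply: cong_uu.
Qed.

(** The equation on y says that y^-1 is divisible by p^N. In particular a function with f(1) = 0 has
    bounded support in the big cell. *)
Lemma ind_infinity f : exists N, forall y a, a \in OL -> c y = - y -> y * (p%:R ^+ N * a) = 1 ->
  act sigma (ttT (- y)) (f (ww * uu y)%g) = f 1%g.
Proof.
have [N fN] := ind_small f; exists N => y a ia cy ya.
have y0 : y != 0 by apply: contra_eq_neq ya => ->; rewrite mul0r eq_sym oner_neq0.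
have yV : y^-1 = p%:R ^+ N * a by apply: (mulfI y0); rewrite mulfV.
have cyV : c y^-1 = - y^-1 by rewrite fmorphV /= cy invrN.
rewrite -ind_nn // -[nn _]mul1g fN // yV; apply: cong_nn => //.
by rewrite -yV.
Qed.

(* The points B w u(y) of the big cell with y in z O_L. *)
Definition in_cell z g := (low g != 0) && (slope g / z \in OL).

Definition cellf_fun z v : G -> sigma :=
  fun g => if in_cell z g then act sigma (ttT (c (low g))^-1) v else 0.

(** [insubd] yields 0 unless [cellf_fun z v] is smooth and equivariant; [cellfE] identifies it for z
    != 0 and v fixed by small torus elements. *)
Definition cellf z v : ind sigma := insubd 0 (cellf_fun z v).

Definition small_vec v := exists N, forall a, a \in OL ->
  act sigma (ttT (1 + p%:R ^+ N.+1 * a)) v = v.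

Lemma in_cell_cong z v : z != 0 -> small_vec v -> exists N, forall g h, cong N h ->
  in_cell z g -> in_cell z (g * h)%g /\ cellf_fun z v (g * h)%g = cellf_fun z v g.
Proof.
move=> z0 [N0 vN0].
have [M iM] := clear_denom z; have [M' iM'] := clear_denom z^-1; rewrite natrX in iM; rewrite natrX in iM'.
(* M clears the denominator of z, hence of the slope r; M' clears that of z^-1; N0 + 1 keeps the
   change of the lower left entry inside the fixator of v. *)
exists (N0.+1 + M + M')%N => g h [X iX hX] gz; have /andP[d0 sz] := gz.
set r := slope g in sz.
have ir : p%:R ^+ M * r \in OL.
  by rewrite -[r](divfK z0) mulrCA rpredM.
have dE : u11_mx g 1 1 = r * low g by rewrite /r divfK.
pose a := p%:R ^+ M' * (p%:R ^+ M * X 0 0 + p%:R ^+ M * r * X 1 0).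
have ia : a \in OL by apply: pXS_integral; rewrite rpredD //; [apply: pXS_integral|apply: rpredM].
have lowE : low (g * h)%g = low g * (1 + p%:R ^+ N0.+1 * a).
  rewrite u11M hX mxE !big_ord_recl big_ord0 /= addr0 !mxE /=.
  rewrite (_ : lift ord0 ord0 = 1) ?dE; last exact: val_inj.
  by rewrite /a !exprD; ring.
have n0 := one_plus_pX_neq0 N0 ia.
have low0 : low (g * h)%g != 0 by rewrite lowE mulf_neq0.
have g11E : u11_mx (g * h)%g 1 1 = low g *
    (p%:R ^+ (N0.+1 + M + M')%N * X 0 1 + r * (1 + p%:R ^+ (N0.+1 + M + M')%N * X 1 1)).
  rewrite u11M hX mxE !big_ord_recl big_ord0 /= addr0 !mxE /=.
  rewrite (_ : lift ord0 ord0 = 1) ?dE; last exact: val_inj.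
  by ring.
have ghz : in_cell z (g * h)%g.
  rewrite /in_cell low0 /= lowE g11E invfM mulrACA divff // mul1r mulrAC.
  rewrite rpredM //; last first.
    have [b ib ->] := one_plus_pX_inv N0 ia.
    by rewrite rpredD ?rpred1 // pXS_integral.
  rewrite mulrDl rpredD //.
    have -> : p%:R ^+ (N0.+1 + M + M') * X 0 1 / z = p%:R ^+ (N0.+1 + M) * X 0 1 * (p%:R ^+ M' * z^-1).
      by rewrite exprD; ring.
    by rewrite rpredM // pXS_integral.
  by rewrite mulrAC rpredM // rpredD ?rpred1 // pXS_integral.
split=> //; rewrite /cellf_fun ghz gz lowE rmorphM /= c_one_plus_pX invfM.
have [b ib bE] := one_plus_pX_inv N0 (c_integral c ia).
rewrite bE ttTM ?actM ?vN0 //; first by rewrite invr_neq0 // fmorph_eq0.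
by rewrite one_plus_pX_neq0.
Qed.

Lemma cellf_funP z v : z != 0 -> small_vec v -> cellf_fun z v \in @in_ind _ _ _ c R sigma.
Proof.
move=> z0 sv; apply/asboolP; split.
  move=> b g t bB btU; have [x x0 tE] := torus_elem t.
  have cx0 : c x != 0 by rewrite fmorph_eq0.
  have tx : u11_mx t = mx2 x 0 0 (c x)^-1 by rewrite tE (ttE L_quadratic c_nontrivial).
  have b11 : u11_mx b 1 1 = (c x)^-1.
    have : u11_mx b = u11_mx t *m u11_mx ((t : G)^-1 * b)%g by rewrite -u11M mulgA mulgV mul1g.
    move=> /matrixP/(_ 1 1); rewrite mxE !big_ord_recl big_ord0 /= addr0.
    rewrite (_ : lift ord0 ord0 = 1); last exact: val_inj.
    by case: btU => _ _ ->; rewrite tx !mxE /= mul0r add0r mulr1.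
  have bgE j : u11_mx (b * g)%g 1 j = (c x)^-1 * u11_mx g 1 j.
    rewrite u11M mxE !big_ord_recl big_ord0 /= addr0.
    rewrite (_ : lift ord0 ord0 = 1); last exact: val_inj.
    by rewrite bB mul0r add0r b11.
  have -> : cellf_fun z v (b * g)%g =
      if in_cell z g then act sigma (ttT (x * (c (low g))^-1)) v else 0.
    rewrite /cellf_fun /in_cell !bgE mulf_eq0 invr_eq0 (negPf cx0) /= -mulf_div divff ?invr_neq0 //.
    by rewrite mul1r rmorphM fmorphV /= cK invfM invrK.
  rewrite /cellf_fun tE; case: ifP => [/andP[d0 _]|_]; last by rewrite linear0.
  by rewrite ttTM ?actM // invr_neq0 // fmorph_eq0.
have [N NP] := in_cell_cong z0 sv.
exists [set g | cong N g]; first exact: cong_open_subgroup.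
move=> g h /= hN; have [gz|ngz] := boolP (in_cell z g); first by have [] := NP _ _ hN gz.
(* The complement of the support is stable as well: apply the previous lemma to h^-1. *)
rewrite /cellf_fun (negPf ngz) ifN //; apply: contra ngz => ghz.
by have [] := NP _ _ (congV hN) ghz; rewrite -mulgA mulgV mulg1.
Qed.

Lemma cellfE z v g : z != 0 -> small_vec v ->
  cellf z v g = if in_cell z g then act sigma (ttT (c (low g))^-1) v else 0.
Proof. by move=> z0 sv; rewrite /cellf insubdK //; apply: cellf_funP. Qed.

Lemma cellf_1 z v : z != 0 -> small_vec v -> cellf z v 1%g = 0.
Proof.
have l0 : low (1%g : G) = 0 by rewrite -[u11_mx 1%g]/(1%:M) mxE.
by move=> z0 sv; rewrite cellfE // /in_cell l0 eqxx.
Qed.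

Lemma cellf_cell z v y : z != 0 -> small_vec v -> c y = - y ->
  cellf z v (ww * uu y)%g = if y / z \in OL then v else 0.
Proof.
move=> z0 sv cy; rewrite cellfE // /in_cell u11M wwE uuE // mx2M !mxE /=.
rewrite ?(mulr1, mul1r, mul0r, mulr0, addr0, add0r, oner_neq0, divr1) /=.
by rewrite rmorph1 invr1 ttT1 act1.
Qed.
End Bump.
End Congruence.

(** * Functions on the big cell *)

Section IndAnalysis.
Variables (p : nat) (p_pr : prime p) (L : fieldExtType (Qp p_pr)).
Hypotheses (L_quadratic : \dim {: L} = 2%N) (L_unramified : unramified L).
Variable c : {lrmorphism L -> L}.
Hypothesis c_nontrivial : exists x : L, c x <> x.
Local Notation OL := (@integral _ _ L).
Local Notation G := (U11 c).
Local Notation T := (torus c).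
Local Notation cK := (cK L_quadratic c_nontrivial).
Local Notation ttT := (ttT L_quadratic c_nontrivial).
Local Notation tt := (@tt _ _ _ c).
Local Notation uu := (@uu _ _ _ c).
Local Notation ww := (@ww _ _ _ c).
Local Notation cellf := (cellf L_quadratic c_nontrivial).
Local Notation small_vec := (small_vec L_quadratic c_nontrivial).
Implicit Types (x y z : L) (g h : G).

Lemma trace0M r z : c r = r -> c z = - z -> c (r * z) = - (r * z).
Proof. by move=> cr cz; rewrite rmorphM /= cr cz mulrN. Qed.
Lemma trace0B y z : c y = - y -> c z = - z -> c (y - z) = - (y - z).
Proof. by move=> cy cz; rewrite rmorphB /= cy cz opprB opprK addrC. Qed.
Lemma trace0D y z : c y = - y -> c z = - z -> c (y + z) = - (y + z).
Proof. by move=> cy cz; rewrite rmorphD /= cy cz opprD. Qed.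
Lemma trace0_ratio y z : c y = - y -> c z = - z -> c (y / z) = y / z.
Proof. by move=> cy cz; rewrite rmorphM fmorphV /= cy cz invrN mulrNN. Qed.
Lemma c_nat n : c n%:R = n%:R. Proof. exact: rmorph_nat. Qed.
Lemma c_pX N : c (p%:R ^+ N) = p%:R ^+ N. Proof. by rewrite rmorphXn rmorph_nat. Qed.
Lemma c_pXV N : c (p%:R ^+ N)^-1 = (p%:R ^+ N)^-1. Proof. by rewrite fmorphV /= c_pX. Qed.

(** The classes i + p^M with i < p^M partition the integral elements fixed by c, so at most one term
    survives: the residue of r, found by [fixed_approx] and unique by [nat_pdvd]. This turns a sum
    over translates of a ball into a pointwise value. *)
Lemma sum_residue (V : zmodType) (M : nat) r (F : nat -> V) : c r = r ->
  (r \in OL -> exists i0 b, [/\ (i0 < p ^ M)%N, c b = b, b \in OL, r = i0%:R + p%:R ^+ M * b &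
     \sum_(i < p ^ M) (if (r - i%:R) / p%:R ^+ M \in OL then F i else 0) = F i0]) /\
  (r \notin OL -> \sum_(i < p ^ M) (if (r - i%:R) / p%:R ^+ M \in OL then F i else 0) = 0).
Proof.
move=> cr; split=> [ir|nr]; last first.
  rewrite big1 // => i _; rewrite ifN //; apply: contra nr => ir.
  have -> : r = (r - i%:R) / p%:R ^+ M * p%:R ^+ M + i%:R by rewrite divfK ?pX_neq0 // subrK.
  by rewrite rpredD ?rpred_nat // rpredM // p_integral.
have [i0 [b [lti cb ib rE]]] := fixed_approx L_quadratic L_unramified c_nontrivial M cr ir.
exists i0, b; split=> //; rewrite (bigD1 (Ordinal lti)) //= big1 ?addr0 => [|i ne].
  suff -> : (r - i0%:R) / p%:R ^+ M = b by rewrite ib.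
  by rewrite rE addrAC subrr add0r mulrAC divff ?pX_neq0 // mul1r.
rewrite ifN //; apply: contraNN ne => ii; apply/eqP/val_inj => /=.
have key : forall m n : nat, (m <= n)%N -> (n < p ^ M)%N -> forall b', b' \in OL ->
    n%:R - m%:R = p%:R ^+ M * b' -> m = n.
  move=> m n le ltn b' ib' E; have := nat_pdvd L_unramified ib' (i := (n - m)%N) (N := M).
  rewrite natrB // => /(_ E); rewrite /dvdn modn_small; last exact: leq_ltn_trans (leq_subr _ _) ltn.
  by rewrite subn_eq0 => le'; apply/eqP; rewrite eqn_leq le le'.
have E : i0%:R - i%:R = p%:R ^+ M * ((r - i%:R) / p%:R ^+ M - b).
  by rewrite mulrBr mulrC divfK ?pX_neq0 // {1}rE; ring.
have ib' : (r - i%:R) / p%:R ^+ M - b \in OL by rewrite rpredB.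
have [le|le] := leqP i i0; first exact: (key i i0 le lti _ ib' E).
apply/esym; apply: (key i0 i (ltnW le) (ltn_ord i) (- ((r - i%:R) / p%:R ^+ M - b))); first by rewrite rpredN.
by rewrite mulrN -E opprB.
Qed.

Section General.
Variables (R : comNzRingType) (sigma : rep R T).
Hypothesis sm : forall v : sigma, small_vec v.
Implicit Types f : Ind sigma.

Lemma ind_actE g f h : act (Ind sigma) g f h = f (h * g)%g.
Proof. by []. Qed.

Lemma ind_addE f f' g : ind_fun (f + f') g = ind_fun f g + ind_fun f' g.
Proof. by []. Qed.
Lemma ind_scaleE a f g : ind_fun (a *: f) g = a *: ind_fun f g.
Proof. by []. Qed.

Lemma ind_sumE (I : Type) (s : seq I) (P : pred I) (F : I -> Ind sigma) g :
  ind_fun (\sum_(i <- s | P i) F i) g = \sum_(i <- s | P i) ind_fun (F i) g.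
Proof. by elim/big_rec2: _ => // i y1 y2 _ <-. Qed.

Lemma ind_uu1 f z : c z = - z -> f (uu z) = f 1%g.
Proof. by move=> cz; rewrite -[uu z]mulg1 ind_uu. Qed.

Lemma cellf_act_uu z v a y : z != 0 -> c y = - y -> c a = - a ->
  act (Ind sigma) (uu a) (cellf z v) (ww * uu y)%g = if (y + a) / z \in OL then v else 0.
Proof.
by move=> z0 cy ca; rewrite ind_actE -mulgA -uuD // cellf_cell // trace0D.
Qed.

Lemma cellf_act_uu1 z v a : z != 0 -> c a = - a -> act (Ind sigma) (uu a) (cellf z v) 1%g = 0.
Proof. by move=> z0 ca; rewrite ind_actE mul1g ind_uu1 // cellf_1. Qed.

Lemma cellfZ z a v : z != 0 -> cellf z (a *: v) = a *: cellf z v :> Ind sigma.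
Proof.
move=> z0; apply: (ind_ext L_quadratic c_nontrivial) => [|y cy].
  by rewrite ind_scaleE !cellf_1 ?scaler0.
by rewrite ind_scaleE !cellf_cell //; case: ifP; rewrite ?scaler0.
Qed.

Lemma cellf_split M z v : z != 0 -> c z = - z ->
  cellf z v = \sum_(i < p ^ M) act (Ind sigma) (uu (i%:R * z)) (cellf (p%:R ^+ M * z) v) :> Ind sigma.
Proof.
move=> z0 cz; have pz0 : p%:R ^+ M * z != 0 by rewrite mulf_neq0 ?pX_neq0.
have ciz (i : 'I_(p ^ M)) : c (i%:R * z) = - (i%:R * z) by apply: trace0M; rewrite ?c_nat.
apply: (ind_ext L_quadratic c_nontrivial) => [|y cy].
  by rewrite ind_sumE cellf_1 // big1 // => i _; rewrite cellf_act_uu1.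
rewrite ind_sumE cellf_cell //.
(* The sign comes from right translation: u(a) moves the support by -a. *)
pose r := - (y / z); have cr : c r = r by rewrite rmorphN /= trace0_ratio.
transitivity (\sum_(i < p ^ M) (if (r - i%:R) / p%:R ^+ M \in OL then v else 0)); last first.
  apply: eq_bigr => i _; rewrite cellf_act_uu //.
  have -> : (y + i%:R * z) / (p%:R ^+ M * z) = - ((r - i%:R) / p%:R ^+ M).
    by rewrite /r; field; rewrite z0 pX_neq0.
  by rewrite rpredN.
have [h1 h2] := @sum_residue sigma M r (fun=> v) cr.
case: ifP => [iy|/negbT ny]; last by rewrite h2 // rpredN.
by have [|? [? [_ _ _ _ ->]]] := h1; rewrite ?rpredN.
Qed.

Variables (e : L).
Hypotheses (ce : c e = - e) (e0 : e != 0) (ie : e \in OL) (ieV : e^-1 \in OL).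

(** As f(1) = 0, f is supported on a ball of radius index -N by [ind_infinity], and it is constant
    on balls of index N by [ind_periodic]; the large ball contains p^(2N) small ones. *)
Lemma ind_decomp f : f 1%g = 0 -> exists N, f =
  \sum_(i < p ^ (N + N)) act (Ind sigma) (uu (- (i%:R * (e / p%:R ^+ N))))
     (cellf (p%:R ^+ N * e) (f (ww * uu (i%:R * (e / p%:R ^+ N))))%g).
Proof.
move=> f1; have [N1 fN1] := ind_infinity L_quadratic c_nontrivial f.
have [N2 fN2] := ind_periodic f.
pose N := (N1 + N2)%N; exists N.
have N0 := pX_neq0 L N.
have pe0 : p%:R ^+ N * e != 0 by rewrite mulf_neq0.
have ce' : c (e / p%:R ^+ N) = - (e / p%:R ^+ N) by rewrite rmorphM /= c_pXV ce mulNr.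
have ciz (i : nat) : c (- (i%:R * (e / p%:R ^+ N))) = - (- (i%:R * (e / p%:R ^+ N))).
  by rewrite rmorphN /= trace0M // c_nat.
apply: (ind_ext L_quadratic c_nontrivial) => [|y cy].
  by rewrite ind_sumE f1 big1 // => i _; rewrite cellf_act_uu1.
rewrite ind_sumE; pose r := y * p%:R ^+ N / e.
have cr : c r = r by rewrite /r mulrAC rmorphM /= c_pX trace0_ratio.
pose F (i : nat) := f (ww * uu (i%:R * (e / p%:R ^+ N)))%g.
transitivity (\sum_(i < p ^ (N + N)) (if (r - i%:R) / p%:R ^+ (N + N) \in OL then F i else 0)); last first.
  apply: eq_bigr => i _; rewrite cellf_act_uu // -/(F i).
  suff -> : (y - i%:R * (e / p%:R ^+ N)) / (p%:R ^+ N * e) = (r - i%:R) / p%:R ^+ (N + N) by [].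
  by rewrite /r exprD; field; rewrite e0 N0.
have [h1 h2] := sum_residue (N + N) F cr.
have [ir|nr] := boolP (r \in OL).
  have [i0 [b [lti cb ib rE ->]]] := h1 ir; rewrite /F.
  have -> : y = i0%:R * (e / p%:R ^+ N) + p%:R ^+ N2 * (p%:R ^+ N1 * e * b).
    have -> : y = r * (e / p%:R ^+ N) by rewrite /r; field; rewrite e0 N0.
    by rewrite rE exprD {2}/N [in RHS]/N; rewrite /N !exprD; field; rewrite !pX_neq0.
  rewrite fN2 //.
  - by rewrite !rpredM // p_integral.
  - by rewrite trace0M // c_nat.
  - by rewrite mulrA mulrC trace0M // mulrA trace0M // rmorphM /= !c_pX.
rewrite h2 //; have [|[b ib rb]] := fixed_dichotomy L_quadratic c_nontrivial cr.
  by move=> ir; rewrite ir in nr.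
have yb : y * (p%:R ^+ N1 * (p%:R ^+ N2 * (p%:R * b) * e^-1)) = 1.
  transitivity (r * (p%:R * b)); last exact: rb.
  by rewrite /r /N exprD; ring.
have y0 : y != 0 by apply: contra_eq_neq yb => ->; rewrite mul0r eq_sym oner_neq0.
have := fN1 y _ _ cy yb; rewrite f1 => fy.
have : act sigma (ttT (- y))^-1%g (act sigma (ttT (- y)) (f (ww * uu y)%g)) = 0.
  rewrite fy ?linear0 //; rewrite rpredM // rpredM ?p_integral // rpredM ?rpred_nat //.
by rewrite -actM mulVg act1.
Qed.

(** An induction principle for functions with values in W. It serves for all of [sigma], to lift
    functions, and for the kernel of a reduction, to describe the functions that reduce to 0. *)
Lemma ind_gen (W : set sigma) (P : set (Ind sigma)) : W 0 ->
  (forall v w, W v -> W w -> W (v - w)) -> (forall t v, W v -> W (act sigma t v)) ->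
  P 0 -> (forall f f', P f -> P f' -> P (f + f')) ->
  (forall g f, P f -> P (act (Ind sigma) g f)) ->
  (forall z v, z != 0 -> W v -> P (cellf z v)) ->
  forall f, (forall g, W (f g)) -> P f.
Proof.
move=> W0 WB WT P0 PD PG Pb f Wf.
(* A translated cell function agreeing with f at 1; the difference vanishes at 1, so [ind_decomp]
   applies to it. *)
pose f1 := act (Ind sigma) ww (cellf e (f 1%g)).
have Wf1 g : W (f1 g).
  rewrite /f1 ind_actE cellfE //; case: ifP => // _; exact: WT.
have Wff1 g : W ((f - f1) g) by exact: (WB _ _ (Wf g) (Wf1 g)).
have -> : f = f1 + (f - f1) by rewrite addrC subrK.
apply: (PD); first by apply: PG; apply: Pb.
have ff1 : (f - f1) 1%g = 0.
  rewrite -[RHS](subrr (f 1%g)); change (f 1%g - f1 1%g = f 1%g - f 1%g); congr (_ - _).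
  by rewrite /f1 ind_actE mul1g -[ww]mulg1 -(uu0 c) cellf_cell ?rmorph0 ?oppr0 // mul0r rpred0.
have [N E] := ind_decomp ff1; rewrite E.
apply: (big_ind P P0 PD) => i _; apply: PG; apply: Pb => //.
by rewrite mulf_neq0 ?pX_neq0.
Qed.
End General.
End IndAnalysis.

(** * Coinvariants of lifts *)

Section UnipotentAugmentation.
Variables (p : nat) (p_pr : prime p) (L : fieldExtType (Qp p_pr)).
Hypotheses (L_quadratic : \dim {: L} = 2%N) (L_unramified : unramified L).
Variable c : {lrmorphism L -> L}.
Hypothesis c_nontrivial : exists x : L, c x <> x.
Local Notation OL := (@integral _ _ L).
Local Notation G := (U11 c).
Local Notation T := (torus c).
Local Notation cK := (cK L_quadratic c_nontrivial).
Local Notation tt := (@tt _ _ _ c).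
Local Notation uu := (@uu _ _ _ c).
Local Notation ww := (@ww _ _ _ c).
Implicit Types (x z : L) (g h : G).
Variables (e : L).
Hypotheses (ce : c e = - e) (e0 : e != 0).

Section Smooth.
Variables (R : comNzRingType) (M : rep R G).
Hypothesis smM : smooth M.
Implicit Types v w y : M.

Definition utr (q : nat) z w : M := \sum_(i < q) act M (uu (i%:R * z)) w.

(** With u = u(z), this is u^q - 1 = (u - 1)(1 + u + ... + u^(q-1)), the second factor being
    [utr q z]. *)
Lemma utr_telescope q z w : c z = - z ->
  act M (uu (q%:R * z)) w - w = act M (uu z) (utr q z w) - utr q z w.
Proof.
move=> cz; elim: q => [|q IHq].
  by rewrite /utr big_ord0 linear0 mul0r uu0 act1 !subrr.
rewrite /utr big_ord_recr /= -/(utr q z w) linearD /= -actM -uuD //; last first.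
  by rewrite trace0M // c_nat.
rewrite (_ : q.+1%:R * z = z + q%:R * z); last by rewrite mulrSr mulrDl mul1r addrC.
by rewrite opprD addrACA -IHq [RHS]addrC addrA subrK.
Qed.

(* The sums of vectors u w - w with w in S are of this form, see uaugD. *)
Definition uaug (S : set M) : set M :=
  [set y | exists z w, [/\ c z = - z, S w & y = act M (uu z) w - w]].

Lemma uu_small w : exists N, forall a, a \in OL -> c (p%:R ^+ N * a) = - (p%:R ^+ N * a) ->
  act M (uu (p%:R ^+ N * a)) w = w.
Proof.
have [N wN] := smooth_small smM w; exists N => a ia ca.
by apply: wN; apply: cong_uu.
Qed.

(* U is topologically cyclic modulo every open subgroup. *)
Lemma uaug_generator z z1 w : c z = - z -> c z1 = - z1 -> z1 != 0 -> z / z1 \in OL ->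
  exists q, act M (uu z) w - w = act M (uu z1) (utr q z1 w) - utr q z1 w.
Proof.
move=> cz cz1 z10 iz; have [N wN] := uu_small w.
have [m im] := clear_denom z1; rewrite natrX in im.
(* q approximates z / z1 so well that u(z - q z1) fixes w: m clears the denominator of z1, and N is
   the level of w. *)
have [q [b [_ cb ib zE]]] := fixed_approx L_quadratic L_unramified c_nontrivial (N + m)
  (trace0_ratio cz cz1) iz.
exists q; rewrite -utr_telescope //; congr (_ - _).
have -> : z = q%:R * z1 + p%:R ^+ N * (p%:R ^+ m * z1 * b).
  by rewrite -{1}(divfK z10 z) zE exprD; ring.
have cpb : c (p%:R ^+ N * (p%:R ^+ m * z1 * b)) = - (p%:R ^+ N * (p%:R ^+ m * z1 * b)).
  rewrite mulrAC mulrA trace0M // !rmorphM /= !c_pX cb //.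
rewrite uuD ?actM ?wN //; first by rewrite rpredM.
by rewrite trace0M // c_nat.
Qed.

Section Closed.
Variable S : set M.
Hypotheses (S0 : S 0) (SD : forall v w, S v -> S w -> S (v + w)).
Hypotheses (SZ : forall a v, S v -> S (a *: v)) (SG : forall g v, S v -> S (act M g v)).

Lemma utr_closed q z w : S w -> S (utr q z w).
Proof. by move=> Sw; apply: (big_ind S) => // i _; apply: SG. Qed.

Lemma ratio_big z : exists m, z / (e / p%:R ^+ m) \in OL.
Proof.
have [m im] := clear_denom (z / e); exists m; rewrite natrX in im.
suff -> : z / (e / p%:R ^+ m) = p%:R ^+ m * (z / e) by [].
by field; rewrite e0 pX_neq0.
Qed.

(** Both z and z' are integral multiples of e / p^(m + m'), so one topological generator serves
    both. This makes [uaug] closed under addition. *)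
Lemma uaug_common y y' : uaug S y -> uaug S y' -> exists z w w',
  [/\ c z = - z, S w, S w', y = act M (uu z) w - w & y' = act M (uu z) w' - w'].
Proof.
move=> [z [w [cz Sw ->]]] [z' [w' [cz' Sw' ->]]].
have [m im] := ratio_big z; have [m' im'] := ratio_big z'.
pose z1 := e / p%:R ^+ (m + m').
have cz1 : c z1 = - z1 by rewrite /z1 rmorphM /= c_pXV ce mulNr.
have z10 : z1 != 0 by rewrite mulf_neq0 ?invr_neq0 ?pX_neq0.
have [|q ->] := @uaug_generator z z1 w cz cz1 z10.
  have -> : z / z1 = p%:R ^+ m' * (z / (e / p%:R ^+ m)).
    by rewrite /z1 exprD; field; rewrite e0 !pX_neq0.
  by rewrite rpredM // p_integral.
have [|q' ->] := @uaug_generator z' z1 w' cz' cz1 z10.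
  have -> : z' / z1 = p%:R ^+ m * (z' / (e / p%:R ^+ m')).
    by rewrite /z1 exprD; field; rewrite e0 !pX_neq0.
  by rewrite rpredM // p_integral.
by exists z1, (utr q z1 w), (utr q' z1 w'); split=> //; apply: utr_closed.
Qed.

Lemma uaug0 : uaug S 0.
Proof. by exists 0, 0; split=> //; [rewrite rmorph0 oppr0|rewrite linear0 subrr]. Qed.

Lemma uaugD y y' : uaug S y -> uaug S y' -> uaug S (y + y').
Proof.
move=> uy uy'; have [z [w [w' [cz Sw Sw' -> ->]]]] := uaug_common uy uy'.
by exists z, (w + w'); split=> //; [apply: SD|rewrite linearD opprD addrACA].
Qed.

Lemma uaugZ a y : uaug S y -> uaug S (a *: y).
Proof.
move=> [z [w [cz Sw ->]]]; exists z, (a *: w); split=> //; first exact: SZ.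
by rewrite linearZ scalerBr.
Qed.

Lemma uaugN y : uaug S y -> uaug S (- y).
Proof. by rewrite -scaleN1r; apply: uaugZ. Qed.

Lemma uaug_sum (I : eqType) (s : seq I) (F : I -> M) :
  (forall i, i \in s -> uaug S (F i)) -> uaug S (\sum_(i <- s) F i).
Proof.
by move=> sF; rewrite big_seq; apply: (big_ind (uaug S)) => //; [exact: uaug0|exact: uaugD].
Qed.

Lemma uaug_tt x y : x != 0 -> uaug S y -> uaug S (act M (tt x) y).
Proof.
move=> x0 [z [w [cz Sw ->]]]; exists (x * c x * z), (act M (tt x) w); split.
- exact: norm_trace0.
- exact: SG.
- by rewrite linearB /= -!actM tt_uu.
Qed.

End Closed.

Lemma uaugS (S S' : set M) y : S `<=` S' -> uaug S y -> uaug S' y.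
Proof. by move=> SS' [z [w [cz Sw ->]]]; exists z, w; split=> //; apply: SS'. Qed.
End Smooth.
End UnipotentAugmentation.

(** * Freeness of the coinvariants of a lift *)

Section Core.
Variables (p : nat) (p_pr : prime p) (L : fieldExtType (Qp p_pr)).
Hypotheses (L_quadratic : \dim {: L} = 2%N) (L_unramified : unramified L).
Variable c : {lrmorphism L -> L}.
Hypothesis c_nontrivial : exists x : L, c x <> x.
Local Notation OL := (@integral _ _ L).
Local Notation G := (U11 c).
Local Notation tt := (@tt _ _ _ c).
Local Notation uu := (@uu _ _ _ c).
Implicit Types (x z : L) (g h : G).
Variables (e : L).
Hypotheses (ce : c e = - e) (e0 : e != 0).

Variables (R : comNzRingType) (k : fieldType) (aug : {rmorphism R -> k}).
Hypotheses (locR : local_ring R) (artR : artinian R).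
Hypothesis aug_surj : forall y : k, exists a : R, aug a = y.
Local Notation mpow := (@mpow R k aug).

Variables (M : rep R G) (Mbar : rep k G) (phi : {linear M -> Mbar | aug \; *:%R}).
Hypothesis phiG : forall g v, phi (act M g v) = act Mbar g (phi v).
Hypothesis phi_surj : forall w, exists v, phi v = w.
Hypotheses (smM : smooth M) (freeM : free_module M) (bcM : is_base_change phi).
Local Notation powM := (@powM R k aug M).
Local Notation uaugM := (@uaug _ _ _ c R M).
Implicit Types v w y : M.

Let lift_coordM := lift_coord freeM bcM.

Lemma powM1E v : powM 1 v <-> phi v = 0.
Proof. by split; [exact: powM1_ker|exact: ker_powM1]. Qed.

(* Elimination: a coordinate in which h w is a unit expresses its coefficient
   through the others modulo m^(j+1). *)
Lemma kernel_devissage j (h : {linear M -> M}) (s : seq (R * M)) :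
  (forall aw, aw \in s -> mpow j aw.1) -> powM j.+1 (\sum_(aw <- s) aw.1 *: h aw.2) ->
  exists2 t : seq (R * M), (forall aw, aw \in t -> mpow j aw.1 /\ phi (h aw.2) = 0)
    & powM j.+1 (\sum_(aw <- s) aw.1 *: aw.2 - \sum_(aw <- t) aw.1 *: aw.2).
Proof.
have [co [colin coe coP]] := lift_coordM.
elim: {s}(size s) {-2}s (erefl (size s)) => [|n IHn] s sn sj hs.
  by exists [::]; rewrite ?big_nil // (size0nil sn) big_nil subr0; apply: powM0.
have [[aw0 aw0s /eqP naw0]|all0] := pselect (exists2 aw, aw \in s & phi (h aw.2) <> 0); last first.
  exists s; last by rewrite subrr; apply: powM0.
  move=> aw aws; split; first exact: sj.
  by apply: contrapT => naw; apply: all0; exists aw.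
have [i /eqP ni] : exists i, aug (co i (h aw0.2)) <> 0.
  by apply: contrapT => /forallNP ni; case/eqP: naw0; apply/coP => i; apply: contrapT => /ni.
have [d d1] := aug_unit locR aug_surj ni.
have perm := perm_to_rem aw0s; pose s' := rem aw0 s.
have sum_s (N : zmodType) (F : R * M -> N) : \sum_(aw <- s) F aw = F aw0 + \sum_(aw <- s') F aw.
  by rewrite (perm_big _ perm) big_cons.
pose co_lin : {linear M -> R^o} := HB.pack (co i)
  (GRing.isLinear.Build R M R^o *:%R (co i) (colin i)).
have coh : mpow j.+1 (\sum_(aw <- s) aw.1 * co i (h aw.2)).
  have -> : \sum_(aw <- s) aw.1 * co i (h aw.2) = co_lin (\sum_(aw <- s) aw.1 *: h aw.2).
    by rewrite linear_sum; apply: eq_bigr => aw _; rewrite linearZ.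
  have [t [tP ->]] := hs; rewrite linear_sum; apply: mpow_sum => aw /tP ja.
  by rewrite linearZ; apply: mpowMr.
pose f (aw : R * M) := (aw.1, aw.2 - (d * co i (h aw.2)) *: aw0.2).
have diff : powM j.+1 (\sum_(aw <- s) aw.1 *: aw.2 - \sum_(aw <- map f s') aw.1 *: aw.2).
  suff -> : \sum_(aw <- s) aw.1 *: aw.2 - \sum_(aw <- map f s') aw.1 *: aw.2
      = (d * \sum_(aw <- s) aw.1 * co i (h aw.2)) *: aw0.2.
    by apply: powM_scale; apply: mpowMl.
  rewrite !sum_s big_map -addrA -sumrB mulrDr scalerDl; congr (_ + _).
    by rewrite mulrCA [d * _]mulrC d1 mulr1.
  rewrite mulr_sumr scaler_suml; apply: eq_bigr => aw _.
  by rewrite /f /= scalerBr subKr scalerA mulrCA.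
have [|||t tP tE] := IHn (map f s').
- by rewrite size_map /s' size_rem // sn.
- by move=> _ /mapP[aw /mem_rem aws ->]; apply: (sj aw).
- have hE (t : seq (R * M)) : \sum_(aw <- t) aw.1 *: h aw.2 = h (\sum_(aw <- t) aw.1 *: aw.2).
    by rewrite linear_sum; apply: eq_bigr => aw _; rewrite linearZ.
  rewrite (hE s) in hs; rewrite (hE (map f s')); have := powMB hs (powM_linear h diff).
  by rewrite -linearB subKr.
exists t => //; have := powMD diff tE.
by rewrite addrA subrK.
Qed.

Variable ev : {linear Mbar -> k^o}.
Variable chi : L -> k.
Hypothesis ev_uu : forall z m, c z = - z -> ev (act Mbar (uu z) m) = ev m.
Hypothesis ev_tt : forall x m, x != 0 -> ev (act Mbar (tt x) m) = chi x * ev m.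
Variable v0 : M.
Hypothesis ev_v0 : ev (phi v0) = 1.
Hypothesis ev_ker : forall m, ev m = 0 -> @uaug _ _ _ c k Mbar setT m.
Variables (x : L) (kb : k).
Hypotheses (x0 : x != 0) (chi_kb : chi x != kb).
(* t(x) acts by kb on H_1(U, Mbar), the colimit under traces of the invariants of
   the elements u(z); q approximates the norm of x. *)
Hypothesis H1_scalar : forall z m, z != 0 -> c z = - z -> act Mbar (uu z) m = m ->
  exists N b, utr (M := Mbar) (p ^ N) (z / p%:R ^+ N) m = b /\ forall N', exists q a,
    [/\ a \in OL, x * c x = q%:R + p%:R ^+ N' * a
      & utr q (z / p%:R ^+ N) (act Mbar (tt x) b) = kb *: b].

Lemma phi_utr q z w : phi (utr q z w) = utr q z (phi w).
Proof. by rewrite linear_sum; apply: eq_bigr => i _; rewrite phiG. Qed.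

Let S0 j : powM j 0. Proof. exact: powM0. Qed.
Let SD j : forall v w, powM j v -> powM j w -> powM j (v + w). Proof. exact: powMD. Qed.
Let SZ j : forall a v, powM j v -> powM j (a *: v). Proof. exact: powMZ. Qed.
Let SG j : forall g v, powM j v -> powM j (act M g v). Proof. by move=> g v; exact: powM_linear. Qed.

Let uD j := uaugD L_quadratic L_unramified c_nontrivial ce e0 smM (@S0 j) (@SD j) (@SG j).
Let usum j := uaug_sum L_quadratic L_unramified c_nontrivial ce e0 smM (@S0 j) (@SD j) (@SG j).
Let uZ j := uaugZ (@SZ j).
Let utt j := uaug_tt L_quadratic c_nontrivial (@SG j).

Lemma uaug_coinv w : exists a, uaugM setT (w - a *: v0).
Proof.
pose uDT := uaugD L_quadratic L_unramified c_nontrivial ce e0 smM (S := setT)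
  I (fun _ _ _ _ => I) (fun _ _ _ => I).
pose uZT := uaugZ (c := c) (M := M) (S := setT) (fun _ _ _ => I).
pose S : set M := [set w | exists a, uaugM setT (w - a *: v0)].
apply: (@nakayama R k aug locR artR aug_surj M S).
- by exists 0; rewrite scale0r subr0; apply: uaug0.
- move=> v w' [a ua] [b ub]; exists (a + b).
  by rewrite scalerDl opprD addrACA; apply: uDT.
- by move=> a v [b ub]; exists (a * b); rewrite -scalerA -scalerBr; apply: uZT.
- move=> v; have [a aE] := aug_surj (ev (phi v)).
  have [|z [m [cz _ mE]]] := ev_ker (m := phi (v - a *: v0)).
    by rewrite linearB linearZ /= aE linearB linearZ /= ev_v0 [_ *: _]mulr1 subrr.
  have [m' m'E] := phi_surj m.
  exists (a *: v0 + (act M (uu z) m' - m')).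
    by exists a; rewrite addrC addKr; exists z, m'.
  apply/powM1E; rewrite opprD addrA linearB /= mE linearB /= phiG m'E subrr //.
Qed.

(** A merely A-linear lift of [ev]. It is equivariant only modulo m, which on m^j M leaves an error
    in m^(j+1). *)
Lemma ex_ev_lift : exists Ef : {linear M -> R^o}, forall v, aug (Ef v) = ev (phi v).
Proof.
have /free_module_basis[B Bb] := freeM.
pose eps (i : M) := projT1 (cid (aug_surj (ev (phi i)))).
have epsE i : aug (eps i) = ev (phi i) by rewrite /eps; case: cid.
have [Ef EfE] := @basis_extend R M R^o M B id eps Bb; exists Ef => v.
have [_ /(_ v)[s [a [sB ->]]]] := Bb; rewrite !linear_sum rmorph_sum.
by apply: eq_big_seq => i /sB Bi; rewrite !linearZ /= rmorphM EfE // epsE.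
Qed.

Variables (kap : R).
Hypothesis aug_kap : aug kap = kb.
Let Th y : M := act M (tt x) y - kap *: y.

Let Th_lin : linear Th.
Proof. by move=> a v w; rewrite /Th linearP /= scalerBr scalerDr !scalerA [kap * a]mulrC opprD addrACA. Qed.
HB.instance Definition _ := GRing.isLinear.Build R M M *:%R Th Th_lin.

Let Th_uaug j y : uaugM (powM j) y -> uaugM (powM j) (Th y).
Proof.
move=> uy; apply: (uD (j := j)); first exact: utt.
by rewrite -scaleNr; apply: uZ.
Qed.

(** Refining z to z1 = z / p^N replaces w by its trace w1. Conjugation by t(x) turns u(z1) - 1 into
    u(n z1) - 1 with n the norm of x, and this factors through u(z1) - 1 by a trace of length q
    close to n. The vector left under u(z1) - 1 reduces to kb b - kb b = 0. *)
Lemma Th_uaug1 z w : c z = - z -> act Mbar (uu z) (phi w) = phi w ->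
  uaugM (powM 1) (Th (act M (uu z) w - w)).
Proof.
move=> cz zw; have [->|z0] := eqVneq z 0.
  by rewrite uu0 act1 subrr linear0; apply: uaug0 (S0 _).
have [N [b [bE bq]]] := H1_scalar z0 cz zw.
pose z1 := z / p%:R ^+ N; have cz1 : c z1 = - z1 by rewrite rmorphM /= c_pXV cz mulNr.
pose w1 := utr (p ^ N) z1 w.
have -> : act M (uu z) w - w = act M (uu z1) w1 - w1.
  by rewrite -utr_telescope // natrX mulrC divfK ?pX_neq0.
have [N1 wN1] := uu_small smM (act M (tt x) w1).
have [m im] := clear_denom z1; rewrite natrX in im.
(* N1 is a level fixing t(x) w1 and m clears the denominator of z1, so replacing the norm by q
   changes nothing. *)
have [q [a [ia nE qE]]] := bq (N1 + m)%N.
pose w2 := utr q z1 (act M (tt x) w1).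
have E : act M (tt x) (act M (uu z1) w1 - w1) = act M (uu z1) w2 - w2.
  rewrite /w2 -utr_telescope // linearB /= -actM tt_uu // actM; congr (_ - _).
  rewrite nE mulrDl.
  have -> : p%:R ^+ (N1 + m) * a * z1 = p%:R ^+ N1 * (a * (p%:R ^+ m * z1)) by rewrite exprD; ring.
  have ca : c (p%:R ^+ N1 * (a * (p%:R ^+ m * z1))) = - (p%:R ^+ N1 * (a * (p%:R ^+ m * z1))).
    have -> : p%:R ^+ N1 * (a * (p%:R ^+ m * z1)) = (x * c x) * z1 - q%:R * z1 by rewrite nE exprD; ring.
    apply: trace0B; first exact: (norm_trace0 L_quadratic c_nontrivial).
    by apply: trace0M; rewrite ?c_nat.
  by rewrite (uuD (trace0M (c_nat c q) cz1) ca) actM wN1 // rpredM.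
exists z1, (w2 - kap *: w1); split=> //.
  apply/powM1E; rewrite linearB linearZ /= aug_kap /w2 phi_utr phiG /w1 phi_utr bE.
  by rewrite -/z1 in qE; rewrite qE subrr.
rewrite /Th E [in RHS]linearB [in RHS]linearZ /= scalerBr !opprB addrACA [RHS]addrACA.
by congr (_ + _); apply: addrC.
Qed.

(** [kernel_devissage] writes w, up to m^(j+1) M, as a combination with coefficients in m^j of
    vectors whose reductions are fixed by u(z); [Th_uaug1] treats each of these. *)
Lemma Th_uaugS j z w : c z = - z -> powM j w -> powM j.+1 (act M (uu z) w - w) ->
  uaugM (powM j.+1) (Th (act M (uu z) w - w)).
Proof.
move=> cz [s [sP wE]].
pose h v := act M (uu z) v - v.
have h_lin : linear h by move=> a v v'; rewrite /h linearP /= scalerBr opprD addrACA.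
pose hl : {linear M -> M} := HB.pack h (GRing.isLinear.Build R M M *:%R h h_lin).
rewrite -[act _ _ _ - _]/(hl w) => hw.
have [|t tP tE] := @kernel_devissage j hl s sP.
  by rewrite wE linear_sum in hw; move: hw; congr powM; apply: eq_bigr => aw _; rewrite linearZ.
rewrite -wE in tE.
have -> : w = \sum_(aw <- t) aw.1 *: aw.2 + (w - \sum_(aw <- t) aw.1 *: aw.2) by rewrite addrC subrK.
have ThD v v' : Th (hl (v + v')) = Th (hl v) + Th (hl v') by rewrite [hl _]linearD; exact: linearD.
rewrite ThD; apply: uD; last first.
  by apply: Th_uaug; exists z, (w - \sum_(aw <- t) aw.1 *: aw.2).
have -> : Th (hl (\sum_(aw <- t) aw.1 *: aw.2)) = \sum_(aw <- t) Th (hl (aw.1 *: aw.2)).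
  by rewrite [hl _]linear_sum; exact: linear_sum.
apply: usum => aw /tP[ja /= h0].
have -> : Th (hl (aw.1 *: aw.2)) = aw.1 *: Th (hl aw.2).
  by rewrite [hl _]linearZ; exact: linearZ.
have [|z' [w' [cz' w'1 ThE]]] := @Th_uaug1 z aw.2 cz.
  by apply/eqP; rewrite -subr_eq0 -phiG -linearB h0.
exists z', (aw.1 *: w'); split=> //; first exact: powM_scaleS.
by rewrite [Th _]ThE linearZ scalerBr.
Qed.

Lemma iter_Th_uaug j y : uaugM setT y -> powM j y -> uaugM (powM j) (iter j Th y).
Proof.
elim: j => [|j IHj] uy jy /=.
  by apply: uaugS uy => v _; rewrite -[v]scale1r; apply: powM_scale.
have ij i : powM j.+1 (iter i Th y).
  by elim: i => //= i; exact: (@powM_linear _ _ _ _ _ Th).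
move: (ij j) => {}ij.
have [z [w [cz jw E]]] := IHj uy (powMSW jy).
by rewrite E in ij *; apply: Th_uaugS.
Qed.

(** Suppose a is in m^j and compute [Ef] of (s - kappa)^j (a v0) twice. The vector lies in m^j D, so
    the value is in m^(j+1); it is also (c1 - kap)^j Ef(v0) a up to m^(j+1), and this coefficient of
    a is a unit. Hence a is in m^(j+1). *)
Lemma uaug_free a : uaugM setT (a *: v0) -> a = 0.
Proof.
move=> ua; have [n nil] := mpow_nilp locR artR aug_surj.
apply: nil; elim: n => // j IHj.
have [Ef EfE] := ex_ev_lift.
have EfZ r v : Ef (r *: v) = r * Ef v by exact: linearZ.
have [c1 c1E] := aug_surj (chi x).
have jy : powM j (a *: v0) by apply: powM_scale.
have [z [w [cz [s [sP wE]] itE]]] := iter_Th_uaug ua jy.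
have it0 : mpow j.+1 (Ef (iter j Th (a *: v0))).
  rewrite itE wE linear_sum -sumrB linear_sum; apply: mpow_sum => aw /sP ja.
  rewrite linearZ -scalerBr EfZ mulrC; apply: mpowS ja.
  by rewrite EfE linearB /= phiG linearB /= ev_uu // subrr.
have Ths y : powM j y -> mpow j.+1 (Ef (Th y) - (c1 - kap) * Ef y).
  move=> [t [tP ->]].
  have -> : Th (\sum_(aw <- t) aw.1 *: aw.2) = \sum_(aw <- t) aw.1 *: Th aw.2.
    by rewrite [LHS]linear_sum; apply: eq_bigr => aw _; exact: linearZ.
  rewrite !linear_sum mulr_sumr -sumrB; apply: mpow_sum => aw /tP ja.
  rewrite !EfZ mulrCA -mulrBr mulrC; apply: mpowS ja.
  rewrite rmorphB rmorphM rmorphB !EfE /Th linearB linearZ /= linearB linearZ /= phiG ev_tt //.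
  by rewrite c1E aug_kap mulrBl subrr.
have iters i : powM j (iter i Th (a *: v0)) /\
    mpow j.+1 (Ef (iter i Th (a *: v0)) - (c1 - kap) ^+ i * Ef (a *: v0)).
  elim: i => [|i [pi IHi]]; first by rewrite expr0 mul1r subrr; split=> //; apply: mpow0.
  split; first exact: (@powM_linear _ _ _ _ _ Th).
  have := mpowD (Ths _ pi) (mpowMl (c1 - kap) IHi).
  by rewrite mulrBr addrA subrK mulrA -exprS.
have [_ itj] := iters j.
have : mpow j.+1 ((c1 - kap) ^+ j * Ef v0 * a).
  have := mpowD it0 (mpowN itj); rewrite opprB addrC subrK EfZ.
  by rewrite mulrCA mulrC.
have [d d1] : exists d, (c1 - kap) ^+ j * Ef v0 * d = 1.
  apply: (aug_unit locR aug_surj); rewrite rmorphM rmorphXn rmorphB c1E aug_kap EfE ev_v0.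
  by rewrite mulr1 expf_neq0 // subr_eq0.
by move=> /(mpowMl d); rewrite mulrA [d * _]mulrC d1 mul1r.
Qed.
End Core.

(** * The residual representation *)

Section Residual.
Variables (p : nat) (p_pr : prime p) (L : fieldExtType (Qp p_pr)).
Hypotheses (L_quadratic : \dim {: L} = 2%N) (L_unramified : unramified L).
Variable c : {lrmorphism L -> L}.
Hypothesis c_nontrivial : exists x : L, c x <> x.
Local Notation OL := (@integral _ _ L).
Local Notation G := (U11 c).
Local Notation T := (torus c).
Local Notation ttT := (ttT L_quadratic c_nontrivial).
Local Notation tt := (@tt _ _ _ c).
Local Notation uu := (@uu _ _ _ c).
Local Notation ww := (@ww _ _ _ c).
Local Notation cellf := (cellf L_quadratic c_nontrivial).
Implicit Types (x y z : L) (g h : G).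
Variables (e : L).
Hypotheses (ce : c e = - e) (e0 : e != 0) (ie : e \in OL) (ieV : e^-1 \in OL).

Lemma fixator_open (R : comNzRingType) (M : rep R G) (v : M) N :
  (forall g, cong N g -> act M g v = v) -> open [set h | act M h v = v].
Proof.
move=> Nv.
have -> : [set h | act M h v = v] =
    \bigcup_(h in [set h | act M h v = v]) [set g : G | cong N (h^-1 * g * 1)%g].
  apply/seteqP; split=> [h /= hv|g [h /= hv]]; first by exists h => //=; rewrite mulVg mulg1; apply: cong1.
  by rewrite mulg1 => /Nv; rewrite actM => E; rewrite -[g](mulVKg h) actM actM E.
apply: bigcup_open => h _; exact: (u11_open_translate _ _ (cong_open c N)).
Qed.

Lemma ind_smooth (R : comNzRingType) (sigma : rep R T) : smooth (Ind sigma).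
Proof.
move=> f; have [N fN] := ind_small f; apply: (@fixator_open _ _ _ N) => g gN.
by apply/val_inj/funext => h; apply: fN.
Qed.

Variables (k : fieldType) (chi : mchar L k).
Hypothesis p0 : (p%:R : k) = 0.
Hypothesis chi1p : forall a, a \in OL -> chi (1 + p%:R * a) = 1.
Local Notation chibar := (char_rep c chi).
Implicit Types f : Ind chibar.

Lemma char_ttE x (v : chibar) : x != 0 -> act chibar (ttT x) v = chi x *: v.
Proof.
by move=> x0; rewrite /= /char_act /torus_coord /= (ttE L_quadratic c_nontrivial) // mxE.
Qed.

Lemma chi_small (v : chibar) : small_vec L_quadratic c_nontrivial v.
Proof.
exists 0%N => a ia; rewrite char_ttE; last exact: (one_plus_pX_neq0 L_unramified).
by rewrite expr1 chi1p // scale1r.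
Qed.

Let ev_fun f : k^o := f 1%g.
Let ev_lin : linear ev_fun. Proof. by []. Qed.
Definition ev1 : {linear Ind chibar -> k^o} :=
  HB.pack ev_fun (GRing.isLinear.Build k (Ind chibar) k^o *:%R ev_fun ev_lin).

Lemma ev1E f : ev1 f = f 1%g. Proof. by []. Qed.

Lemma ev1_uu z f : c z = - z -> ev1 (act (Ind chibar) (uu z) f) = ev1 f.
Proof. by move=> cz; rewrite !ev1E ind_actE mul1g ind_uu1. Qed.

Lemma ev1_tt x f : x != 0 -> ev1 (act (Ind chibar) (tt x) f) = chi x * ev1 f.
Proof.
move=> x0; rewrite !ev1E ind_actE mul1g -[tt x]mulg1 (ind_tt L_quadratic c_nontrivial) //.
by rewrite char_ttE.
Qed.

Lemma pX_k N : (0 < N)%N -> ((p ^ N)%:R : k) = 0.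
Proof. by case: N => // N _; rewrite expnS natrM p0 mul0r. Qed.

Lemma ev1_ker f : ev1 f = 0 -> @uaug _ _ _ c k (Ind chibar) setT f.
Proof.
have sm := @ind_smooth k chibar.
pose uD := uaugD L_quadratic L_unramified c_nontrivial ce e0 sm (S := setT)
  I (fun _ _ _ _ => I) (fun _ _ _ => I).
pose usum := uaug_sum L_quadratic L_unramified c_nontrivial ce e0 sm (S := setT)
  I (fun _ _ _ _ => I) (fun _ _ _ => I).
have b0 z v : z != 0 -> c z = - z -> @uaug _ _ _ c k (Ind chibar) setT (cellf z v).
  move=> z0 cz; rewrite (cellf_split L_unramified chi_small 1 v z0 cz).
  have pz0 : p%:R ^+ 1 * z != 0 by rewrite mulf_neq0 ?pX_neq0.
  (* A ball is a union of p translates of a smaller one; subtracting p = 0 copies of the latter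
     turns the sum into a sum of vectors u w - w. *)
  have E : \sum_(i < p ^ 1) cellf (p%:R ^+ 1 * z) v = 0 :> Ind chibar.
    by rewrite sumr_const card_ord -scaler_nat pX_k // scale0r.
  rewrite -[\sum_(i < _) _]subr0 -[X in _ - X]E -sumrB; apply: usum => i _.
  by exists (i%:R * z), (cellf (p%:R ^+ 1 * z) v); split=> //; apply: trace0M; rewrite ?c_nat.
rewrite ev1E => f1; have [N E] := ind_decomp L_unramified chi_small ce e0 ie ieV f1.
rewrite {}E; apply: usum => i _.
set v := (X in cellf _ X); set z := p%:R ^+ N * e; set a := - (_ * _).
have ca : c a = - a.
  by rewrite rmorphN /= trace0M ?c_nat // rmorphM /= c_pXV ce mulNr.
rewrite -[act _ _ _](subrK (cellf z v : Ind chibar)); apply: uD.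
  by exists a, (cellf z v).
apply: b0; first by rewrite mulf_neq0 ?pX_neq0.
by apply: trace0M; rewrite ?c_pX.
Qed.

Lemma sum_shift (V : zmodType) n j (F : nat -> V) : (forall i, F (i + n)%N = F i) ->
  \sum_(i < n) F (i + j)%N = \sum_(i < n) F i.
Proof.
move=> Fn; elim: j => [|j <-]; first by apply: eq_bigr => i _; rewrite addn0.
case: n Fn => [|n] Fn; first by rewrite !big_ord0.
rewrite big_ord_recr [RHS]big_ord_recl /= add0n addrC; congr (_ + _).
  by rewrite -[in RHS]Fn !addnS addnC.
by apply: eq_bigr => i _; rewrite /= /fintype.bump /= add1n addSn addnS.
Qed.

(** After a fine enough trace an invariant function becomes a multiple of the indicator of one ball,
    so these indicators generate H_1. *)
Lemma trace_cellf z f : z != 0 -> c z = - z -> act (Ind chibar) (uu z) f = f ->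
  exists N v, utr (M := Ind chibar) (p ^ N) (z / p%:R ^+ N) f = cellf (z / p%:R ^+ N) v.
Proof.
move=> z0 cz fz; have [N1 fN1] := ind_infinity L_quadratic c_nontrivial f.
have [N2 fN2] := ind_periodic f.
have [m im] := clear_denom z; have [m' im'] := clear_denom z^-1.
rewrite natrX in im; rewrite natrX in im'.
pose F y := f (ww * uu y)%g.
have Fz (i : nat) y : c y = - y -> F (y + i%:R * z) = F y.
  move=> cy; elim: i => [|i IHi]; first by rewrite mul0r addr0.
  have cyi : c (y + i%:R * z) = - (y + i%:R * z).
    by apply: trace0D => //; apply: trace0M; rewrite ?c_nat.
  by rewrite -IHi mulrSr mulrDl mul1r addrA /F (uuD cyi cz) mulgA -(ind_actE (uu z)) fz.
(* Invariance under the integer multiples of z extends to their p-adic closure because F is locally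
   constant. *)
have FzO b y : c y = - y -> c b = b -> b \in OL -> F (y + b * z) = F y.
  move=> cy cb ib.
  have [i [b' [_ cb' ib' ->]]] := fixed_approx L_quadratic L_unramified c_nontrivial (N2 + m) cb ib.
  have -> : y + (i%:R + p%:R ^+ (N2 + m) * b') * z = y + i%:R * z + p%:R ^+ N2 * (p%:R ^+ m * z * b').
    by rewrite exprD; ring.
  have cyi : c (y + i%:R * z) = - (y + i%:R * z).
    by apply: trace0D => //; apply: trace0M; rewrite ?c_nat.
  have ipz : p%:R ^+ m * z * b' \in OL by rewrite rpredM.
  have cpz : c (p%:R ^+ N2 * (p%:R ^+ m * z * b')) = - (p%:R ^+ N2 * (p%:R ^+ m * z * b')).
    have -> : p%:R ^+ N2 * (p%:R ^+ m * z * b') = p%:R ^+ N2 * p%:R ^+ m * b' * z by ring.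
    by apply: trace0M => //; rewrite !rmorphM /= !c_pX cb'.
  by rewrite [LHS](fN2 _ _ ipz cyi cpz); apply: Fz.
(* N1 + m' puts the complement of the ball of z / p^N in the range of [ind_infinity]; the extra 1
   makes p^N vanish in k. *)
pose N := (N1 + m').+1; exists N, (\sum_(i < p ^ N) F (i%:R * (z / p%:R ^+ N))).
set z1 := z / p%:R ^+ N; have cz1 : c z1 = - z1 by rewrite rmorphM /= c_pXV cz mulNr.
have z10 : z1 != 0 by rewrite mulf_neq0 ?invr_neq0 ?pX_neq0.
have ciz (i : nat) : c (i%:R * z1) = - (i%:R * z1) by apply: trace0M; rewrite ?c_nat.
apply: (ind_ext L_quadratic c_nontrivial) => [|y cy].
  rewrite ind_sumE (cellf_1 L_unramified) //; last exact: chi_small.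
  rewrite (eq_bigr (fun=> f 1%g)); last by move=> i _; rewrite ind_actE mul1g ind_uu1.
  by rewrite sumr_const card_ord -mulr_natl pX_k // mul0r.
rewrite ind_sumE (cellf_cell L_unramified) //; last exact: chi_small.
rewrite (eq_bigr (fun i : 'I_(p ^ N) => F (y + i%:R * z1))); last first.
  by move=> i _; rewrite ind_actE -mulgA -uuD.
pose r := y / z1; have cr : c r = r by rewrite trace0_ratio.
have yE : y = r * z1 by rewrite divfK.
rewrite -/r; case: ifP => [ir|/negbT nr].
  have [j [b [ltj cb ib rE]]] := fixed_approx L_quadratic L_unramified c_nontrivial N cr ir.
  (* Inside the ball, y only shifts the summation index by j, modulo p^N; the trace is constant
     there. *)
  rewrite -(@sum_shift _ _ j (fun i => F (i%:R * z1))).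
    apply: eq_bigr => i _.
    have -> : y + i%:R * z1 = (i + j)%:R * z1 + b * z.
      by rewrite yE rE natrD /z1; field; rewrite pX_neq0.
    exact: FzO.
  move=> i; have -> : (i + p ^ N)%:R * z1 = i%:R * z1 + 1%:R * z.
    by rewrite natrD natrX /z1; field; rewrite pX_neq0.
  exact: Fz.
have [ir|[b ib rb]] := fixed_dichotomy L_quadratic c_nontrivial cr; first by rewrite ir in nr.
have y0 : y != 0.
  rewrite yE mulf_neq0 //; apply: contra_eq_neq rb => ->; rewrite mul0r eq_sym oner_neq0 //.
(* Outside the ball y + i z1 = y u with u in 1 + p O_L, where chi is 1; so the p^N terms of the
   trace are equal and add up to 0 in k. *)
have Fy (i : nat) : chi (- y) *: F (y + i%:R * z1) = f 1%g.
  pose u := 1 + p%:R * (i%:R * b).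
  have iib : i%:R * b \in OL by rewrite rpredM ?rpred_nat.
  have u0 : u != 0 by apply: (one_plus_p_neq0 L_unramified).
  have iu : u^-1 \in OL by apply: (one_plus_p_inv L_quadratic L_unramified c_nontrivial).
  have yiE : y + i%:R * z1 = y * u.
    have z1E : z1 = y * (p%:R * b) by rewrite yE -mulrA mulrCA rb mulr1.
    by rewrite {1}z1E /u; ring.
  have cyi : c (y + i%:R * z1) = - (y + i%:R * z1) by apply: trace0D.
  have := fN1 (y + i%:R * z1) (p%:R ^+ m' * z^-1 * (p%:R * p%:R) * b * u^-1) _ cyi _.
  rewrite -/(F _) => <-.
  - rewrite char_ttE; last by rewrite oppr_eq0 yiE mulf_neq0.
    by rewrite yiE -mulNr mcharM ?oppr_eq0 // chi1p // mulr1.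
  - by do 3! apply: rpredM => //; rewrite rpredM ?rpred_nat.
  - rewrite yiE; transitivity (r * (p%:R * b)); last exact: rb.
    by rewrite yE /z1 /N exprS exprD; field; rewrite z0 u0 !pX_neq0 p_neq0.
rewrite (eq_bigr (fun=> (chi (- y))^-1 * f 1%g)); last first.
  by move=> i _; rewrite -(Fy i) mulKf // mchar_neq0 // oppr_eq0.
by rewrite sumr_const card_ord -mulr_natl pX_k // mul0r.
Qed.

(** t(x) scales U by the norm of x and becomes t(c(x)^-1) when moved to the left of w, which gives
    the new radius and the scalar. *)
Lemma cellf_tt x z v : x != 0 -> z != 0 ->
  act (Ind chibar) (tt x) (cellf z v) = chi (c x)^-1 *: cellf (x * c x * z) v :> Ind chibar.
Proof.
move=> x0 z0; have cx0 : c x != 0 by rewrite fmorph_eq0.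
have nz0 : x * c x * z != 0 by do 2! apply: mulf_neq0 => //.
have cxV0 : (c x)^-1 != 0 by rewrite invr_neq0.
apply: (ind_ext L_quadratic c_nontrivial) => [|y cy].
  rewrite ind_scaleE (cellf_1 L_unramified) //; last exact: chi_small.
  rewrite ind_actE mul1g -[tt x]mulg1 (ind_tt L_quadratic c_nontrivial) //.
  rewrite (cellf_1 L_unramified) //; last exact: chi_small.
  by rewrite linear0 scaler0.
rewrite ind_scaleE (cellf_cell L_unramified) //; last exact: chi_small.
pose y' := y / (x * c x).
have cn : c (x * c x)^-1 = (x * c x)^-1.
  by rewrite fmorphV rmorphM /= (cK L_quadratic c_nontrivial) mulrC.
have cy' : c y' = - y' by rewrite /y' mulrC trace0M.
have yE : y = x * c x * y' by rewrite /y' mulrC divfK // mulf_neq0.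
rewrite ind_actE -mulgA {1}yE -(tt_uu L_quadratic c_nontrivial) // mulgA.
rewrite (ww_tt L_quadratic c_nontrivial) // -mulgA (ind_tt L_quadratic c_nontrivial) //.
rewrite (cellf_cell L_unramified) //; last exact: chi_small.
by rewrite char_ttE // /y' [(x * c x * z)^-1]invfM [in RHS]mulrA.
Qed.

(** The hypothesis [H1_scalar] for Ind chibar, stated on representatives so that the colimit
    defining H_1 is not formed. *)
Definition acts_on_H1 x (kb : k) : Prop := forall z f, z != 0 -> c z = - z ->
  act (Ind chibar) (uu z) f = f ->
  exists N b, utr (M := Ind chibar) (p ^ N) (z / p%:R ^+ N) f = b /\ forall N', exists q a,
    [/\ a \in OL, x * c x = q%:R + p%:R ^+ N' * a
      & utr (M := Ind chibar) q (z / p%:R ^+ N) (act (Ind chibar) (tt x) b) = kb *: b].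

(** The norm of p is exactly p^2, so q = p^2 and a = 0. The trace over p^2 translates reassembles
    the ball that t(p) has shrunk, and only the scalar chi(p)^-1 remains. *)
Lemma acts_on_H1_p : acts_on_H1 p%:R (chi p%:R)^-1.
Proof.
move=> z f z0 cz fz; have [N [v E]] := trace_cellf z0 cz fz.
exists N, (cellf (z / p%:R ^+ N) v); split=> // N'; exists (p ^ 2)%N, 0.
have z10 : z / p%:R ^+ N != 0 by rewrite mulf_neq0 ?invr_neq0 ?pX_neq0.
have cz1 : c (z / p%:R ^+ N) = - (z / p%:R ^+ N) by rewrite rmorphM /= c_pXV cz mulNr.
rewrite rpred0; split=> //; first by rewrite c_nat mulr0 addr0 natrX expr2.
rewrite cellf_tt ?p_neq0 // c_nat -expr2 (cellf_split L_unramified chi_small 2 v z10 cz1).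
have -> : chi p%:R^-1 = (chi p%:R)^-1.
  have pn := p_neq0 L; apply: (mulfI (mchar_neq0 chi pn)).
  by rewrite -mcharM ?invr_eq0 // !mulfV ?mchar1 // mchar_neq0.
by rewrite /utr scaler_sumr; apply: eq_bigr => i _; rewrite linearZ.
Qed.

(** The norm of x is a unit, so t(x) preserves the ball, whose indicator is fixed by the
    translations of the trace: q equal terms give the factor q = nb. *)
Lemma acts_on_H1_unit x (nb : k) : x \in OL -> x != 0 -> x^-1 \in OL ->
  (forall (q : nat) a, a \in OL -> x * c x = q%:R + p%:R * a -> q%:R = nb) ->
  acts_on_H1 x (nb * chi (c x)^-1).
Proof.
move=> ix x0 ixV nbP z f z0 cz fz; have [N [v E]] := trace_cellf z0 cz fz.
set z1 := z / p%:R ^+ N in E *.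
exists N, (cellf z1 v); split=> // N'.
have z10 : z1 != 0 by rewrite mulf_neq0 ?invr_neq0 ?pX_neq0.
have cz1 : c z1 = - z1 by rewrite rmorphM /= c_pXV cz mulNr.
have cn : c (x * c x) = x * c x by rewrite rmorphM /= (cK L_quadratic c_nontrivial) mulrC.
have icx := c_integral c ix; have icxV := c_integral c ixV.
have icn : x * c x \in OL by rewrite rpredM.
(* Precision N' + 1 rather than N', so that q is the norm modulo p even for N' = 0. *)
have [q [a [_ ca ia nE]]] := fixed_approx L_quadratic L_unramified c_nontrivial N'.+1 cn icn.
exists q, (p%:R * a); split; first by rewrite rpredM ?rpred_nat.
  by rewrite nE exprSr mulrA.
have qE : q%:R = nb.
  by apply: (nbP q (p%:R ^+ N' * a)); rewrite ?rpredM ?p_integral // nE exprS mulrA.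
have cx0 : c x != 0 by rewrite fmorph_eq0.
have nz0 : x * c x * z1 != 0 by do 2! apply: mulf_neq0 => //.
have bE : cellf (x * c x * z1) v = cellf z1 v :> Ind chibar.
  apply: (ind_ext L_quadratic c_nontrivial) => [|y cy].
    by rewrite !(cellf_1 L_unramified) //; exact: chi_small.
  rewrite !(cellf_cell L_unramified) //; try exact: chi_small.
  suff -> : (y / (x * c x * z1) \in OL) = (y / z1 \in OL) by [].
  apply/idP/idP => iy.
    have -> : y / z1 = y / (x * c x * z1) * (x * c x) by field; rewrite ?z10 ?x0 ?cx0.
    by rewrite rpredM.
  have -> : y / (x * c x * z1) = y / z1 * (x^-1 * c x^-1) by rewrite fmorphV /=; field; rewrite ?z10 ?x0 ?cx0.
  by rewrite rpredM // rpredM.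
have inv i : act (Ind chibar) (uu (i%:R * z1)) (cellf z1 v) = cellf z1 v :> Ind chibar.
  have ci : c (i%:R * z1) = - (i%:R * z1) by apply: trace0M; rewrite ?c_nat.
  apply: (ind_ext L_quadratic c_nontrivial) => [|y cy].
    by rewrite ind_actE mul1g ind_uu1.
  rewrite (cellf_act_uu L_unramified chi_small) // (cellf_cell L_unramified) //; last exact: chi_small.
  suff -> : ((y + i%:R * z1) / z1 \in OL) = (y / z1 \in OL) by [].
  by rewrite mulrDl mulfK // rpredDr // rpred_nat.
rewrite cellf_tt // bE /utr (eq_bigr (fun=> chi (c x)^-1 *: (cellf z1 v : Ind chibar))); last first.
  by move=> i _; rewrite linearZ /= inv.
by rewrite sumr_const card_ord -scaler_nat qE scalerA.
Qed.
End Residual.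

(** * Lifts of the induced representation *)

Section Lifts.
Variables (p : nat) (p_pr : prime p) (L : fieldExtType (Qp p_pr)).
Hypotheses (L_quadratic : \dim {: L} = 2%N) (L_unramified : unramified L).
Variable c : {lrmorphism L -> L}.
Hypothesis c_nontrivial : exists x : L, c x <> x.
Local Notation OL := (@integral _ _ L).
Local Notation G := (U11 c).
Local Notation T := (torus c).
Local Notation ttT := (ttT L_quadratic c_nontrivial).
Local Notation tt := (@tt _ _ _ c).
Local Notation uu := (@uu _ _ _ c).
Local Notation ww := (@ww _ _ _ c).
Local Notation cellf := (cellf L_quadratic c_nontrivial).
Implicit Types (x y z : L) (g h : G).
Variables (e : L).
Hypotheses (ce : c e = - e) (e0 : e != 0) (ie : e \in OL) (ieV : e^-1 \in OL).

Variables (O : comNzRingType) (k : fieldType) (red : {rmorphism O -> k}).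
Hypothesis red_surj : forall y : k, exists x : O, red x = y.
Variable chi : mchar L k.
Hypothesis p0 : (p%:R : k) = 0.
Hypothesis chi1p : forall a, a \in OL -> chi (1 + p%:R * a) = 1.
Local Notation chibar := (char_rep c chi).
Local Notation chi_small := (chi_small L_quadratic L_unramified c_nontrivial chi1p).

Lemma art_aug_surj (A : art red) (y : k) : exists a : A, aug A a = y.
Proof. by have [x <-] := red_surj y; exists x%:A; rewrite aug_red. Qed.

Section OneLift.
Variable (A : art red).
Local Notation powM := (@powM A k (aug A)).
Variable V : prelift chibar A.
Hypothesis liftV : is_lift V.

Lemma lift_small (v : V) : small_vec L_quadratic c_nontrivial v.
Proof.
have [smV _ _ _] := liftV.
by apply: (torus_small L_quadratic L_unramified c_nontrivial (smV v)); apply: act1.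
Qed.

Lemma char_lift_gen (v1 : V) : lift_map V v1 = 1 ->
  (forall v, exists a, v = a *: v1) /\ (forall a, a *: v1 = 0 -> a = 0).
Proof.
move=> v1E; have [_ fV _ bcV] := liftV; split.
  pose S : set V := [set v | exists a, v = a *: v1].
  change (forall v, S v); apply: (nakayama (art_local A) (@art_artinian _ _ _ A) (art_aug_surj A)).
  - by exists 0; rewrite scale0r.
  - by move=> v w [a ->] [b ->]; exists (a + b); rewrite scalerDl.
  - by move=> a v [b ->]; exists (a * b); rewrite scalerA.
  - move=> v; have [a aE] := art_aug_surj A (lift_map V v).
    exists (a *: v1); first by exists a.
    apply: (ker_powM1 fV bcV); rewrite linearB linearZ /= v1E aE.
    by rewrite [_ *: _]mulr1 subrr.
move=> a av; have [co [colin _ coP]] := lift_coord fV bcV.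
have [i ni] : exists i, aug A (co i v1) != 0.
  apply: contrapT => /forallNP ni; have /eqP := oner_neq0 k; apply.
  by rewrite -v1E; apply/coP => i; apply/eqP; apply: contraT => /ni.
have [d d1] := aug_unit (art_local A) (art_aug_surj A) ni.
have co0 : co i 0 = 0 by have := colin i (-1) 0 0; rewrite scaler0 addr0 mulN1r addNr.
have : a * co i v1 = 0.
  by have := colin i a v1 0; rewrite addr0 av co0 addr0.
by move=> E; rewrite -[a]mulr1 -d1 mulrA E mul0r.
Qed.

Lemma ex_lift_one : exists v1 : V, lift_map V v1 = 1.
Proof. by have [_ _ surj _] := liftV; apply: (surj 1). Qed.

Lemma ind_comp_cellf z v : z != 0 -> ind_comp (cellf z v : Ind V) = cellf z (lift_map V v).
Proof.
move=> z0; apply: (ind_ext L_quadratic c_nontrivial) => [|y cy] /=.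
  rewrite !(cellf_1 L_unramified) ?linear0 //; [exact: chi_small|exact: lift_small].
rewrite !(cellf_cell L_unramified) //; [|exact: chi_small|exact: lift_small].
by case: ifP => _; rewrite ?linear0.
Qed.

Lemma ind_comp_surj (f : Ind chibar) : exists F : Ind V, ind_comp F = f.
Proof.
have [_ _ surj _] := liftV.
pose P : set (Ind chibar) := [set f | exists F : Ind V, ind_comp F = f].
apply: (ind_gen L_unramified chi_small ce e0 ie ieV (W := setT) (P := P)) => //.
- by exists 0; rewrite linear0.
- by move=> _ _ [F <-] [F' <-]; exists (F + F'); rewrite linearD.
- by move=> g _ [F <-]; exists (act (Ind V) g F); rewrite ind_compE.
- by move=> z v z0 _; have [v' <-] := surj v; exists (cellf z v'); apply: ind_comp_cellf.
Qed.

(** Each value lies in m V, but membership in m Ind V asks for a finite expression; [ind_gen]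
    reduces to cell functions, where the scalar comes out by [cellfZ]. *)
Lemma ind_comp_ker (f : Ind V) : ind_comp f = 0 -> powM 1 f.
Proof.
move=> f0; have [v1 v1E] := ex_lift_one; have [gen _] := char_lift_gen v1E.
apply: (ind_gen L_unramified lift_small ce e0 ie ieV (W := [set v | lift_map V v = 0])).
- exact: linear0.
- by move=> v w /= v0 w0; rewrite linearB v0 w0 subrr.
- by move=> t v /= v0; rewrite lift_mapE v0 linear0.
- exact: powM0.
- exact: powMD.
- by move=> g f'; exact: powM_linear.
- move=> z v z0 /=; have [a ->] := gen v; rewrite linearZ /= v1E [_ *: _]mulr1 => a0.
  by rewrite (cellfZ L_unramified lift_small) //; apply: powM_scale; apply/mpow1E.
- by move=> g /=; have := congr1 (fun f' : Ind chibar => f' g) f0.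
Qed.

(** Independence is [indep_lift] for the evaluations at the points of G, read as scalars through the
    generator v1 of V. *)
Lemma ind_lift_basis (B : set (Ind chibar)) (s : Ind chibar -> Ind V) :
  basis_fam (I := Ind chibar) B id -> (forall f, ind_comp (s f) = f) -> basis_fam B s.
Proof.
move=> [ind sp] sK; have [v1 v1E] := ex_lift_one; have [gen free] := char_lift_gen v1E.
pose xi v := projT1 (cid (gen v)).
have xiE v : v = xi v *: v1 by rewrite /xi; case: cid.
have xi_lin a v w : xi (a *: v + w) = a * xi v + xi w.
  apply/eqP; rewrite -subr_eq0; apply/eqP/free.
  by rewrite scalerBl scalerDl -scalerA -!xiE subrr.
have xi_aug v : aug A (xi v) = lift_map V v.
  by rewrite [in RHS](xiE v) linearZ /= v1E [RHS]mulr1.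
split; last first.
  apply: (span_lift (art_local A) (@art_artinian _ _ _ A) (art_aug_surj A) ind_comp_ker _ sp).
  by move=> f _; apply: sK.
apply: (indep_lift (art_local A) (art_aug_surj A) (phi := @ind_comp _ _ _ _ _ _ _ _ _ V)
  (la := fun g (f : Ind V) => xi (f g)) _ _ _ ind).
- by move=> g a f f'; apply: xi_lin.
- move=> f nf; apply: contrapT => no; apply: nf; apply/val_inj/funext => g /=.
  rewrite -xi_aug; apply: contrapT => /eqP ng; apply: no; by exists g.
- by move=> f _; apply: sK.
Qed.

Lemma ind_lift_is_lift : is_lift (Ind_lift V).
Proof.
have [B Bb] := @ex_basis k (Ind chibar).
pose s f := projT1 (cid (ind_comp_surj f)).
have sK f : ind_comp (s f) = f by rewrite /s; case: cid.
have Bs := ind_lift_basis Bb sK.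
split; [exact: ind_smooth| |exact: ind_comp_surj|].
  by apply: (basis_fam_free _ Bs); apply: can_inj sK.
apply: (base_change_of_basis (B := B) (e := s)); first by case: Bs.
suff -> : (fun i => ind_comp (s i)) = id by [].
by apply/funext => f; apply: sK.
Qed.
End OneLift.

Section MapInd.
Variables (R S : comNzRingType) (sigma : rep R T) (tau : rep S T) (j : sigma -> tau).
Hypothesis jT : forall t v, j (act sigma t v) = act tau t (j v).

Lemma map_indP (f : Ind sigma) : (fun g : G => j (f g)) \in @in_ind _ _ _ c S tau.
Proof.
have /asboolP[fB [K oK fK]] := indP f; apply/asboolP; split.
  by move=> b h t bB btU; rewrite (fB _ _ _ bB btU) jT.
by exists K => // g x Kx; rewrite fK.
Qed.
Definition map_ind (f : Ind sigma) : Ind tau := MkInd (map_indP f).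
End MapInd.

Lemma ind_lift_iso_of_map (A : art red) (M : prelift (Ind chibar) A) (V : prelift chibar A)
    (h : {linear M -> Ind V}) : is_lift M -> is_lift V ->
  (forall g v, h (act M g v) = act (Ind V) g (h v)) ->
  (forall v, ind_comp (h v) = lift_map M v) -> lift_iso M (Ind_lift V).
Proof.
move=> [_ fM surjM bcM] liftV hG hphi; exists h; split=> //.
have [B Bb] := @ex_basis k (Ind chibar).
apply: (lift_bij (art_local A) (@art_artinian _ _ _ A) (art_aug_surj A)
  (phiM := lift_map M) (phiN := @ind_comp _ _ _ _ _ _ _ _ _ V) _ surjM Bb _ hphi).
  exact: ker_powM1.
by move=> s sK; apply: ind_lift_basis.
Qed.

Lemma ind_lift_iso (A : art red) (V W : prelift chibar A) : is_lift V -> is_lift W ->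
  lift_iso V W -> lift_iso (Ind_lift V) (Ind_lift W).
Proof.
move=> liftV liftW [h [_ hT hphi]].
pose H := map_ind hT.
have H_lin : linear H by move=> a f f'; apply/val_inj/funext => g /=; rewrite linearP.
pose Hl : {linear Ind V -> Ind W} := HB.pack H (GRing.isLinear.Build A (Ind V) (Ind W) *:%R H H_lin).
apply: (@ind_lift_iso_of_map A (Ind_lift V) W Hl) => //.
- exact: ind_lift_is_lift.
- by move=> g v; apply: val_inj.
- by move=> f; apply/val_inj/funext => g /=; apply: hphi.
Qed.

(** Lifts to Ind V of a k-basis of Ind chibar span, and their images in Ind W lift the same k-basis,
    hence form a basis. *)
Lemma ind_base_change (A A' : art red) (f : {lrmorphism A -> A'})
    (V : prelift chibar A) (W : prelift chibar A') (j : {linear V -> W | f \; *:%R}) :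
  is_lift V -> is_lift W -> (forall t v, j (act V t v) = act W t (j v)) ->
  (forall v, lift_map W (j v) = lift_map V v) ->
  exists j' : {linear Ind_lift V -> Ind_lift W | f \; *:%R}, [/\
      forall h v, j' (act (Ind_lift V) h v) = act (Ind_lift W) h (j' v),
      forall v, lift_map (Ind_lift W) (j' v) = lift_map (Ind_lift V) v & is_base_change j'].
Proof.
move=> liftV liftW jT jphi; pose H := map_ind jT.
have H_lin : linear_for (f \; *:%R) H.
  by move=> a F F'; apply/val_inj/funext => g /=; rewrite linearP.
pose Hl : {linear Ind_lift V -> Ind_lift W | f \; *:%R} :=
  HB.pack H (GRing.isLinear.Build A (Ind V) (Ind W) (f \; *:%R) H H_lin).
have Hphi (F : Ind V) : ind_comp (Hl F) = ind_comp F.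
  by apply/val_inj/funext => g /=; apply: jphi.
exists Hl; split=> [g v|v|]; [exact: val_inj|exact: Hphi|].
have [B Bb] := @ex_basis k (Ind chibar).
pose s F := projT1 (cid (ind_comp_surj liftV F)).
have sK F : ind_comp (s F) = F by rewrite /s; case: cid.
apply: (base_change_of_basis (B := B) (e := s)); first by case: (ind_lift_basis liftV Bb sK).
by apply: (ind_lift_basis liftW Bb) => F; rewrite Hphi.
Qed.
End Lifts.

(** * Isomorphism classes of lifts *)

Section LiftIso.
Variables (O : comNzRingType) (k : fieldType) (red : {rmorphism O -> k}).
Variables (H : groupTopType) (pibar : rep k H) (A : art red).
Implicit Types V W X : prelift pibar A.

Lemma lift_iso_sym V W : lift_iso V W -> lift_iso W V.
Proof.
move=> [h [[h' hK h'K] hG hphi]].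
have h'_lin : linear h'.
  by move=> a v w; apply: (can_inj hK); rewrite linearP !h'K.
pose hl : {linear W -> V} := HB.pack h' (GRing.isLinear.Build A W V *:%R h' h'_lin).
exists hl; split; first by exists h.
  by move=> g v; apply: (can_inj hK); rewrite hG !h'K.
by move=> v; rewrite -hphi h'K.
Qed.

Lemma lift_iso_trans V W X : lift_iso V W -> lift_iso W X -> lift_iso V X.
Proof.
move=> [h [bh hG hphi]] [h' [bh' h'G h'phi]].
have lin : linear (h' \o h) by move=> a v w /=; rewrite !linearP.
pose hl : {linear V -> X} := HB.pack (h' \o h) (GRing.isLinear.Build A V X *:%R (h' \o h) lin).
exists hl; split; first exact: bij_comp.
  by move=> g v /=; rewrite hG h'G.
by move=> v /=; rewrite h'phi hphi.
Qed.

Lemma lift_iso_refl V : lift_iso V V.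
Proof.
have lin : linear (id : V -> V) by [].
pose hl : {linear V -> V} := HB.pack (id : V -> V) (GRing.isLinear.Build A V V *:%R id lin).
by exists hl; split=> //; exists id.
Qed.

Lemma Def_class (X : Def pibar A) V : sval X V ->
  is_lift V /\ forall W, sval X W <-> is_lift W /\ lift_iso V W.
Proof.
case: X => X /= [V0 lV0 ->] [lV iso0]; split=> // W; split=> -[lW iso]; split=> //.
  exact: lift_iso_trans (lift_iso_sym iso0) iso.
exact: lift_iso_trans iso0 iso.
Qed.

Lemma Def_inhabited (X : Def pibar A) : exists V, sval X V.
Proof. by case: X => X /= [V lV ->]; exists V; split=> //; apply: lift_iso_refl. Qed.

Lemma Def_eq (X Y : Def pibar A) V W : sval X V -> sval Y W -> lift_iso V W -> X = Y.
Proof.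
move=> XV YW iso; have [lV XE] := Def_class XV; have [lW YE] := Def_class YW.
suff : sval X = sval Y.
  by case: X Y {XV YW XE YE} => [X PX] [Y PY] /= E; subst Y; congr exist; apply: Prop_irrelevance.
apply/funext => Z; apply/propext; split.
  move=> /XE[lZ isoZ]; apply/YE; split=> //.
  exact: lift_iso_trans (lift_iso_sym iso) isoZ.
by move=> /YE[lZ isoZ]; apply/XE; split=> //; apply: lift_iso_trans iso isoZ.
Qed.

Definition Def_of V (lV : is_lift V) : Def pibar A :=
  exist _ (fun W => is_lift W /\ lift_iso V W) (ex_intro2 _ _ V lV erefl).

Lemma Def_of_self V (lV : is_lift V) : sval (Def_of lV) V.
Proof. by split=> //; apply: lift_iso_refl. Qed.
End LiftIso.

(** * Injectivity and surjectivity of induction on isomorphism classes *)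

Section Equivalence.
Variables (p : nat) (p_pr : prime p) (L : fieldExtType (Qp p_pr)).
Hypotheses (L_quadratic : \dim {: L} = 2%N) (L_unramified : unramified L).
Variable c : {lrmorphism L -> L}.
Hypothesis c_nontrivial : exists x : L, c x <> x.
Local Notation OL := (@integral _ _ L).
Local Notation G := (U11 c).
Local Notation T := (torus c).
Local Notation ttT := (ttT L_quadratic c_nontrivial).
Local Notation tt := (@tt _ _ _ c).
Local Notation uu := (@uu _ _ _ c).
Implicit Types (x y z : L) (g h : G).
Variables (e : L).
Hypotheses (ce : c e = - e) (e0 : e != 0) (ie : e \in OL) (ieV : e^-1 \in OL).
Variables (O : comNzRingType) (k : fieldType) (red : {rmorphism O -> k}).
Hypothesis red_surj : forall y : k, exists x : O, red x = y.
Variable chi : mchar L k.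
Hypothesis p0 : (p%:R : k) = 0.
Hypothesis chi1p : forall a, a \in OL -> chi (1 + p%:R * a) = 1.
Local Notation chibar := (char_rep c chi).
Local Notation ev1_ker := (ev1_ker L_quadratic L_unramified c_nontrivial ce e0 ie ieV p0 chi1p).
Variable A : art red.
Local Notation art_surj := (art_aug_surj red_surj A).

Lemma ind_lift_coinv (M : prelift (Ind chibar) A) : is_lift M -> exists v0 : M,
  lift_map M v0 1%g = 1 /\ forall w, exists a, @uaug _ _ _ c A M setT (w - a *: v0).
Proof.
move=> liftM; have [smM fM surjM bcM] := liftM.
(* Translation by w carries the big cell to a neighbourhood of 1, so b takes the value 1 at 1. *)
pose b := act (Ind chibar) (ww c) (cellf L_quadratic c_nontrivial e (1 : chibar)).
have [v0 v0E] := surjM b; exists v0.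
have v01 : lift_map M v0 1%g = 1.
  rewrite v0E /b ind_actE mul1g -[ww c]mulg1 -(uu0 c) (cellf_cell L_unramified) //.
  - by rewrite mul0r rpred0.
  - exact: (chi_small L_quadratic L_unramified c_nontrivial chi1p).
  - by rewrite rmorph0 oppr0.
split=> // w.
apply: (@uaug_coinv _ _ _ L_quadratic L_unramified _ c_nontrivial e ce e0 A k (aug A)
  (art_local A) (@art_artinian _ _ _ A) art_surj M (Ind chibar) (lift_map M)
  (@lift_mapE _ _ _ _ _ _ M) surjM smM fM bcM (ev1 c chi)) => //.
exact: ev1_ker.
Qed.

Lemma uaug_ind_1 (V : rep A T) (f : Ind V) : @uaug _ _ _ c A (Ind V) setT f -> f 1%g = 0.
Proof.
move=> [z [w [cz _ ->]]]; change (w (1 * uu z)%g - w 1%g = 0).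
by rewrite mul1g ind_uu1 // subrr.
Qed.

(** The character is recovered from coinvariants: h preserves a relation t v0 - a v0 in D, and
    evaluation at 1 kills D, so t acts by the same a on the generators x1 of V and y1 of W. *)
Lemma ind_lift_iso_inj (V W : prelift chibar A) : is_lift V -> is_lift W ->
  lift_iso (Ind_lift V) (Ind_lift W) -> lift_iso V W.
Proof.
move=> lV lW [h [_ hG hphi]].
have lIV := ind_lift_is_lift L_quadratic L_unramified c_nontrivial ce e0 ie ieV red_surj chi1p lV.
have [v0 [v01 coinv]] := ind_lift_coinv lIV.
pose x1 : V := ind_fun v0 1%g; pose y1 : W := ind_fun (h v0) 1%g.
have x1E : lift_map V x1 = 1 by exact: v01.
have y1E : lift_map W y1 = 1.
  by have := congr1 (fun f : Ind chibar => f 1%g) (hphi v0) => /= ->; exact: v01.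
have [genV freeV] := char_lift_gen red_surj lV x1E.
have [genW freeW] := char_lift_gen red_surj lW y1E.
pose xi v := projT1 (cid (genV v)).
have xiE v : v = xi v *: x1 by rewrite /xi; case: cid.
have xiU v a : v = a *: x1 -> xi v = a.
  move=> vE; apply/eqP; rewrite -subr_eq0; apply/eqP/freeV.
  by rewrite scalerBl -xiE vE subrr.
pose H v : W := xi v *: y1.
have H_lin : linear H.
  move=> a v w; rewrite /H scalerA -scalerDl; congr (_ *: _); apply: xiU.
  by rewrite scalerDl -scalerA -!xiE.
pose Hl : {linear V -> W} := HB.pack H (GRing.isLinear.Build A V W *:%R H H_lin).
exists Hl; split.
- exists (fun w => projT1 (cid (genW w)) *: x1) => [v|w].
    case: cid => a /= E; rewrite [RHS]xiE; congr (_ *: _).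
    by apply/eqP; rewrite -subr_eq0; apply/eqP/freeW; rewrite scalerBl -E subrr.
  by case: cid => a /= ->; rewrite /H (xiU _ a).
- move=> t v; have [x x0 tE] := torus_elem L_quadratic c_nontrivial t.
  have [a ua] := coinv (act (Ind V) (tt x) v0).
  have tx1 : act V t x1 = a *: x1.
    have := uaug_ind_1 ua; change (v0 (1 * tt x)%g - a *: x1 = 0 -> act V t x1 = a *: x1).
    rewrite mul1g -[tt x]mulg1 (ind_tt L_quadratic c_nontrivial) // -tE => /eqP.
    by rewrite subr_eq0 => /eqP.
  have ty1 : act W t y1 = a *: y1.
    have : @uaug _ _ _ c A (Ind W) setT (h (act (Ind V) (tt x) v0 - a *: v0)).
      have [z [w [cz _ E]]] := ua; exists z, (h w); split=> //.
      by rewrite [X in h X]E linearB hG.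
    rewrite linearB linearZ /= => /uaug_ind_1.
    have -> : h (ind_act (tt x) v0) = act (Ind W) (tt x) (h v0) by exact: hG.
    change ((h v0 : Ind W) (1 * tt x)%g - a *: y1 = 0 -> act W t y1 = a *: y1).
    rewrite mul1g -[tt x]mulg1 (ind_tt L_quadratic c_nontrivial) // -tE => /eqP.
    by rewrite subr_eq0 => /eqP.
  rewrite /= /H (xiU _ (xi v * a)); last by rewrite {1}(xiE v) linearZ /= tx1 scalerA.
  by rewrite -scalerA -ty1 linearZ.
- by move=> v; rewrite /= /H [in RHS](xiE v) !linearZ /= x1E y1E.
Qed.

Variables (x : L) (kb : k).
Hypotheses (x0 : x != 0) (chi_kb : chi x != kb) (xkb : acts_on_H1 c chi x kb).

Section Surjective.
Variable M : prelift (Ind chibar) A.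
Hypothesis liftM : is_lift M.

(** [ell w] is the coefficient of w along v0 modulo D: it exists by [ind_lift_coinv] and is unique
    by [uaug_free], whence its linearity and equivariance. *)
Lemma ind_lift_functional : exists (v0 : M) (ell : {linear M -> A^o}),
  [/\ ell v0 = 1, forall w, aug A (ell w) = lift_map M w 1%g,
      forall z w, c z = - z -> ell (act M (uu z) w) = ell w
    & forall y w, y != 0 -> ell (act M (tt y) w) = ell (act M (tt y) v0) * ell w].
Proof.
have [smM fM surjM bcM] := liftM; have [v0 [v01 coinv]] := ind_lift_coinv liftM.
have [kap kapE] := art_surj kb.
have free (a : A) : @uaug _ _ _ c A M setT (a *: v0) -> a = 0.
  apply: (@uaug_free _ _ _ L_quadratic L_unramified _ c_nontrivial e ce e0 A k (aug A)
    (art_local A) (@art_artinian _ _ _ A) art_surj M (Ind chibar) (lift_map M)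
    (@lift_mapE _ _ _ _ _ _ M) smM fM bcM (ev1 c chi) chi _ _ v0 v01 x kb x0 chi_kb xkb kap kapE).
  - by move=> z m cz; apply: ev1_uu.
  - by move=> y m y0; apply: ev1_tt.
pose uD := uaugD L_quadratic L_unramified c_nontrivial ce e0 smM (S := setT)
  I (fun _ _ _ _ => I) (fun _ _ _ => I).
pose uZ := uaugZ (c := c) (M := M) (S := setT) (fun _ _ _ => I).
pose uN (v : M) := uaugN (c := c) (M := M) (S := setT) (fun _ _ _ => I) (y := v).
pose l w : A^o := projT1 (cid (coinv w)).
have lP w : @uaug _ _ _ c A M setT (w - l w *: v0) by rewrite /l; case: cid.
have lU w a : @uaug _ _ _ c A M setT (w - a *: v0) -> l w = a.
  move=> ua; apply/eqP; rewrite -subr_eq0; apply/eqP/free.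
  have := uD _ _ ua (uN _ (lP w)); rewrite opprB addrC addrA subrK scalerBl.
  by rewrite addrC.
have l_lin : linear l.
  move=> a v w; apply: lU.
  have := uD _ _ (uZ a _ (lP v)) (lP w).
  by rewrite scalerBr addrACA -opprD scalerA scalerDl.
pose ell : {linear M -> A^o} := HB.pack l (GRing.isLinear.Build A M A^o *:%R l l_lin).
have l0 w : @uaug _ _ _ c A M setT w -> l w = 0.
  by move=> uw; apply: lU; rewrite scale0r subr0.
exists v0, ell; split.
- by apply: lU; rewrite scale1r subrr; apply: uaug0.
- move=> w; have [z [w' [cz _ wE]]] := lP w.
  have : lift_map M (w - l w *: v0) 1%g = 0.
    rewrite wE linearB /= lift_mapE.
    by change (lift_map M w' (1 * uu z)%g - lift_map M w' 1%g = 0); rewrite mul1g ind_uu1 // subrr.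
  rewrite linearB linearZ /=.
  change (lift_map M w 1%g - aug A (l w) * lift_map M v0 1%g = 0 ->
    aug A (l w) = lift_map M w 1%g).
  by rewrite v01 mulr1 => /eqP; rewrite subr_eq0 => /eqP.
- move=> z w cz; have : l (act M (uu z) w - w) = 0 by apply: l0; exists z, w.
  by rewrite -[l]/(ell : M -> A^o) linearB => /eqP; rewrite subr_eq0 => /eqP.
- move=> y w y0; have := l0 _ (uaug_tt L_quadratic c_nontrivial (S := setT) (fun _ _ _ => I) y0 (lP w)).
  rewrite linearB linearZ -[l]/(ell : M -> A^o) linearB linearZ => /eqP; rewrite subr_eq0 => /eqP ->.
  by rewrite mulrC.
Qed.

Lemma ind_lift_surj : exists2 V : prelift chibar A, is_lift V & lift_iso (Ind_lift V) M.
Proof.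
have [smM fM surjM bcM] := liftM.
have [v0 [ell [ell0 ell_aug ell_uu ell_tt]]] := ind_lift_functional.
pose ch (t : T) : A := ell (act M (t : G) v0).
have chM (t : T) w : ell (act M (t : G) w) = ch t * ell w.
  by have [y y0 ->] := torus_elem L_quadratic c_nontrivial t; apply: ell_tt.
pose ca (t : T) (v : A^o) : A^o := ch t *: v.
have ca_lin t : linear (ca t) by move=> a v w; rewrite /ca scalerDr !scalerA mulrC.
pose cal t : {linear A^o -> A^o} := HB.pack (ca t) (GRing.isLinear.Build A A^o A^o *:%R (ca t) (ca_lin t)).
have ca1 v : cal 1%g v = v.
  by rewrite /= /ca /ch -[torus_val 1%g]/(1%g : G) act1 ell0 scale1r.
have caM s t v : cal (s * t)%g v = cal s (cal t v).
  rewrite /= /ca scalerA; congr (_ *: _).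
  by rewrite {1}/ch -[torus_val (s * t)%g]/(torus_val s * torus_val t)%g actM chM.
pose VR := @Rep A T A^o cal ca1 caM.
pose vm (v : VR) : chibar := aug A v.
have vm_lin : linear_for (aug A \; *:%R) vm.
  by move=> a v w; rewrite /vm rmorphD rmorphM.
pose vml : {linear VR -> chibar | aug A \; *:%R} :=
  HB.pack vm (GRing.isLinear.Build A VR chibar (aug A \; *:%R) vm vm_lin).
have vmE t v : vml (act VR t v) = act chibar t (vml v).
  have [y y0 ->] := torus_elem L_quadratic c_nontrivial t.
  rewrite (char_ttE L_quadratic c_nontrivial) //=.
  rewrite /vm /ca [aug A _](rmorphM (aug A)); congr (_ * _).
  rewrite /ch ell_aug lift_mapE; change (lift_map M v0 (1 * tt y)%g = chi y).
  rewrite mul1g -[tt y]mulg1 (ind_tt L_quadratic c_nontrivial) // (char_ttE L_quadratic c_nontrivial) //.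
  by rewrite -ell_aug ell0 rmorph1 [_ *: _]mulr1.
pose V := @Prelift O k red T chibar A VR vml vmE.
have b1 (R : comNzRingType) : @basis_fam R R^o unit setT (fun=> 1).
  split=> [s a us _|w]; last first.
    by exists [:: Datatypes.tt], (fun=> w); rewrite big_seq1 [_ *: _]mulr1.
  case: s us => [|[] [|[] s]] //= _; rewrite big_seq1 [_ *: _]mulr1 => a0 i.
  by case: i.
have liftV : is_lift V.
  split.
  - move=> v; have [N NP] := smooth_small smM v0.
    pose S := [set t : T | act VR t v = v].
    (* Torus elements congruent to 1 at level N fix v0, so [ch] is 1 on them and the stabiliser of v
       is a union of cosets. *)
    exists (\bigcup_(t in S) [set g : G | cong N ((t : G)^-1 * g * 1)%g]).
      apply: bigcup_open => t _; exact: (u11_open_translate _ _ (cong_open c N)).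
    apply/seteqP; split=> [t [s /= Ss]|t /= St].
      rewrite mulg1 => /NP E; have -> : t = (s * (s^-1 * t))%g by rewrite mulVKg.
      have e1 : ch (s^-1 * t)%g = 1 by rewrite /ch -[torus_val _]/((torus_val s)^-1 * torus_val t)%g E ell0.
      by rewrite -[LHS]/(cal (s * (s^-1 * t))%g v) caM /= {2}/ca e1 scale1r.
    by exists t => //=; rewrite mulVg mulg1; apply: cong1.
  - by apply: (@basis_fam_free A VR unit setT (fun=> 1)); [case; case|exact: b1].
  - by move=> w; have [a aE] := art_surj w; exists a.
  - apply: (base_change_of_basis (B := setT) (e := fun _ : unit => 1 : A^o)).
      by have [] := b1 A.
    rewrite (_ : (fun=> _) = (fun=> 1)); first exact: b1.
    by apply/funext => i; rewrite /= /vm rmorph1.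
exists V => //; apply: lift_iso_sym.
have PhiP w : (fun g => ell (act M g w) : V) \in @in_ind _ _ _ c A V.
  apply/asboolP; split.
    move=> b g t bB btU.
    (* The factor t^-1 b is some u(s), under which [ell] is invariant, so b acts through [ch t]. *)
    have -> : (b * g)%g = ((t : G) * ((t : G)^-1 * b * g))%g by rewrite !mulgA mulgV mul1g.
    have [nb n00 n11] := btU.
    have [_ [s cs E]] := bruhat_borel L_quadratic c_nontrivial nb.
    rewrite n00 in E; rewrite actM chM; congr (_ * _).
    have tt1 : tt 1 = 1%g by have := congr1 val (ttT1 L_quadratic c_nontrivial).
    by rewrite E tt1 mul1g actM ell_uu.
  have [N NP] := smooth_small smM w.
  exists [set g | cong N g]; first exact: cong_open_subgroup.
  by move=> g h /NP E; rewrite actM E.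
pose Phi w : Ind V := MkInd (PhiP w).
have Phi_lin : linear Phi.
  by move=> a v w; apply/val_inj/funext => g /=; rewrite !linearP.
pose Phil : {linear M -> Ind V} := HB.pack Phi (GRing.isLinear.Build A M (Ind V) *:%R Phi Phi_lin).
apply: (@ind_lift_iso_of_map _ _ _ L_quadratic L_unramified _ c_nontrivial
  e ce e0 ie ieV _ _ _ red_surj chi A M V Phil) => //.
- by move=> g v; apply/val_inj/funext => h /=; rewrite actM.
- move=> v; apply/val_inj/funext => g /=.
  by rewrite /vm ell_aug lift_mapE; change (lift_map M v (1 * g)%g = lift_map M v g); rewrite mul1g.
Qed.
End Surjective.
End Equivalence.

(** * Genericity *)

(** Pigeonhole: for odd p more than half of the residues are squares, so the squares and their image
    under y -> g + d y meet. For p = 2 every element is its own square. *)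
Lemma Fp_norm_form (p : nat) (p_pr : prime p) (d g : 'F_p) : d != 0 ->
  exists a b : 'F_p, a ^+ 2 = g + d * b ^+ 2.
Proof.
move=> d0; pose sq (x : 'F_p) := x ^+ 2; pose S := [set sq x | x in [set: 'F_p]]%SET.
have [p2|p_odd] := even_prime p_pr.
  exists g, 0; rewrite expr0n mulr0 addr0.
  have E := expf_card g; rewrite card_Fp // in E.
  by rewrite -[RHS]E; congr (_ ^+ _).
have cardS : (p < #|S| + #|S|)%N.
  suff le : (p <= #|S| * 2)%N.
    rewrite addnn -muln2 ltn_neqAle le andbT; apply: contraL p_odd => /eqP ->.
    by rewrite muln2 odd_double.
  (* The flag tells x from -x, so a square has at most two preimages and p <= 2 #|S|; parity makes
     this strict. *)
  pose h (x : 'F_p) : 'F_p * bool := (sq x, (x : nat) <= (- x : 'F_p))%N.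
  have h_inj : injective h.
    move=> x y hxy; have /eqP := congr1 fst hxy; rewrite /= /sq eqf_sqr.
    case/orP=> /eqP // xE;
    have : ((x : nat) <= (- x : 'F_p))%N = ((y : nat) <= (- y : 'F_p))%N := congr1 snd hxy.
    rewrite xE opprK.
    by case: ltngtP => // /val_inj.
  rewrite -{1}(card_Fp p_pr) -cardsT -(card_imset _ h_inj).
  apply: (@leq_trans #|finset.setX S [set: bool]%SET|); last by rewrite cardsX cardsT card_bool.
  apply: subset_leq_card.
  by apply/fintype.subsetP => _ /imsetP[x _ ->]; rewrite finset.in_setX finset.in_setT andbT; apply: imset_f.
pose f (x : 'F_p) := g + d * x.
have f_inj : injective f by move=> x y /addrI/(mulfI d0).
have : S :&: [set f x | x in S]%SET != finset.set0.
  rewrite -card_gt0; have := cardsUI S [set f x | x in S]%SET.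
  rewrite (card_imset _ f_inj) => E; rewrite -(ltn_add2l #|S :|: [set f x | x in S]%SET|) E addn0.
  apply: leq_ltn_trans cardS; rewrite -[X in (_ <= X)%N](card_Fp p_pr).
  exact: max_card.
move=> /set0Pn[y]; rewrite inE => /andP[/imsetP[a _ ->] /imsetP[_ /imsetP[b _ ->]]].
by rewrite /f /sq => E; exists a, b.
Qed.

(** Otherwise X^m - 1 would have p - 1 roots, more than its degree. *)
Lemma Fp_not_root (p : nat) (p_pr : prime p) (m : nat) : (0 < m < p.-1)%N ->
  exists2 g : 'F_p, g != 0 & g ^+ m != 1.
Proof.
move=> /andP[m0 mp]; apply: contrapT => no.
pose rs := enum [set~ (0 : 'F_p)]%SET.
have : (size rs <= m)%N.
  apply: max_unity_roots m0 _ (enum_uniq _); apply/allP => g.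
  rewrite mem_enum !inE unity_rootE => g0.
  by apply: contraT => gm; case: no; exists g.
by rewrite -cardE cardsC1 card_Fp // leqNgt mp.
Qed.

Lemma natr_eq_pchar (R : nzRingType) (p m n : nat) : p \in [pchar R] ->
  (m%:R == n%:R :> R) = (m == n %[mod p])%N.
Proof.
move=> pR; wlog le : m n / (n <= m)%N.
  by move=> W; have [/W //|/ltnW/W E] := leqP n m; rewrite eq_sym E eq_sym.
by rewrite eqn_mod_dvd // (dvdn_pcharf pR) natrB // subr_eq0.
Qed.

Section NormElement.
Variables (p : nat) (p_pr : prime p) (L : fieldExtType (Qp p_pr)).
Hypotheses (L_quadratic : \dim {: L} = 2%N) (L_unramified : unramified L).
Variable c : {lrmorphism L -> L}.
Hypothesis c_nontrivial : exists x : L, c x <> x.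
Local Notation OL := (@integral _ _ L).

Lemma near_nat_unit (g : nat) (n a : L) : ~~ (p %| g)%N -> a \in OL ->
  n = g%:R + p%:R * a -> n != 0 /\ n^-1 \in OL.
Proof.
move=> pg ia nE; have g0 : (0 < g)%N by case: g pg {nE} => [|//]; rewrite dvdn0.
have [u v uv _] := egcdnP p g0.
have gcd1 : gcdn g p = 1%N.
  by apply/eqP; have := pg; rewrite -prime_coprime // coprime_sym.
rewrite gcd1 in uv.
have E : u%:R * n = 1 + p%:R * (v%:R + u%:R * a).
  rewrite nE mulrDr -natrM uv natrD natrM; ring.
have iva : v%:R + u%:R * a \in OL by rewrite rpredD ?rpredM ?rpred_nat.
have un0 : u%:R * n != 0 by rewrite E (one_plus_p_neq0 L_unramified).
have n0 : n != 0 by apply: contraNneq un0 => ->; rewrite mulr0.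
split=> //; have -> : n^-1 = u%:R * (1 + p%:R * (v%:R + u%:R * a))^-1.
  rewrite -E invfM mulrA divff ?mul1r //.
  by apply: contraNneq un0 => ->; rewrite mul0r.
rewrite rpredM ?rpred_nat //.
exact: (one_plus_p_inv L_quadratic L_unramified c_nontrivial).
Qed.

(** The norm of a + b e is a^2 - e^2 b^2 for e of trace zero; with d the nonzero residue of e^2, the
    equation modulo p is [Fp_norm_form]. *)
Lemma ex_norm_mod_p (g : 'F_p) : exists x a, [/\ x \in OL, a \in OL & x * c x = (g : nat)%:R + p%:R * a].
Proof.
have [e ce [ie e0 iee]] := ex_trace0_unit L_quadratic L_unramified c_nontrivial.
have cee : c (e * e) = e * e by rewrite rmorphM /= ce mulrNN.
have iee' : e * e \in OL by rewrite rpredM.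
have [d [b [ltd cb ib eeE]]] := fixed_approx L_quadratic L_unramified c_nontrivial 1 cee iee'.
rewrite expr1 in eeE; rewrite expn1 in ltd.
have d0 : (d%:R : 'F_p) != 0.
  rewrite -(dvdn_pcharf (pchar_Fp p_pr)); apply/negP => /dvdnP[d' d'E].
  apply: (@pO_absurd _ _ _ L_unramified ((d'%:R + b) * (e * e)^-1)).
    by rewrite rpredM // rpredD ?rpred_nat.
  have -> : p%:R * ((d'%:R + b) / (e * e)) = (d%:R + p%:R * b) / (e * e).
    by rewrite d'E natrM; ring.
  by rewrite -eeE divff // mulf_neq0.
have [a' [b' ab]] := Fp_norm_form p_pr g d0.
have /eqP E : ((a' : nat) ^ 2 == g + d * (b' : nat) ^ 2 %[mod p])%N.
  rewrite -(natr_eq_pchar _ _ (pchar_Fp p_pr)) natrD natrM !natrX !natr_Zp.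
  by rewrite ab.
pose A := ((a' : nat) ^ 2)%N; pose B := (g + d * (b' : nat) ^ 2)%N.
have AE : (A%:R : L) = (A %% p)%:R + p%:R * (A %/ p)%:R.
  by rewrite -natrM -natrD mulnC addnC -divn_eq.
have BE : (B%:R : L) = (B %% p)%:R + p%:R * (B %/ p)%:R.
  by rewrite -natrM -natrD mulnC addnC -divn_eq.
exists ((a' : nat)%:R + (b' : nat)%:R * e), ((A %/ p)%:R - (B %/ p)%:R - b * (b' : nat)%:R ^+ 2); split.
- by rewrite rpredD ?rpredM ?rpred_nat.
- by rewrite !rpredB ?rpredM ?rpredX ?rpred_nat.
have ABE : (A%:R : L) - B%:R = p%:R * ((A %/ p)%:R - (B %/ p)%:R).
  by rewrite AE BE -/A -/B E; ring.
have A2 : (A%:R : L) = (a' : nat)%:R ^+ 2 by rewrite natrX.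
have B2 : (B%:R : L) = (g : nat)%:R + d%:R * (b' : nat)%:R ^+ 2 by rewrite natrD natrM natrX.
rewrite rmorphD rmorphM /= !c_nat ce.
transitivity (A%:R - (b' : nat)%:R ^+ 2 * (e * e)); first by rewrite A2; ring.
rewrite eeE mulrBr -ABE B2; ring.
Qed.
End NormElement.

Section Characters.
Variables (p : nat) (p_pr : prime p) (L : fieldExtType (Qp p_pr)).
Hypotheses (L_quadratic : \dim {: L} = 2%N) (L_unramified : unramified L).
Variable c : {lrmorphism L -> L}.
Hypothesis c_nontrivial : exists x : L, c x <> x.
Variables (kL : fieldType) (redL : {rmorphism intring L -> kL}).
Hypothesis redL_surj : forall y : kL, exists x : intring L, redL x = y.
Variables (k : fieldType) (iota : {rmorphism kL -> k}).
Variables (lambda : k) (r : int) (mu omega : mchar L k).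
Hypotheses (mu_lambda : is_mu lambda mu)
  (omega_red : is_omega (fun u : intring L => iota (redL u)) omega).
Local Notation OL := (@integral _ _ L).
Local Notation chi := (twist mu omega r).

(** If p had a nonzero image, surjectivity would give y with 1 - p y reducing to 0, although 1 - p y
    is a unit. *)
Lemma redL_p : redL p%:R = 0.
Proof.
apply: contrapT => /eqP np; have [y yE] := redL_surj (redL p%:R)^-1.
have iy : - val y \in OL by rewrite rpredN; apply: intring_valP.
pose u : intring L := 1 - p%:R * y.
have uE : val u = 1 + p%:R * - val y by rewrite rmorphB rmorphM rmorph1 rmorph_nat mulrN.
pose v : intring L := MkIntring (one_plus_p_inv L_quadratic L_unramified c_nontrivial iy).
have uv : u * v = 1.
  apply: val_inj; rewrite rmorphM rmorph1; change (val u / (1 + p%:R * - val y) = 1).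
  rewrite uE; apply: mulfV.
  exact: (one_plus_p_neq0 L_unramified).
have := congr1 redL uv; rewrite rmorphM rmorph1 rmorphB rmorph1 rmorphM yE mulfV //.
by rewrite subrr mul0r => /esym/eqP; rewrite oner_eq0.
Qed.

Lemma pchar_k : p \in [pchar k].
Proof.
by rewrite inE /= p_pr; have := congr1 iota redL_p; rewrite !rmorph_nat rmorph0 => ->; rewrite eqxx.
Qed.

Lemma chi_unit (x : L) (ix : x \in OL) : x != 0 -> x^-1 \in OL ->
  chi x = iota (redL (MkIntring ix)) ^ r.
Proof.
move=> x0 ixV; have ux : is_unit (MkIntring ix).
  by exists (MkIntring ixV); apply: val_inj; rewrite rmorphM rmorph1 /= mulfV.
have [_ muU] := mu_lambda; have [_ omU] := omega_red.
by rewrite /= /twist_fun (muU _ ux) mul1r (omU _ ux).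
Qed.

Lemma redL_near_nat (g : nat) (a : L) (x : intring L) : a \in OL ->
  val x = g%:R + p%:R * a -> redL x = g%:R.
Proof.
move=> ia xE; have -> : x = g%:R + p%:R * MkIntring ia.
  by apply: val_inj; rewrite rmorphD rmorphM !rmorph_nat.
by rewrite rmorphD rmorphM redL_p mul0r addr0 rmorph_nat.
Qed.

Lemma chi_one_plus_p a : a \in OL -> chi (1 + p%:R * a) = 1.
Proof.
move=> ia; have i1 : 1 + p%:R * a \in OL by rewrite rpredD ?rpred1 ?rpredM ?rpred_nat.
rewrite (chi_unit i1); last 2 first.
- exact: (one_plus_p_neq0 L_unramified).
- exact: (one_plus_p_inv L_quadratic L_unramified c_nontrivial).
by rewrite (@redL_near_nat 1 a) // rmorph1 exp1rz.
Qed.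

Lemma ex_H1_element :
  (lambda <> 1 /\ lambda <> -1) \/ ~ (((p - 1)%N%:Z %| r - 1)%Z) ->
  exists x kb, [/\ x != 0, chi x != kb & acts_on_H1 c chi x kb].
Proof.
have kp := pchar_k; have p0 := pcharf0 kp.
have [mup muU] := mu_lambda; have [omp omU] := omega_red.
case=> [[l1 lm1]|ndvd].
  exists p%:R, (chi p%:R)^-1; split; first exact: p_neq0; last first.
    exact: (acts_on_H1_p L_quadratic L_unramified c_nontrivial p0 chi_one_plus_p).
  rewrite /= /twist_fun mup omp exp1rz mulr1.
  have l0 : lambda != 0 by rewrite -mup; apply: mchar_neq0; apply: p_neq0.
  apply/eqP => E; have : lambda ^+ 2 == 1 by rewrite expr2 {2}E mulfV.
  by rewrite sqrf_eq1 => /orP[/eqP/l1|/eqP/lm1].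
(* r - 1 may be negative or large; its residue modulo p - 1 is an exponent for which roots can be
   counted. *)
pose m := `|((r - 1) %% (p - 1)%N%:Z)%Z|%N.
have p1 : (0 < p - 1)%N by rewrite subn_gt0 prime_gt1.
have mE : ((r - 1) %% (p - 1)%N%:Z)%Z = m%:Z by rewrite gez0_abs // modz_ge0 // -lt0n.
have m_bd : (0 < m < p.-1)%N.
  rewrite -subn1; apply/andP; split; last first.
    by rewrite -ltz_nat -mE ltz_pmod // ltz_nat.
  rewrite lt0n; apply/eqP => m0; apply: ndvd; apply/dvdz_mod0P.
  by rewrite mE m0.
have [g g0 gm] := Fp_not_root p_pr m_bd.
have [x [a [ix ia nE]]] := ex_norm_mod_p L_quadratic L_unramified c_nontrivial g.
have pg : ~~ (p %| g)%N by rewrite (dvdn_pcharf (pchar_Fp p_pr)) natr_Zp.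
have [n0 inV] := near_nat_unit L_quadratic L_unramified c_nontrivial pg ia nE.
have x0 : x != 0 by apply: contraNneq n0 => ->; rewrite mul0r.
have icx := c_integral c ix.
have cx0 : c x != 0 by rewrite fmorph_eq0.
have ixV : x^-1 \in OL.
  suff -> : x^-1 = c x * (x * c x)^-1 by rewrite rpredM.
  by rewrite invfM mulrCA mulfV ?mulr1.
have ic : x * c x \in OL by rewrite rpredM.
pose gk : k := (g : nat)%:R.
have chin : chi (x * c x) = gk ^ r.
  by rewrite (chi_unit ic n0 inV) (@redL_near_nat g a) // rmorph_nat.
exists x, (gk * chi (c x)^-1); split=> //; last first.
  apply: (acts_on_H1_unit L_quadratic L_unramified c_nontrivial p0 chi_one_plus_p) => //.
  move=> q b ib qE; rewrite /gk -[LHS](rmorph_nat iota) -(@redL_near_nat q b (MkIntring ic)) //.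
  by rewrite (@redL_near_nat g a) // rmorph_nat.
have gk0 : gk != 0 by rewrite -(dvdn_pcharf kp).
(* Multiplying the equality of eigenvalues by chi(c x) gives chi(x c(x)) = gk, that is gk^r = gk. *)
apply/eqP => E; have : gk ^ r = gk.
  have chiV : chi (c x)^-1 * chi (c x) = 1.
    by rewrite -mcharM ?invr_neq0 // mulVf // mchar1.
  by rewrite -chin mcharM // E -mulrA chiV mulr1.
move=> gr; have gr1 : gk ^ (r - 1) = 1 by rewrite expfzDr // gr exprN1 mulfV.
have gp : gk ^+ (p - 1) = 1.
  have : (g : nat) ^ (p - 1) == 1 %[mod p].
    rewrite -(natr_eq_pchar _ _ (pchar_Fp p_pr)) natrX natr_Zp subn1.
    apply/eqP; apply: (mulfI g0); rewrite -exprS prednK ?prime_gt0 // mulr1.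
    by have := expf_card g; rewrite card_Fp.
  by rewrite -(natr_eq_pchar _ _ kp) natrX => /eqP.
have : gk ^+ m = 1.
  rewrite -[RHS]gr1 [in RHS](divz_eq (r - 1) (p - 1)%N%:Z) mE expfzDr //.
  have -> : gk ^ (((r - 1) %/ (p - 1)%N%:Z)%Z * (p - 1)%N%:Z) = 1; last by rewrite mul1r.
  by rewrite mulrC -exprz_exp -exprnP gp exp1rz.
rewrite /gk -natrX => /eqP; rewrite -[1]/(1%:R) (natr_eq_pchar _ _ kp).
rewrite -(natr_eq_pchar _ _ (pchar_Fp p_pr)) natrX natr_Zp => E1.
by rewrite E1 in gm.
Qed.
End Characters.

Theorem mainTheorem3 (p : nat) (p_pr : prime p)
  (* L = Q_{p^2}, with residue field kL and nontrivial automorphism c over Q_p *)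
  (L : fieldExtType (Qp p_pr)) (L_quadratic : \dim {: L} = 2%N)
  (L_unramified : unramified L)
  (c : {lrmorphism L -> L}) (c_nontrivial : exists x : L, c x <> x)
  (kL : fieldType) (redL : {rmorphism intring L -> kL})
  (redL_surj : forall y : kL, exists x : intring L, redL x = y)
  (* the coefficients: E / Q_p finite, O = intring E, residue field k *)
  (E : fieldExtType (Qp p_pr))
  (k : fieldType) (red : {rmorphism intring E -> k})
  (red_surj : forall y : k, exists x : intring E, red x = y)
  (iota : {rmorphism kL -> k})
  (* chibar = mu_lambda * omega^r *)
  (lambda : k) (lambda_neq0 : lambda != 0) (r : int)
  (mu : mchar L k) (mu_lambda : is_mu lambda mu)
  (omega : mchar L k)
  (omega_red : is_omega (fun u : intring L => iota (redL u)) omega)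
  (generic : (lambda <> 1 /\ lambda <> -1) \/
             ~ (((p - 1)%N%:Z %| r - 1)%Z)) :
  let chibar : rep k (torus c) := char_rep c (twist mu omega r) in
  exists Phi : forall A : art red, Def chibar A -> Def (Ind chibar) A,
  [/\ forall (A : art red) (X : Def chibar A) (V : prelift chibar A),
        sval X V -> sval (Phi A X) (Ind_lift V),
      forall (A B : art red) (f : {lrmorphism A -> B}), local_hom f ->
        forall (X : Def chibar A) (Y : Def chibar B),
        Def_map f X Y -> Def_map f (Phi A X) (Phi B Y)
    & forall A : art red, bijective (Phi A)].
Proof.
move=> chibar.
have [e ce [ie e0 iee]] := ex_trace0_unit L_quadratic L_unramified c_nontrivial.
have ieV : e^-1 \in @integral _ _ L.
  suff -> : e^-1 = e * (e * e)^-1 by rewrite rpredM.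
  by rewrite invfM mulrA mulfV ?mul1r.
have p0 := pcharf0 (pchar_k L_quadratic L_unramified c_nontrivial redL_surj iota).
have chi1p := chi_one_plus_p L_quadratic L_unramified c_nontrivial redL_surj r mu_lambda omega_red.
have [x [kb [x0 xkb H1x]]] := ex_H1_element L_quadratic L_unramified c_nontrivial redL_surj
  mu_lambda omega_red generic.
have lift_Ind (A : art red) (V : prelift chibar A) : is_lift V -> is_lift (Ind_lift V).
  exact: (ind_lift_is_lift L_quadratic L_unramified c_nontrivial ce e0 ie ieV red_surj chi1p).
pose rp (A : art red) (X : Def chibar A) := projT1 (cid (Def_inhabited X)).
have rpP A X : sval X (@rp A X) by rewrite /rp; case: cid.
have rp_lift A X : is_lift (@rp A X) by have [] := Def_class (rpP A X).
pose Phi A (X : Def chibar A) : Def (Ind chibar) A := Def_of (lift_Ind A _ (rp_lift A X)).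
have PhiP (A : art red) (X : Def chibar A) (V : prelift chibar A) :
    sval X V -> sval (Phi A X) (Ind_lift V).
  move=> XV; have [lV XE] := Def_class XV; split; first exact: (lift_Ind _ _ lV).
  apply: (ind_lift_iso L_quadratic L_unramified c_nontrivial ce e0 ie ieV red_surj chi1p) => //.
  by apply: lift_iso_sym; have [] := (XE (rp A X)).1 (rpP A X).
exists Phi; split=> // [A B f _ X Y [V [W [XV YW [j [jT jphi _]]]]]|A].
  have [lV _] := Def_class XV; have [lW _] := Def_class YW.
  exists (Ind_lift V), (Ind_lift W); split; [exact: (PhiP _ _ _ XV)|exact: (PhiP _ _ _ YW)|].
  exact: (ind_base_change L_quadratic L_unramified c_nontrivial ce e0 ie ieV red_surj chi1p
    lV lW jT jphi).
have inj : injective (Phi A).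
  move=> X Y XY; have [lV _] := Def_class (rpP A X); have [lW _] := Def_class (rpP A Y).
  apply: (Def_eq (rpP A X) (rpP A Y)).
  apply: (ind_lift_iso_inj L_quadratic L_unramified c_nontrivial ce e0 ie ieV red_surj p0 chi1p) => //.
  have := PhiP _ _ _ (rpP A Y); rewrite -XY => PX.
  by have [_ /(_ _)] := Def_class (PhiP _ _ _ (rpP A X)) => /(_ (Ind_lift (rp A Y))) [/(_ PX)[]].
have surj Y : exists X, Phi A X = Y.
  have [M YM] := Def_inhabited Y; have [lM _] := Def_class YM.
  have [V lV iso] := ind_lift_surj L_quadratic L_unramified c_nontrivial ce e0 ie ieV
    red_surj p0 chi1p x0 xkb H1x lM.
  exists (Def_of lV); apply: (Def_eq (PhiP _ _ _ (Def_of_self lV)) YM iso).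
exists (fun Y => projT1 (cid (surj Y))) => [X|Y]; last by case: cid.
by apply: inj; case: cid.
Qed.
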